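(* Let $T>0$, $1\le p<\infty$, let $\alpha=m-1+\sigma$ with $m\in\mathbb{N}$ and $0<\sigma<1$, and let $\varepsilon>0$ be arbitrarily given such that $0<\varepsilon<\alpha$. Then: (i) There exists a constant $C=C(\alpha,\varepsilon)>0$ (for the fixed $p$ and $T$) such that $$\Vert J^{\alpha}v\Vert_{W^{\alpha-\varepsilon,p}(0,T)}\le C\Vert v\Vert_{L^p(0,T)}\quad\text{for all } v\in L^p(0,T),$$ and $$W_{\alpha,p}(0,T)\subset {}_{0}W^{\alpha-\varepsilon,p}(0,T).$$ (ii) We have $${}_{0}W^{\alpha+\varepsilon,p}(0,T)\subset W_{\alpha,p}(0,T)$$ and $$J^{\alpha}\left(\frac{d^m}{dt^m}J^{m-\alpha}u\right)(t)=u(t)\quad\text{for each } u\in {}_{0}W^{\alpha+\varepsilon,p}(0,T).$$ (iii) The embedding $W_{\alpha+\varepsilon,p}(0,T)\to W_{\alpha,p}(0,T)$ is compact.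
   Context: All functions are real-valued; $\mathbb{N}=\{1,2,3,\dots\}$; derivatives are weak derivatives. Riemann-Liouville integral: for $\alpha>0$ and $v\in L^1(0,T)$, $J^{\alpha}v(t)=\frac{1}{\Gamma(\alpha)}\int_0^t(t-s)^{\alpha-1}v(s)\,ds$, $0<t<T$. It maps $L^p(0,T)$ into itself and is injective there. For $\alpha>0$, $W_{\alpha,p}(0,T):=J^{\alpha}L^p(0,T)$ (the range of $J^\alpha$ on $L^p(0,T)$), with norm $\Vert u\Vert_{W_{\alpha,p}(0,T)}:=\Vert (J^{\alpha})^{-1}u\Vert_{L^p(0,T)}$. Sobolev-Slobodecki spaces: for $s=k-1+\theta$ with $k\in\mathbb{N}$, $0<\theta<1$, $W^{s,p}(0,T)$ is the set of $u\in L^p(0,T)$ with $$\Vert u\Vert_{W^{s,p}(0,T)}:=\left(\Vert u\Vert^p_{W^{k-1,p}(0,T)}+\int_0^T\int_0^T\frac{\left|\frac{d^{k-1}u}{dt^{k-1}}(t)-\frac{d^{k-1}u}{dt^{k-1}}(\xi)\right|^p}{|t-\xi|^{1+\theta p}}\,dt\,d\xi\right)^{1/p}<\infty,$$ where for nonnegative integers $j$, $W^{j,p}(0,T)$ is the usual Sobolev space and $W^{0,p}(0,T)=L^p(0,T)$. For $k\in\mathbb{N}$, ${}_{0}C^k[0,T]:=\{v\in C^k[0,T]: \frac{d^jv}{dt^j}(0)=0 \text{ for } j=0,1,\dots,k-1\}$. For $s=k-1+\theta$ with $k\in\mathbb{N}$, $0<\theta<1$, ${}_{0}W^{s,p}(0,T)$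 is the closure of ${}_{0}C^k[0,T]$ in $W^{s,p}(0,T)$. For an integer $s=k\ge1$, ${}_{0}W^{k,p}(0,T)$ is the closure of ${}_{0}C^k[0,T]$ in $W^{k,p}(0,T)$. *)

(* Defs.v *)
From mathcomp Require Import all_boot all_order all_algebra.
From mathcomp Require Import all_classical all_reals all_analysis.

Set Implicit Arguments.
Unset Strict Implicit.
Unset Printing Implicit Defensive.

Import Order.TTheory GRing.Theory Num.Theory.
Import numFieldNormedType.Exports.

Local Open Scope classical_set_scope.
Local Open Scope ring_scope.

(* Functions on (0,T) are represented by functions R -> R whose values outside
   (0,T) (outside [0,T] for C^k[0,T]) are irrelevant. A class of functions
   modulo a.e. equality is represented by its Borel measurable members: the
   library's Lebesgue measure lives on the Borel sigma-algebra. *)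

Definition Lp_norm (R : realType) (p T : R) (u : R -> R) : \bar R :=
  'N[@lebesgue_measure R]_p%:E[EFin \o (u \_ `]0%R, T[)]%E.

Definition Lp (R : realType) (p T : R) : set (R -> R) :=
  [set u | u \_ `]0, T[ \in Lfun (@lebesgue_measure R) p%:E].

Definition eq_ae0T (R : realType) (T : R) (u v : R -> R) : Prop :=
  ae_eq (@lebesgue_measure R) `]0, T[%classic u v.

(** Fractional integrals *)

Definition Gamma (R : realType) (a : R) : R :=
  \int[@lebesgue_measure R]_(x in `]0, +oo[) (x `^ (a - 1) * expR (- x)).

Definition RLint (R : realType) (a : R) (v : R -> R) : R -> R := fun t =>
  (Gamma a)^-1 *
  \int[@lebesgue_measure R]_(s in `]0, t[) ((t - s) `^ (a - 1) * v s).

Definition RLspace (R : realType) (a p T : R) : set (R -> R) :=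
  [set u | Lp p T u /\ exists2 v, Lp p T v & eq_ae0T T (RLint a v) u].

(* J^a is injective on L^p(0,T), so the chosen v is unique up to a.e.
   equality. *)
Definition RLint_inv (R : realType) (a p T : R) (u : R -> R) : R -> R :=
  xget (fun=> 0) [set v | Lp p T v /\ eq_ae0T T (RLint a v) u].

Definition RLspace_norm (R : realType) (a p T : R) (u : R -> R) : \bar R :=
  Lp_norm p T (RLint_inv a p T u).

(** Weak derivatives and Sobolev-Slobodecki spaces *)

Definition test_function (R : realType) (T : R) (phi : R -> R) : Prop :=
  (forall n x, derivable (derive1n n phi) x 1) /\
  exists K : set R, [/\ compact K, K `<=` `]0, T[ &
    forall x, ~ K x -> phi x = 0].

Definition is_wderiv (R : realType) (T : R) (j : nat) (f w : R -> R) : Prop :=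
  [/\ locally_integrable `]0, T[ f, locally_integrable `]0, T[ w &
    forall phi, test_function T phi ->
      \int[@lebesgue_measure R]_(t in `]0, T[) (f t * derive1n j phi t) =
      (-1) ^+ j * \int[@lebesgue_measure R]_(t in `]0, T[) (w t * phi t)].

(* The value is determined up to a.e. equality on (0,T) when the weak
   derivative exists, and is a junk value otherwise. *)
Definition wderiv (R : realType) (T : R) (j : nat) (f : R -> R) : R -> R :=
  if j is 0%N then f else xget (fun=> 0) [set w | is_wderiv T j f w].

Definition sobolev (R : realType) (j : nat) (p T : R) : set (R -> R) :=
  [set u | Lp p T u /\
    forall i, (i <= j)%N -> exists2 w, is_wderiv T i u w & Lp p T w].

Definition sobolev_norm (R : realType) (j : nat) (p T : R) (u : R -> R)
    : \bar R :=
  ((\sum_(i < j.+1) Lp_norm p T (wderiv T i u) `^ p) `^ p^-1)%E.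

(* On the diagonal the integrand is 0 by the convention 0^-1 = 0. *)
Definition gagliardo (R : realType) (theta p T : R) (g : R -> R) : \bar R :=
  (\int[@lebesgue_measure R]_(xi in `]0%R, T[)
   \int[@lebesgue_measure R]_(t in `]0%R, T[)
     (`|g t - g xi| `^ p / `|t - xi| `^ (1 + theta * p))%R%:E)%E.

(* For s >= 0, [Num.truncn s] is the integer part of s, hence equals k - 1 when
   s = k - 1 + theta with 0 < theta < 1, and s itself when s is an integer. *)
Definition slobodecki_norm (R : realType) (s p T : R) (u : R -> R) : \bar R :=
  let j := Num.truncn s in
  let theta := s - j%:R in
  if theta == 0 then sobolev_norm j p T u
  else ((sobolev_norm j p T u `^ p + gagliardo theta p T (wderiv T j u))
          `^ p^-1)%E.

Definition slobodecki (R : realType) (s p T : R) : set (R -> R) :=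
  [set u | sobolev (Num.truncn s) p T u /\ (slobodecki_norm s p T u < +oo)%E].

(* [d j] is the j-th derivative on [0,T], one-sided at the endpoints. *)
Definition Ck_derivs (R : realType) (k : nat) (T : R) (d : nat -> R -> R)
    : Prop :=
  (forall j, (j <= k)%N -> {within `[0, T], continuous (d j)}) /\
  (forall j (t : R), (j < k)%N -> t \in `[0, T] ->
    (fun s => (d j s - d j t) / (s - t)) @ within `[0, T] t^' --> d j.+1 t).

Definition zeroC (R : realType) (k : nat) (T : R) : set (R -> R) :=
  [set v | exists2 d, Ck_derivs k T d /\ d 0%N = v &
    forall j, (j < k)%N -> d j 0 = 0].

Definition smoothness (R : realType) (s : R) : nat :=
  let j := Num.truncn s in if s == j%:R then j else j.+1.

Definition zeroW (R : realType) (s p T : R) : set (R -> R) :=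
  [set u | slobodecki s p T u /\
    forall e : R, 0 < e -> exists2 v, zeroC (smoothness s) T v &
      (slobodecki_norm s p T (u \- v)%R < e%:E)%E].

(* A continuous inclusion mapping bounded sequences to sequences with a
   subsequence converging in the target space. *)
Definition compact_embedding (R : realType)
    (X : set (R -> R)) (normX : (R -> R) -> \bar R)
    (Y : set (R -> R)) (normY : (R -> R) -> \bar R) : Prop :=
  [/\ X `<=` Y,
      exists C : R, forall u, X u -> (normY u <= C%:E * normX u)%E &
      forall u : nat -> R -> R, (forall n, X (u n)) ->
        (exists M : R, forall n, (normX (u n) <= M%:E)%E) ->
        exists h : nat -> nat, {homo h : i j / (i < j)%N} /\
        exists2 l, Y l & normY (u (h n) \- l)%R @[n --> \oo] --> 0%E].

(* Main.v *)
(* Everything is measured by the energy [\int_0^T |v|^p], the p-th power of the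
   L^p norm; only crude constants are needed.

   (i) Young's inequality for the kernel [s^(a-1)], the identity
   [(J^a v)^(i) = J^(a-i) v] and the estimate
   [\int |r(x+h) - r(x)| dx <= C |h|^a] for [r(x) = x^(a-1)] bound the
   Slobodecki norm. Making the kernel of [J^c] Lipschitz near 0 approximates
   [J^c v] by [J^1 y] with y bounded; iterating, [J^c v] is a limit in L^p of
   functions [(J^1)^k y], and applying [J^(a-c)] yields approximants in 0C^k.

   (ii) If [u = lim v_n] with [v_n] in 0C^k, then [v_n = J^m v_n^(m)], and it
   suffices that [J^(1-sigma) v_n^(m)] be Cauchy in L^p: its limit g satisfies
   [u = J^alpha g]. Put [f = v_n^(m-1) = J^1 f']. Marchaud's formula
   [Gamma(1-sigma) J^(1-sigma) f'(t) = t^(-sigma) f(t)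
    + sigma \int_0^t (f(t) - f(s)) (t-s)^(-1-sigma) ds],
   Jensen's inequality and a Hardy inequality for the first term bound
   [J^(1-sigma) f'] by the Slobodecki norm of f of any order [theta > sigma].

   (iii) Under [J^alpha] the embedding becomes [J^eps] on L^p. Along an
   ultrafilter on the indices the Lipschitz approximants [J^1 y_n] converge on a
   finite grid, hence are uniformly Cauchy; so every bounded sequence has a
   subsequence with convergent image. *)

(* Real-valued integrals take the default value 0 where they diverge. Linearity and the semigroup
   law of [RLint] are therefore available only almost everywhere in (0,T), and [RLint 0] is not the
   identity, so every splitting of an order keeps both parts positive.

   In (i) the gap between the two orders is spent in two halves: one for the density argument, the
   other to leave an order that still exceeds the order of the target space.

   In (ii) the Hardy inequality is obtained by absorbing a multiple k < 1 of its left-hand side,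
   which must be known to be finite beforehand. This is clear for the approximants, where f(t) =
   O(t), and the constant in O(t) does not enter the estimate; hence all bounds are proved for
   approximants and their differences before passing to the limit. The loss theta > sigma also
   disposes of the critical exponent sigma p = 1, because the weight may be replaced by a slightly
   more singular one.

   In (iii) the ultrafilter replaces diagonal extraction: the values at all grid points of all
   approximations converge along the same one. *)
Require Import Defs.
From mathcomp Require Import all_boot all_order all_algebra.
From mathcomp Require Import all_classical all_reals all_analysis.
From mathcomp Require Import measurable_realfun.
From mathcomp Require Import ring lra.

Import Order.TTheory GRing.Theory Num.Theory.
Import numFieldNormedType.Exports.

Set Implicit Arguments.
Unset Strict Implicit.
Unset Printing Implicit Defensive.

Local Open Scope classical_set_scope.
Local Open Scope ring_scope.

(** * Affine changes of variables for the Lebesgue integral *)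

Section change_of_variables.
Context {R : realType}.
Local Open Scope ereal_scope.
Local Notation mu := (@lebesgue_measure R).
Implicit Types f : R -> \bar R.

(** The pushforward of Lebesgue measure by x -> d x + c, multiplied by d, gives every interval ]a,
    b] its length, so by uniqueness it is Lebesgue measure. *)
Lemma ge0_integral_affine f (d c : R) : (0 < d)%R ->
  measurable_fun [set: R] f -> (forall x, 0 <= f x) ->
  d%:E * \int[mu]_x f (d * x + c)%R = \int[mu]_x f x.
Proof.
move=> d0 mf f0.
pose phi : R -> R := fun x => (d * x + c)%R.
have mphi : measurable_fun [set: R] phi.
  by apply: measurable_funD => //; exact: measurable_funM.
have <- : \int[pushforward mu (phi : _ -> measurableTypeR R)]_x f x =
    \int[mu]_x (f \o phi) x.
  by rewrite ge0_integral_pushforward// preimage_setT.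
have d00 : (0 <= d)%R by exact: ltW.
rewrite -(@ge0_integral_mscale _ _ _ (pushforward mu (phi : _ -> measurableTypeR R))
  setT measurableT (NngNum d00) f)//.
apply: eq_measure_integral => A mA _; apply/esym.
apply: (@lebesgue_measure_unique R
  (mscale (NngNum d00) (pushforward mu (phi : _ -> measurableTypeR R)))) => // _ [[a b]] _ <-.
rewrite /= /mscale /= /pushforward.
have -> : (phi @^-1` `]a, b])%classic = `]((a - c) / d)%R, ((b - c) / d)%R]%classic.
  apply/seteqP; split => x /=; rewrite !in_itv/= /phi ltr_pdivrMr// ler_pdivlMr//;
  by rewrite ltrBlDr lerBrDr mulrC.
rewrite !lebesgue_measure_itv/= !lte_fin.
rewrite ltr_pM2r ?invr_gt0// ltrD2r; case: ifPn => ab; last by rewrite mule0.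
by rewrite -!EFinB -EFinM; congr (_%:E); field; rewrite gt_eqF.
Qed.

Lemma ge0_integral_shift f (c : R) :
  measurable_fun [set: R] f -> (forall x, 0 <= f x) ->
  \int[mu]_x f (x + c)%R = \int[mu]_x f x.
Proof.
move=> mf f0; rewrite -(@ge0_integral_affine f 1 c)// mul1e.
by under eq_integral do rewrite -[X in (X + c)%R]mul1r.
Qed.

Lemma ge0_integral_opp f :
  measurable_fun [set: R] f -> (forall x, 0 <= f x) ->
  \int[mu]_x f (- x)%R = \int[mu]_x f x.
Proof.
move=> mf f0.
have <- : \int[pushforward mu (-%R : _ -> measurableTypeR R)]_x f x =
    \int[mu]_x (f \o -%R) x.
  by rewrite ge0_integral_pushforward// preimage_setT.
by apply: eq_measure_integral => A mA _; exact: lebesgue_measureN.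
Qed.

Lemma ge0_integral_reflect f (c : R) :
  measurable_fun [set: R] f -> (forall x, 0 <= f x) ->
  \int[mu]_x f (c - x)%R = \int[mu]_x f x.
Proof.
move=> mf f0; rewrite -(@ge0_integral_opp f)//.
rewrite -(@ge0_integral_shift (fun x => f (- x)%R) (- c)%R)//; last first.
  by apply: measurableT_comp.
by apply: eq_integral => x _; rewrite opprD opprK addrC.
Qed.

End change_of_variables.

(** * Tonelli's theorem and measurability of parameter integrals on subsets *)

Section tonelli_on.
Context {R : realType}.
Local Open Scope ereal_scope.
Local Notation mu := (@lebesgue_measure R).

(** Both domains are absorbed into the integrand, restricted to A x B, so that the theorem on the
    whole plane applies. *)
Lemma tonelli_on (A B : set R) (f : R -> R -> \bar R) :
  measurable A -> measurable B ->
  measurable_fun [set: R * R] (fun z => f z.1 z.2) ->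
  (forall x y, 0 <= f x y) ->
  \int[mu]_(x in A) \int[mu]_(y in B) f x y =
  \int[mu]_(y in B) \int[mu]_(x in A) f x y.
Proof.
move=> mA mB mf f0.
pose g (z : R * R) : \bar R := ((fun z => f z.1 z.2) \_ (A `*` B)) z.
have mAB : measurable (A `*` B) by exact: measurableX.
have mg : measurable_fun [set: R * R] g.
  by apply/(measurable_restrictT _ mAB); exact: measurable_funTS.
have g0 z : 0 <= g z by apply: erestrict_ge0 => ? _.
transitivity (\int[mu]_x \int[mu]_y g (x, y)).
  rewrite integral_mkcond; apply: eq_integral => x _; rewrite patchE.
  case: ifPn => [xA|xA].
    rewrite integral_mkcond; apply: eq_integral => y _.
    by rewrite /g !patchE in_setX xA.
  under eq_integral do rewrite /g patchE in_setX (negbTE xA)/=.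
  by rewrite integral0.
transitivity (\int[mu]_y \int[mu]_x g (x, y)); last first.
  rewrite [RHS]integral_mkcond; apply: eq_integral => y _; rewrite patchE.
  case: ifPn => [yB|yB].
    rewrite [RHS]integral_mkcond; apply: eq_integral => x _.
    by rewrite /g !patchE in_setX yB andbT.
  under eq_integral do rewrite /g patchE in_setX (negbTE yB) andbF.
  by rewrite integral0.
exact: fubini_tonelli.
Qed.

Lemma measurable_tonelli_on (B : set R) (f : R -> R -> \bar R) :
  measurable B ->
  measurable_fun [set: R * R] (fun z => f z.1 z.2) ->
  (forall x y, 0 <= f x y) ->
  measurable_fun [set: R] (fun x => \int[mu]_(y in B) f x y).
Proof.
move=> mB mf f0.
pose g (z : R * R) : \bar R := ((fun z => f z.1 z.2) \_ (setT `*` B)) z.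
have mAB : measurable (setT `*` B : set (R * R)) by exact: measurableX.
have mg : measurable_fun [set: R * R] g.
  by apply/(measurable_restrictT _ mAB); exact: measurable_funTS.
have g0 z : 0 <= g z by apply: erestrict_ge0 => ? _.
rewrite [X in measurable_fun _ X](_ : _ = fun x => \int[mu]_y g (x, y)).
  exact: measurable_fun_fubini_tonelli_F.
apply/funext => x; rewrite integral_mkcond; apply: eq_integral => y _.
by rewrite /g !patchE in_setX in_setT.
Qed.

(** No integrability is required: the integral is a difference of two Tonelli integrals, and taking
    the real value is measurable even where that difference is infinite. *)
Lemma measurable_int_on (B : set R) (f : R -> R -> R) :
  measurable B ->
  measurable_fun [set: R * R] (fun z => f z.1 z.2) ->
  measurable_fun [set: R] (fun x => Rintegral mu B (f x)).
Proof.
move=> mB mf; apply: measurableT_comp => //.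
rewrite [X in measurable_fun _ X](_ : _ = fun x =>
   \int[mu]_(y in B) (Num.max (f x y) 0%R)%:E -
   \int[mu]_(y in B) (Num.max (- f x y) 0%R)%:E); last first.
  apply/funext => x; rewrite integralE; congr (_ - _).
    by apply: eq_integral => y _; rewrite funeposE /= EFin_max.
  by apply: eq_integral => y _; rewrite funenegE /= EFin_max EFinN.
apply: emeasurable_funB; apply: measurable_tonelli_on => //.
- by apply/measurable_EFinP; exact: measurable_maxr.
- by move=> x y; rewrite lee_fin le_max lexx orbT.
- by apply/measurable_EFinP; apply: measurable_maxr => //; exact: measurableT_comp.
- by move=> x y; rewrite lee_fin le_max lexx orbT.
Qed.

End tonelli_on.

(** * Integrals of powers *)

Section power_integrals.
Context {R : realType}.
Local Notation mu := (@lebesgue_measure R).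
Implicit Types (a b x y : R).

Lemma measurable_powR_comp d (U : measurableType d) (D : set U) (f : U -> R) a :
  measurable_fun D f -> measurable_fun D (fun u => f u `^ a).
Proof. by move=> mf; exact: measurableT_comp (measurable_powR a) mf. Qed.

Lemma ler_powR_base a x y : 0 <= a -> 0 <= x -> x <= y -> x `^ a <= y `^ a.
Proof.
by move=> a0 x0 xy; apply: ge0_ler_powR => //; rewrite nnegrE// (le_trans x0).
Qed.

Lemma poweR_le (a : R) (x y : \bar R) : 0 <= a -> (0 <= x)%E -> (x <= y)%E ->
  (x `^ a <= y `^ a)%E.
Proof.
move=> a0 x0 xy; apply: gt0_ler_poweR => //; rewrite in_itv/= ?x0 ?leey//.
by rewrite (le_trans x0 xy).
Qed.

(** Applied later with negative [b] as well, for the truncated kernel and for Marchaud's formula;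
    hence the interval away from 0. *)
Lemma integral_powR_cc b x y : b != 0 -> 0 < x -> x <= y ->
  (\int[mu]_(r in `[x, y]) (r `^ (b - 1))%:E = ((y `^ b - x `^ b) / b)%:E)%E.
Proof.
move=> b0 x0; rewrite le_eqVlt => /predU1P[<-|xy].
  by rewrite set_itv1 integral_set1 subrr mul0r.
pose F (r : R) := r `^ b / b.
have dF (r : R) : 0 < r -> is_derive r 1 F (r `^ (b - 1)).
  move=> r0; rewrite -[X in is_derive _ _ _ X](mulfVK b0) (mulrC _ b) mulrA.
  rewrite /F; have := is_derive1_powR b r0 => H.
  have -> : (fun r => r `^ b / b) = b^-1 \*: (fun r : R => r `^ b).
    by apply/funext => z; rewrite /= mulrC.
  apply: is_derive_eq; rewrite /GRing.scale/=.
  by rewrite mulrA mulVf// mul1r mulrAC divff ?mul1r.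
have cF (r : R) : 0 < r -> {for r, continuous F}.
  move=> r0; apply: differentiable_continuous; apply/derivable1_diffP.
  by have [] := dF _ r0.
rewrite (@continuous_FTC2 _ _ F)//.
- by rewrite /F -EFinB mulrBl.
- apply: continuous_in_subspaceT => r; rewrite inE/= in_itv/= => /andP[xr _].
  have r0 : 0 < r by exact: lt_le_trans xr.
  apply: differentiable_continuous; apply/derivable1_diffP.
  by apply: derivable_powR; rewrite in_itv/= r0.
- split.
  + move=> r; rewrite in_itv/= => /andP[xr _]; have r0 := lt_trans x0 xr.
    by have [] := dF _ r0.
  + by apply: cvg_at_right_filter; exact: cF.
  + by apply: cvg_at_left_filter; apply: cF; exact: lt_trans xy.
- move=> r; rewrite in_itv/= => /andP[xr _]; have r0 := lt_trans x0 xr.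
  by rewrite derive1E; have [_ ->] := dF _ r0.
Qed.

Lemma integral_powR_oo a x : 0 < a -> 0 <= x ->
  (\int[mu]_(r in `]0%R, x[) (r `^ (a - 1))%:E = (x `^ a / a)%:E)%E.
Proof.
move=> a0; rewrite le_eqVlt => /predU1P[<-|x0].
  by rewrite set_itvoo0 integral_set0 powR0 ?mul0r// gt_eqF.
have an0 : a != 0 by rewrite gt_eqF.
have mf D : measurable_fun D (fun r : R => (r `^ (a - 1))%:E).
  by apply: measurable_funTS; apply/measurable_EFinP; exact: measurable_powR.
rewrite integral_itv_bndo_bndc//.
(* The singularity at 0 is approached through these intervals, by monotone convergence. *)
pose F n : set R := `[x / n.+1%:R, x]%classic.
have -> : `]0, x]%classic = \bigcup_n F n.
  apply/seteqP; split => r /=; rewrite in_itv/=.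
    move=> /andP[r0 rx]; exists (Num.truncn (x / r)) => //=.
    rewrite /F /= in_itv/= rx andbT ler_pdivrMr// mulrC -ler_pdivrMr//.
    by rewrite ltW// truncnS_gt.
  move=> [n _]; rewrite /F/= in_itv/= => /andP[nr ->]; rewrite andbT.
  by apply: lt_le_trans nr; rewrite divr_gt0.
have cvgF : (\int[mu]_(r in F n) (r `^ (a - 1))%:E)%E @[n --> \oo] -->
    (\int[mu]_(r in \bigcup_n F n) (r `^ (a - 1))%:E)%E.
  apply: ge0_nondecreasing_set_cvg_integral => //.
  - move=> n m nm; apply/subsetPset => r; rewrite /F/= !in_itv/= => /andP[nr ->].
    rewrite andbT (le_trans _ nr)// ler_pM2l// lef_pV2 ?posrE//.
    by rewrite ler_nat ltnS.
  - by move=> n; exact: measurable_itv.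
  - by move=> n; exact: mf.
  - by move=> n r _; rewrite lee_fin powR_ge0.
suff : (\int[mu]_(r in F n) (r `^ (a - 1))%:E)%E @[n --> \oo] -->
    (x `^ a / a)%:E.
  by move=> /(cvg_unique _ cvgF); apply.
have -> : (fun n => \int[mu]_(r in F n) (r `^ (a - 1))%:E)%E =
    fun n => (x `^ a / a - x `^ a / a * (n.+1%:R^-1 `^ a))%:E.
  apply/funext => n; rewrite integral_powR_cc//.
  - by rewrite powRM// ?(ltW x0)// mulrBl [X in (_ - X)%:E]mulrAC.
  - by rewrite divr_gt0.
  - by rewrite ler_pdivrMr// ler_pMr// ler1n.
apply: cvg_EFin; first by near=> n.
rewrite -[X in _ --> X]subr0; apply: cvgB; first exact: cvg_cst.
rewrite -(mulr0 (x `^ a / a)); apply: cvgM; first exact: cvg_cst.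
apply: (@cvg_comp _ _ _ (fun n => n.+1%:R^-1 : R) (fun r => r `^ a) \oo 0^'+).
  move=> A /= [e/= e0 eA]; near=> n; apply: eA => //=.
  rewrite sub0r normrN ger0_norm//.
  by near: n; exact: near_infty_natSinv_lt (PosNum e0).
exact: powR_cvg0.
Unshelve. all: by end_near. Qed.

End power_integrals.

(** * Jensen's inequality for weighted integrals and Schur's test *)

Section schur.
Context {R : realType}.
Local Open Scope ereal_scope.
Local Notation mu := (@lebesgue_measure R).

(** Jensen's inequality for the density [k], without normalisation: Hölder's inequality with q =
    p/(p-1), applied to k^(1/p) F and k^(1/q). For p = 1 there is no conjugate exponent, and the two
    sides coincide. *)
Lemma jensen_weighted (p : R) (B : set R) (k F : R -> R) : (1 <= p)%R ->
  measurable B -> measurable_fun setT k -> measurable_fun setT F ->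
  (forall x, 0 <= k x)%R -> (forall x, 0 <= F x)%R ->
  (\int[mu]_(s in B) (k s * F s)%:E) `^ p <=
  (\int[mu]_(s in B) (k s)%:E) `^ (p - 1) *
  \int[mu]_(s in B) (k s * F s `^ p)%:E.
Proof.
move=> p1 mB mk mF k0 F0.
have [->|pn1] := eqVneq p 1%R.
  rewrite subrr poweRe0 mul1e poweRe1; last first.
    by apply: integral_ge0 => s _; rewrite lee_fin mulr_ge0.
  by under [leRHS]eq_integral do rewrite powRr1//.
have {}p1 : (1 < p)%R by rewrite lt_def pn1.
have p0 : (0 < p)%R by exact: lt_trans p1.
have pm1 : (0 < p - 1)%R by rewrite subr_gt0.
pose q := (p / (p - 1))%R.
have q0 : (0 < q)%R by rewrite divr_gt0.
have pq : (p^-1 + q^-1 = 1)%R.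
  by rewrite /q invf_div -[X in (X + _)%R]mul1r -mulrDl addrC subrK divff ?gt_eqF.
pose f := (fun s => k s `^ p^-1 * F s)%R \_ B.
pose g := (fun s => k s `^ q^-1)%R \_ B.
have mf : measurable_fun setT f.
  apply/(measurable_restrictT _ mB)/measurable_funTS/measurable_funM => //.
  exact: measurable_powR_comp.
have mg : measurable_fun setT g.
  by apply/(measurable_restrictT _ mB)/measurable_funTS; exact: measurable_powR_comp.
have := hoelder mu mf mg p0 q0 pq.
rewrite Lnorm1 unlock.
have -> : \int[mu]_x `|(EFin \o (f \* g)%R) x| = \int[mu]_(s in B) (k s * F s)%:E.
  rewrite [RHS]integral_mkcond; apply: eq_integral => x _.
  rewrite /f /g /= !patchE; case: ifPn => xB; last by rewrite mul0r normr0.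
  rewrite mulrAC -powRD; last by rewrite pq oner_eq0.
  by rewrite pq powRr1// ger0_norm// mulr_ge0.
have -> : \int[mu]_x `|(EFin \o f) x| `^ p = \int[mu]_(s in B) (k s * F s `^ p)%:E.
  rewrite [RHS]integral_mkcond; apply: eq_integral => x _.
  rewrite /f /= !patchE; case: ifPn => xB; last first.
    by rewrite normr0 powR0// gt_eqF.
  rewrite ger0_norm ?mulr_ge0 ?powR_ge0// powRM ?powR_ge0//.
  by rewrite -powRrM mulVf ?gt_eqF// powRr1.
have -> : \int[mu]_x `|(EFin \o g) x| `^ q = \int[mu]_(s in B) (k s)%:E.
  rewrite [RHS]integral_mkcond; apply: eq_integral => x _.
  rewrite /g /= !patchE; case: ifPn => xB; last first.
    by rewrite normr0 powR0// gt_eqF.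
  by rewrite ger0_norm ?powR_ge0// -powRrM mulVf ?gt_eqF// powRr1.
move=> /(@poweR_le _ p); rewrite poweRM ?poweR_ge0// -!poweRrM.
rewrite mulVf ?gt_eqF// poweRe1; last first.
  by apply: integral_ge0 => s _; rewrite lee_fin mulr_ge0// powR_ge0.
have -> : (q^-1 * p = p - 1)%R by rewrite /q invf_div divfK// gt_eqF.
rewrite muleC; apply => //; first exact: ltW.
by apply: integral_ge0 => s _; rewrite lee_fin mulr_ge0.
Qed.

(** Jensen in the variable s, where the kernel has mass at most M1, produces M1^(p-1); after Tonelli
    the mass in the variable t gives M2. *)
Lemma schur_test (p M1 M2 : R) (A B : set R) (k : R -> R -> R) (F : R -> R) :
  (1 <= p)%R -> measurable A -> measurable B ->
  measurable_fun [set: R * R] (fun z => k z.1 z.2) -> measurable_fun setT F ->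
  (forall t s, 0 <= k t s)%R -> (forall s, 0 <= F s)%R ->
  (0 <= M1)%R -> (0 <= M2)%R ->
  (forall t, A t -> \int[mu]_(s in B) (k t s)%:E <= M1%:E) ->
  (forall s, B s -> \int[mu]_(t in A) (k t s)%:E <= M2%:E) ->
  \int[mu]_(t in A) (\int[mu]_(s in B) (k t s * F s)%:E) `^ p <=
  (M1 `^ (p - 1) * M2)%:E * \int[mu]_(s in B) (F s `^ p)%:E.
Proof.
move=> p1 mA mB mk mF k0 F0 M10 M20 kM1 kM2.
have mkt t : measurable_fun setT (k t).
  exact: (measurableT_comp mk (pair1_measurable t)).
have mks s : measurable_fun setT (k ^~ s).
  exact: (measurableT_comp mk (pair2_measurable s)).
have mFp : measurable_fun setT (fun s => F s `^ p)%R by exact: measurable_powR_comp.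
have mkF (G : R -> R) : measurable_fun setT G ->
    measurable_fun [set: R * R] (fun z => (k z.1 z.2 * G z.2)%:E).
  move=> mG; apply/measurable_EFinP; apply: measurable_funM => //.
  exact: measurableT_comp.
have kFp0 t s : 0 <= (k t s * F s `^ p)%:E by rewrite lee_fin mulr_ge0// powR_ge0.
have mkFp : measurable_fun setT (fun t => \int[mu]_(s in B) (k t s * F s `^ p)%:E).
  by apply: (@measurable_tonelli_on _ B (fun t s => (k t s * F s `^ p)%:E)) => //; exact: (mkF (fun s => F s `^ p)%R).
apply: (@le_trans _ _ (\int[mu]_(t in A) ((M1 `^ (p - 1))%:E *
    \int[mu]_(s in B) (k t s * F s `^ p)%:E))).
  apply: ge0_le_integral => //.
  - by move=> t _; exact: poweR_ge0.
  - apply: measurable_funTS; apply: (measurableT_comp (measurable_poweR p)).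
    apply: (@measurable_tonelli_on _ B (fun t s => (k t s * F s)%:E)) => //; first exact: mkF.
    by move=> t s; rewrite lee_fin mulr_ge0.
  - by apply: measurable_funTS; exact: measurable_funeM.
  - move=> t At; apply: (le_trans (jensen_weighted p1 mB (mkt t) mF (k0 t) F0)).
    apply: lee_wpmul2r; first by apply: integral_ge0 => s _.
    rewrite -poweR_EFin; apply: poweR_le; [by rewrite subr_ge0| |exact: kM1].
    by apply: integral_ge0 => s _; rewrite lee_fin.
rewrite ge0_integralZl//; last 3 first.
- exact: measurable_funTS.
- by move=> t _; apply: integral_ge0 => s _.
- by rewrite lee_fin powR_ge0.
rewrite EFinM -muleA; apply: lee_wpmul2l; first by rewrite lee_fin powR_ge0.
rewrite (@tonelli_on _ A B (fun t s => (k t s * F s `^ p)%:E))//; last first.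
  exact: (mkF (fun s => F s `^ p)%R).
rewrite -ge0_integralZl//; last 2 first.
- by apply: measurable_funTS; apply/measurable_EFinP.
- by move=> s _; rewrite lee_fin powR_ge0.
apply: ge0_le_integral => //.
- by move=> s _; apply: integral_ge0 => t _.
- apply: measurable_funTS.
  apply: (@measurable_tonelli_on _ A (fun s t => (k t s * F s `^ p)%:E)) => //.
  apply/measurable_EFinP; apply: measurable_funM.
    exact: (measurableT_comp mk (@measurable_swap _ _ R R)).
  exact: (measurableT_comp mFp measurable_fst).
- by apply: measurable_funTS; apply: measurable_funeM; apply/measurable_EFinP.
- move=> s Bs; under eq_integral do rewrite EFinM.
  rewrite ge0_integralZr//.
  + by apply: lee_wpmul2r; [rewrite lee_fin powR_ge0|exact: kM2].
  + by apply: measurable_funTS; apply/measurable_EFinP; exact: mks.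
  + by move=> t _; rewrite lee_fin.
  + by rewrite lee_fin powR_ge0.
Qed.

End schur.

(** * The p-th power of the norm of L^p, and completeness *)

Section energy.
Context {R : realType}.
Local Notation mu := (@lebesgue_measure R).
Local Notation I0 T := (`]0%R, T[%classic : set R).
Implicit Types (p T : R) (u v w : R -> R).

Definition energy p T v : \bar R := (\int[mu]_(x in I0 T) (`|v x| `^ p)%:E)%E.

(** The working form of [Lp]. Measurability is asked on the whole line, which makes kernels such as
    rk a (t - s) v(s) measurable on the plane; [Lp_mLp] passes to it through extension by 0. *)
Definition mLp p T v : Prop := measurable_fun setT v /\ (energy p T v < +oo)%E.

Lemma energy_ge0 p T v : (0 <= energy p T v)%E.
Proof. by apply: integral_ge0 => x _; rewrite lee_fin powR_ge0. Qed.

Lemma measurable_energy p (D : set R) v : measurable_fun D v ->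
  measurable_fun D (fun x => (`|v x| `^ p)%:E).
Proof.
move=> mv; apply/measurable_EFinP; apply: measurable_powR_comp.
exact: measurableT_comp.
Qed.


Lemma Lp_normE p T u : p != 0 -> Lp_norm p T u = (energy p T u `^ p^-1)%E.
Proof.
move=> p0; rewrite -[LHS]poweRe1 ?Lnorm_ge0// -(mulfV p0) poweRrM; congr poweR.
rewrite /Lp_norm poweR_Lnorm// /energy [RHS]integral_mkcond.
apply: eq_integral => x _ /=.
by rewrite !patchE; case: ifPn => //= _; rewrite normr0 powR0.
Qed.

Lemma LpP p T u : 0 < p ->
  Lp p T u <-> measurable_fun (I0 T) u /\ (energy p T u < +oo)%E.
Proof.
move=> p0; have pn0 : p != 0 by rewrite gt_eqF.
have E : ('N[mu]_p%:E[EFin \o (u \_ (I0 T))] < +oo)%E <-> (energy p T u < +oo)%E.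
  rewrite -[('N[mu]_p%:E[EFin \o (u \_ (I0 T))])%E]/(Lp_norm p T u) Lp_normE//.
  split; last exact: poweR_lty.
  by apply: lty_poweRy; rewrite invr_neq0.
rewrite /Lp /= /Lfun; split.
  move=> /andP[]; rewrite inE /= => mu0 /[!inE] H; split; last exact/E.
  by apply/measurable_restrictT.
move=> [mu0 eu]; apply/andP; split; rewrite inE /=; last exact/E.
exact/(measurable_restrictT _ _).1.
Qed.

Lemma eq_energy p T u v : {in I0 T, u =1 v} -> energy p T u = energy p T v.
Proof. by move=> uv; apply: eq_integral => x xT; rewrite uv. Qed.

Lemma ae_energy p T u v : measurable_fun (I0 T) u -> measurable_fun (I0 T) v ->
  eq_ae0T T u v -> energy p T u = energy p T v.
Proof.
move=> mu0 mv uv; apply: ge0_ae_eq_integral => //.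
- exact: measurable_energy.
- exact: measurable_energy.
- by apply: filterS uv => x uvx Dx; rewrite uvx.
Qed.

Lemma mLp_Lp p T v : 0 < p -> mLp p T v -> Lp p T v.
Proof. by move=> p0 [mv ev]; apply/LpP => //; split => //; exact: measurable_funTS. Qed.

Lemma Lp_mLp p T u : 0 < p -> Lp p T u -> mLp p T (u \_ (I0 T)).
Proof.
move=> p0 /LpP => /(_ p0)[mu0 eu]; split; first exact/(measurable_restrictT _ _).1.
by rewrite (@eq_energy _ _ _ u)// => x xT; rewrite patchE xT.
Qed.

Lemma powRD_le p (a b : R) : 0 <= p -> 0 <= a -> 0 <= b ->
  (a + b) `^ p <= 2 `^ p * (a `^ p + b `^ p).
Proof.
move=> p0; wlog ab : a b / a <= b.
  by move=> H a0 b0; have [ab|/ltW ba] := leP a b; [exact: H|rewrite addrC (addrC (a `^ p)); exact: H].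
move=> a0 b0; apply: (@le_trans _ _ ((2 * b) `^ p)).
  by apply: ler_powR_base => //; [rewrite addr_ge0|rewrite mulr_natl mulr2n lerD2r].
by rewrite powRM// ler_wpM2l ?powR_ge0// lerDr powR_ge0.
Qed.

Lemma energyD p T u v : 0 <= p ->
  measurable_fun (I0 T) u -> measurable_fun (I0 T) v ->
  (energy p T (fun x => u x + v x)%R <=
   (2 `^ p)%:E * (energy p T u + energy p T v))%E.
Proof.
move=> p0 mu0 mv.
rewrite /energy -ge0_integralD//; last 2 first.
- exact: measurable_energy.
- exact: measurable_energy.
rewrite -ge0_integralZl//; last 2 first.
- by apply: emeasurable_funD; exact: measurable_energy.
- by move=> x _; rewrite -EFinD lee_fin addr_ge0// powR_ge0.
apply: ge0_le_integral => //.
- by apply: measurable_energy; exact: measurable_funD.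
- by apply: measurable_funeM; apply: emeasurable_funD; exact: measurable_energy.
- move=> x _; rewrite -EFinD -EFinM lee_fin (le_trans _ (powRD_le _ _ _))//.
  by apply: ler_powR_base => //; exact: ler_normD.
Qed.

Lemma energyZ p T c u : measurable_fun (I0 T) u ->
  energy p T (fun x => c * u x)%R = ((`|c| `^ p)%:E * energy p T u)%E.
Proof.
move=> mu0; rewrite /energy -ge0_integralZl//; last exact: measurable_energy.
by apply: eq_integral => x _; rewrite normrM powRM// EFinM.
Qed.

Lemma energyN p T u : energy p T (fun x => - u x)%R = energy p T u.
Proof. by apply: eq_integral => x _; rewrite normrN. Qed.

Lemma energyB p T u v : 0 <= p ->
  measurable_fun (I0 T) u -> measurable_fun (I0 T) v ->
  (energy p T (fun x => u x - v x)%R <=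
   (2 `^ p)%:E * (energy p T u + energy p T v))%E.
Proof.
move=> p0 mu0 mv; rewrite -(energyN _ _ v); apply: energyD => //.
exact: measurableT_comp.
Qed.

Lemma mLpD p T u v : 0 <= p -> mLp p T u -> mLp p T v ->
  mLp p T (fun x => u x + v x).
Proof.
move=> p0 [mu0 eu] [mv ev]; split; first exact: measurable_funD.
apply: le_lt_trans (energyD p0 (measurable_funTS mu0) (measurable_funTS mv)) _.
by apply: lte_mul_pinfty => //; exact: lte_add_pinfty.
Qed.

Lemma mLpZ p T c u : mLp p T u -> mLp p T (fun x => c * u x).
Proof.
move=> [mu0 eu]; split; first exact: measurable_funM.
rewrite energyZ; last exact: measurable_funTS.
by apply: lte_mul_pinfty => //; rewrite lee_fin powR_ge0.
Qed.

Lemma mLpB p T u v : 0 <= p -> mLp p T u -> mLp p T v ->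
  mLp p T (fun x => u x - v x).
Proof.
move=> p0 Lu [mv ev]; apply: (mLpD p0 Lu (v := fun x => - v x)); split.
  exact: measurableT_comp.
by rewrite energyN.
Qed.

Lemma mLp_bounded p T v (M : R) : 0 <= p -> 0 <= T -> measurable_fun setT v ->
  (forall x, 0 < x < T -> `|v x| <= M) -> mLp p T v.
Proof.
move=> p0 T0 mv vM; split => //.
apply: (@le_lt_trans _ _ (\int[mu]_(x in I0 T) (cst (M `^ p)%:E) x)%E).
  apply: ge0_le_integral => //.
  - by apply: measurable_energy; exact: measurable_funTS.
  - by move=> x; rewrite /= in_itv/= => xT; rewrite lee_fin ler_powR_base// vM.
rewrite integral_cst//= lebesgue_measure_itv/= lte_fin.
by case: ifPn => _; rewrite ?mule0// -EFinB -EFinM ltry.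
Qed.

(** [jensen_weighted] with constant weight 1 on an interval of length T. *)
Lemma integral_le_energy p T u : 1 <= p -> 0 < T -> measurable_fun setT u ->
  ((\int[mu]_(x in I0 T) `|u x|%:E) `^ p <= (T `^ (p - 1))%:E * energy p T u)%E.
Proof.
move=> p1 T0 mu0.
have := @jensen_weighted R p (I0 T) (cst 1) (fun x => `|u x|) p1 _ _ _ _ _.
under eq_integral do rewrite mul1r.
under [X in (_ * X)%E]eq_integral do rewrite mul1r.
rewrite [X in ((X `^ _) * _)%E](_ : _ = T%:E); last first.
  rewrite (@integral_cst _ _ _ mu (I0 T) (measurable_itv _) 1%E).
  by rewrite /= lebesgue_measure_itv/= lte_fin T0 sube0 mul1e.
move=> H.
by rewrite -poweR_EFin; apply: H => //; exact: measurableT_comp.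
Qed.

Lemma mLp_integrable p T u : 1 <= p -> 0 < T -> mLp p T u ->
  mu.-integrable (I0 T) (EFin \o u).
Proof.
move=> p1 T0 [mu0 eu]; apply/integrableP; split.
  by apply/measurable_EFinP; exact: measurable_funTS.
have p0 : p != 0 by rewrite gt_eqF// (lt_le_trans _ p1).
apply: (@lty_poweRy _ _ p) => //=.
apply: le_lt_trans (integral_le_energy p1 T0 mu0) _.
by apply: lte_mul_pinfty => //; rewrite lee_fin powR_ge0.
Qed.

Lemma mLp1 p T u : 1 <= p -> 0 < T -> mLp p T u -> mLp 1 T u.
Proof.
move=> p1 T0 Lu; have /integrableP[_ H] := mLp_integrable p1 T0 Lu.
split; first exact: Lu.1.
by rewrite /energy; under eq_integral do rewrite powRr1//.
Qed.

Lemma energy_eq0 p T u : p != 0 -> measurable_fun (I0 T) u ->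
  energy p T u = 0%E -> eq_ae0T T u (cst 0).
Proof.
move=> p0 mu0 eu.
have mD : measurable (I0 T) by exact: measurable_itv.
have := (@ae_eq_integral_abs _ _ _ mu (I0 T) mD (fun x => (`|u x| `^ p)%:E)
  (measurable_energy _ mu0)).1.
under eq_integral do rewrite /= ger0_norm ?powR_ge0//.
move=> /(_ eu); apply: filterS => x ux Dx.
by have /eqP := ux Dx; rewrite eqe powR_eq0 => /andP[/eqP/normr0_eq0].
Qed.

Lemma energy_limit_unique p T u w : 0 < p ->
  measurable_fun (I0 T) u -> measurable_fun (I0 T) w ->
  (forall e, 0 < e -> (energy p T (fun x => u x - w x)%R <= e%:E)%E) ->
  eq_ae0T T u w.
Proof.
move=> p0 mu0 mw H.
have : eq_ae0T T (fun x => u x - w x) (cst 0).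
  apply: (@energy_eq0 p); first by rewrite gt_eqF.
    exact: measurable_funB.
  apply/eqP; rewrite eq_le energy_ge0 andbT; apply/lee_addgt0Pr => e e0.
  by rewrite add0e; exact: H.
by apply: filterS => x ux Dx; apply/eqP; rewrite -subr_eq0; apply/eqP/ux.
Qed.

(** The sequence a_k - 2M/2^k increases and a_k + 2M/2^k decreases, so the limit is caught between
    them; convergence and its rate come together. *)
Lemma geometric_cauchy (a : nat -> R) (M : R) :
  (forall k, `|a k.+1 - a k| <= M / 2 ^+ k) ->
  cvgn a /\ forall k, `|a k - limn a| <= 2 * M / 2 ^+ k.
Proof.
move=> aM.
have M0 : 0 <= M by have := aM 0; rewrite expr0 divr1; exact: le_trans.
pose b k := a k - 2 * M / 2 ^+ k; pose c k := a k + 2 * M / 2 ^+ k.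
have half k : 2 * M / 2 ^+ k.+1 = M / 2 ^+ k.
  by rewrite exprS invfM mulrACA divff ?mul1r// pnatr_eq0.
have dbl k : 2 * M / 2 ^+ k = M / 2 ^+ k + M / 2 ^+ k.
  by rewrite -mulrA mulr_natl mulr2n.
have ndb : nondecreasing_seq b.
  apply/nondecreasing_seqP => k; rewrite /b half dbl.
  by have := aM k; rewrite ler_norml => /andP[? ?]; lra.
have nic : nonincreasing_seq c.
  apply/nonincreasing_seqP => k; rewrite /c half dbl.
  by have := aM k; rewrite ler_norml => /andP[? ?]; lra.
have q0 k : 0 <= 2 * M / 2 ^+ k by rewrite divr_ge0 ?mulr_ge0 ?exprn_ge0.
have bc k m : b k <= c m.
  have [km|/ltW mk] := leP k m.
    by apply: (le_trans (ndb _ _ km)); rewrite /b /c lerD2l ge0_cp.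
  apply: le_trans (nic _ _ mk); rewrite /b /c lerD2l.
  by rewrite (le_trans _ (q0 k))// oppr_le0.
have ubb : has_ubound (range b) by exists (c 0%N) => _ [k _ <-]; exact: bc.
have bs := nondecreasing_cvgn ndb ubb.
set l := sup (range b) in bs.
have bl k : b k <= l by apply: ub_le_sup => //; exists k.
have lc k : l <= c k.
  by apply: ge_sup; [exists (b 0%N), 0%N|move=> _ [m _ <-]; exact: bc].
have al k : `|a k - l| <= 2 * M / 2 ^+ k.
  by have := bl k; have := lc k; rewrite /b /c ler_distlC => ? ?; apply/andP; split; lra.
have ca : a @ \oo --> l.
  have -> : a = fun k => b k + 2 * M * (2^-1) ^+ k.
    by apply/funext => k; rewrite /b exprVn subrK.
  rewrite -[X in _ --> X]addr0; apply: cvgD => //.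
  rewrite -[X in _ --> X](mulr0 (2 * M)); apply: cvgM; first exact: cvg_cst.
  by apply: cvg_expr; rewrite ger0_norm ?invr_ge0// invf_lt1// ltr1n.
split; first by apply/cvg_ex; exists l.
by rewrite (cvg_lim _ ca).
Qed.

(** Riesz-Fischer: a fast subsequence has increments that are geometrically small at almost every
    point, hence a pointwise limit, and the Cauchy property carries the convergence over to the full
    sequence. *)
Lemma energy_complete p T (v : nat -> R -> R) : 1 <= p -> 0 < T ->
  (forall n, mLp p T (v n)) ->
  (forall e, 0 < e -> exists N, forall n m, (N <= n)%N -> (N <= m)%N ->
     (energy p T (fun x => v n x - v m x)%R <= e%:E)%E) ->
  exists2 w, mLp p T w & forall e, 0 < e -> exists N, forall n, (N <= n)%N ->
     (energy p T (fun x => v n x - w x)%R <= e%:E)%E.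
Proof.
move=> p1 T0 Lv cauchy.
have p0 : 0 < p by exact: lt_le_trans p1.
have mD : measurable (I0 T) by exact: measurable_itv.
(* Chosen so that the increments, weighted by 2^(kp), have energies at most 2^-(k+1), with sum 1. *)
pose e_ k : R := (2 ^+ k.+1)^-1 / ((2 ^+ k) `^ p).
have e_gt0 k : 0 < e_ k by rewrite divr_gt0 ?invr_gt0 ?exprn_gt0// powR_gt0 ?exprn_gt0.
have /choice[N HN] : forall k, exists N, forall n m, (N <= n)%N -> (N <= m)%N ->
    (energy p T (fun x => v n x - v m x)%R <= (e_ k)%:E)%E.
  by move=> k; exact: cauchy.
pose h k := maxn k (\max_(i < k.+1) N i)%N.
have hN k : (N k <= h k)%N.
  by rewrite leq_max (leq_bigmax (@ord_max k)) orbT.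
have hS k : (h k <= h k.+1)%N.
  rewrite /h geq_max !leq_max leqnSn/= [X in _ || (_ <= X)%N]big_ord_recr.
  by rewrite leq_max leqnn/= orbT.
pose g k x : \bar R := (((2 ^+ k) `^ p)%:E * (`|v (h k.+1) x - v (h k) x| `^ p)%:E)%E.
have mvB k : measurable_fun setT (fun x => v (h k.+1) x - v (h k) x).
  by apply: measurable_funB; [exact: (Lv _).1|exact: (Lv _).1].
have mg k : measurable_fun setT (g k).
  by apply: measurable_funeM; exact: measurable_energy.
have g0 k x : (0 <= g k x)%E.
  by rewrite mule_ge0// lee_fin powR_ge0.
pose S x := (\sum_(0 <= k <oo) g k x)%E.
have S0 x : (0 <= S x)%E by apply: nneseries_ge0 => k _ _.
have mS : measurable_fun setT S.
  by apply: ge0_emeasurable_sum => // k x _ _.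
have intS : (\int[mu]_(x in I0 T) S x <= 1)%E.
  rewrite integral_nneseries//; last by move=> k; apply: measurable_funTS; exact: mg.
  apply: (@le_trans _ _ (\sum_(0 <= k <oo) (1 / (2 ^ (k + 1))%:R)%:E)%E).
    apply: lee_nneseries => [k _ _|k _]; first by apply: integral_ge0.
    rewrite /g ge0_integralZl//; last first.
      by apply: measurable_energy; exact: measurable_funTS.
    apply: (@le_trans _ _ (((2 ^+ k) `^ p)%:E * (e_ k)%:E)%E).
      apply: lee_wpmul2l; first by rewrite lee_fin powR_ge0.
      by apply: HN => //; exact: leq_trans (hS k).
    rewrite -EFinM lee_fin /e_ mulrCA divff ?mulr1; last first.
      by rewrite gt_eqF// powR_gt0// exprn_gt0.
    by rewrite div1r addn1 natrX.
  have := @cvg_geometric_eseries_half R 1 0; rewrite expr0 divr1 => /cvg_lim.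
  by move=> /(_ (@ereal_hausdorff R)); rewrite /eseries /= => ->.
(* Setting the functions to 0 where [S] is infinite makes the geometric bound hold at every point,
   with constant S(x)^(1/p), so the limit exists everywhere and is measurable. *)
pose A := I0 T `&` [set x | S x \is a fin_num].
have mA : measurable A by apply: emeasurable_fin_num => //; exact: measurable_funTS.
pose a k := v (h k) \_ A.
have ma k : measurable_fun setT (a k).
  by apply/(measurable_restrictT _ mA)/measurable_funTS; exact: (Lv _).1.
pose M x := if x \in A then (fine (S x)) `^ p^-1 else 0.
have aM x k : `|a k.+1 x - a k x| <= M x / 2 ^+ k.
  rewrite /a /M !patchE; case: ifPn => [|_]; last by rewrite subrr normr0 mul0r.
  rewrite inE => -[_ /= Sfin].
  have gS : (g k x <= S x)%E.
    apply: le_trans (@nneseries_lim_ge _ (g ^~ x) xpredT 0%N k.+1 _); last by move=> *; exact: g0.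
    by rewrite big_nat_recr//= leeDr// sume_ge0.
  rewrite ler_pdivlMr ?exprn_gt0//.
  have -> : `|v (h k.+1) x - v (h k) x| * 2 ^+ k =
      (fine (g k x)) `^ p^-1.
    rewrite /g -EFinM/= -powRM ?exprn_ge0// -powRrM mulfV ?gt_eqF// powRr1 ?mulr_ge0 ?exprn_ge0//.
    by rewrite mulrC.
  apply: ler_powR_base; [by rewrite invr_ge0 ltW|exact: fine_ge0|].
  by apply: fine_le => //; rewrite /g -EFinM.
pose w x := limn (a ^~ x).
have mw : measurable_fun setT w.
  by apply: (measurable_fun_cvg ma) => x _; have [] := geometric_cauchy (aM x).
have Aae k : eq_ae0T T (v (h k)) (a k).
  have iS : mu.-integrable (I0 T) S.
    apply/integrableP; split; first exact: measurable_funTS.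
    under eq_integral do rewrite gee0_abs//.
    by apply: le_lt_trans intS _; rewrite ltry.
  have := @integrable_ae _ _ _ (mu : {measure set (measurableTypeR R) -> \bar R})
    (I0 T) (measurable_itv _) S iS.
  apply: filterS => x Sx Dx.
  by rewrite /a patchE mem_set//; split => //; exact: Sx.
have eaw k : (energy p T (fun x => a k x - w x)%R <= ((2 / 2 ^+ k) `^ p)%:E)%E.
  apply: (@le_trans _ _ (\int[mu]_(x in I0 T) (((2 / 2 ^+ k) `^ p)%:E * S x))%E).
    apply: ge0_le_integral => //.
    - by apply: measurable_energy; apply: measurable_funTS; exact: measurable_funB.
    - by apply: measurable_funeM; exact: measurable_funTS.
    - move=> x Dx.
      have [_ /(_ k)] := geometric_cauchy (aM x); rewrite -/(w x) => H.
      rewrite /M in H; move: H; case: ifPn => [|_]; last first.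
        rewrite mulr0 mul0r => H.
        have -> : `|a k x - w x| = 0 by apply/eqP; rewrite eq_le H normr_ge0.
        by rewrite powR0 ?gt_eqF// mule_ge0// lee_fin powR_ge0.
      rewrite inE => -[_ /= Sfin] H.
      rewrite -[in leRHS](fineK Sfin) -EFinM lee_fin.
      apply: le_trans (ler_powR_base _ _ H) _; rewrite ?(ltW p0)//.
      rewrite mulrAC powRM ?divr_ge0 ?exprn_ge0 ?powR_ge0//.
      by rewrite -powRrM mulVf ?gt_eqF// powRr1// fine_ge0.
  rewrite ge0_integralZl//; last exact: measurable_funTS.
  by rewrite -[leRHS]mule1; apply: lee_wpmul2l => //; rewrite lee_fin powR_ge0.
have evw n k : (energy p T (fun x => v n x - w x)%R <= (2 `^ p)%:E *
     (energy p T (fun x => v n x - v (h k) x)%R + ((2 / 2 ^+ k) `^ p)%:E))%E.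
  have -> : (fun x => v n x - w x) = (fun x => (v n x - a k x) + (a k x - w x)).
    by apply/funext => x; rewrite addrA subrK.
  have mvn := (Lv n).1; have mvh := (Lv (h k)).1.
  apply: le_trans (energyD _ _ _) _; first exact: ltW.
  - by apply: measurable_funTS; exact: measurable_funB.
  - by apply: measurable_funTS; exact: measurable_funB.
  apply: lee_wpmul2l; first by rewrite lee_fin powR_ge0.
  apply: leeD; last exact: eaw.
  rewrite (@ae_energy p T (fun x => v n x - a k x) (fun x => v n x - v (h k) x))//.
  - by apply: measurable_funTS; exact: measurable_funB.
  - by apply: measurable_funTS; exact: measurable_funB.
  - by apply: filterS (Aae k) => x ax Dx; rewrite ax.
have cv : (2 `^ p * (2 / 2 ^+ k) `^ p) @[k --> \oo] --> (0 : R).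
  have -> : (fun k => 2 `^ p * (2 / 2 ^+ k) `^ p) =
     (fun k => (2 `^ p * 2 `^ p) * ((2 `^ p)^-1) ^+ k) :> (nat -> R).
    apply/funext => k; rewrite powRM ?invr_ge0 ?exprn_ge0// mulrA; congr (_ * _).
    rewrite -powR_inv1 ?exprn_ge0// powRAC powR_inv1 ?powR_ge0//.
    have e2 : (2 : R) ^+ k = 2 `^ k%:R by rewrite powR_mulrn.
    have ep : ((2 : R) `^ p) ^+ k = (2 `^ p) `^ k%:R.
      by rewrite powR_mulrn// powR_ge0.
    by rewrite exprVn e2 ep powRAC.
  rewrite -[X in _ --> X](mulr0 (2 `^ p * 2 `^ p)); apply: cvgM; first exact: cvg_cst.
  apply: cvg_expr; rewrite ger0_norm ?invr_ge0 ?powR_ge0// invf_lt1 ?powR_gt0//.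
  by apply: (@lt_le_trans _ _ 2); [rewrite ltr1n|apply: le1r_powR => //; rewrite ler1n].
have conv e : 0 < e -> exists N, forall n, (N <= n)%N ->
     (energy p T (fun x => v n x - w x)%R <= e%:E)%E.
  move=> e0; have e20 : 0 < e / 2 by rewrite divr_gt0.
  have c20 : 0 < e / 2 / (2 `^ p) by rewrite divr_gt0// powR_gt0.
  have [N1 HN1] := cauchy _ c20.
  move/cvgrPdist_le : cv => /(_ _ e20)[K _ HK].
  exists N1 => n Nn.
  pose k := maxn K N1.
  apply: le_trans (evw n k) _.
  have {}HN1 : (energy p T (fun x => v n x - v (h k) x)%R <= (e / 2 / (2 `^ p))%:E)%E.
    by apply: HN1 => //; rewrite leq_max leq_maxr.
  apply: (@le_trans _ _ ((2 `^ p)%:E * ((e / 2 / (2 `^ p))%:E + ((2 / 2 ^+ k) `^ p)%:E))%E).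
    by apply: lee_wpmul2l; [rewrite lee_fin powR_ge0|exact: leeD].
  rewrite -EFinD -EFinM lee_fin mulrDr mulrCA divff ?mulr1 ?gt_eqF ?powR_gt0//.
  have := HK k; rewrite /= leq_maxl => /(_ isT).
  rewrite sub0r normrN ger0_norm; last by rewrite mulr_ge0 ?powR_ge0.
  by move=> H; rewrite [leRHS](splitr e) lerD2l.
exists w => //; split => //.
have [N1 /(_ N1 (leqnn _)) HN1] := conv 1 ltr01.
have -> : w = (fun x => v N1 x - (v N1 x - w x)).
  by apply/funext => x; rewrite subKr.
apply: (mLpB (ltW p0) (Lv N1) _).2; split; last exact: le_lt_trans HN1 (ltry _).
by apply: measurable_funB => //; exact: (Lv _).1.
Qed.

End energy.

(** * Real-valued integrals with default value 0, and Fubini's theorem *)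

Section real_integrals.
Context {R : realType}.
Local Notation mu := (@lebesgue_measure R).

Lemma integrable_on (B : set R) (f : R -> R) :
  measurable_fun B f -> (\int[mu]_(x in B) `|f x|%:E < +oo)%E ->
  mu.-integrable B (EFin \o f).
Proof.
by move=> mf foo; apply/integrableP; split => //; exact/measurable_EFinP.
Qed.

Lemma Rintegral_nonintegrable (B : set R) (f : R -> R) : measurable B ->
  measurable_fun B f -> ~ mu.-integrable B (EFin \o f) ->
  Rintegral mu B f = 0.
Proof.
move=> mB mf nif; rewrite /Rintegral.
have : (\int[mu]_(x in B) (f x)%:E)%E \isn't a fin_num.
  rewrite -(integral_fin_num_abs mu mB mf); apply/negP => foo.
  by apply: nif; exact: integrable_on.
by case: (\int[mu]_(x in B) _)%E.
Qed.

(** Scalars can be taken out even of a divergent integral, because both sides are then the default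
    0. *)
Lemma RintegralZl_measurable (B : set R) (f : R -> R) (r : R) : measurable B ->
  measurable_fun B f ->
  Rintegral mu B (fun x => r * f x) = r * Rintegral mu B f.
Proof.
move=> mB mf; have [->|r0] := eqVneq r 0.
  rewrite mul0r /Rintegral; under eq_integral do rewrite mul0r.
  by rewrite integral0.
have [i_f|nif] := boolP (mu.-integrable B (EFin \o f)).
  by rewrite RintegralZl.
have nif' : ~ mu.-integrable B (EFin \o (fun x => r * f x)).
  move=> H0; have H := @integrableZl _ _ _ mu B mB r^-1 _ H0; move/negP : nif; apply.
  apply: eq_integrable H => // x _ /=.
  by rewrite -EFinM mulrA mulVf// mul1r.
rewrite (Rintegral_nonintegrable mB _ nif'); last exact: measurable_funM.
by rewrite Rintegral_nonintegrable ?mulr0//; exact/negP.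
Qed.

Lemma le_Rintegral_abs (B : set R) (f : R -> R) : measurable B ->
  measurable_fun B f ->
  (`|Rintegral mu B f|%:E <= \int[mu]_(x in B) `|f x|%:E)%E.
Proof.
move=> mB mf; have H : (`|\int[mu]_(x in B) (f x)%:E| <= \int[mu]_(x in B) `|(f x)%:E|)%E.
  by apply: le_abse_integral => //; exact/measurable_EFinP.
apply: le_trans H; rewrite /Rintegral.
by case: (\int[mu]_(x in B) (f x)%:E)%E => [r| |]//=; rewrite normr0 leey.
Qed.

(** The real-valued inner integrals agree with the extended ones where these are finite, that is
    almost everywhere; each side is matched with the integral of the restricted function on the
    plane up to a null set. *)
Lemma fubini_on (A B : set R) (f : R -> R -> R) : measurable A -> measurable B ->
  measurable_fun [set: R * R] (fun z => f z.1 z.2) ->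
  (\int[mu]_(x in A) \int[mu]_(y in B) `|f x y|%:E < +oo)%E ->
  Rintegral mu A (fun x => Rintegral mu B (f x)) =
  Rintegral mu B (fun y => Rintegral mu A (f ^~ y)).
Proof.
move=> mA mB mf foo.
pose g (z : R * R) : R := ((fun z => f z.1 z.2) \_ (A `*` B)) z.
have mAB : measurable (A `*` B) by exact: measurableX.
have mg : measurable_fun [set: R * R] g.
  by apply/(measurable_restrictT _ mAB); exact: measurable_funTS.
have gx x y : g (x, y) = ((fun x => (f x \_ B) y) \_ A) x.
  by rewrite /g !patchE in_setX /=; case: (x \in A).
have gy x y : g (x, y) = ((fun y => (f^~ y \_ A) x) \_ B) y.
  by rewrite /g !patchE in_setX /= andbC; case: (y \in B).
have ig : (mu \x mu)%E.-integrable setT (EFin \o g).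
  apply/integrable12ltyP; first exact/measurable_EFinP.
  rewrite [ltLHS](_ : _ = \int[mu]_(x in A) \int[mu]_(y in B) `|f x y|%:E)%E//.
  rewrite [RHS]integral_mkcond; apply: eq_integral => x _; rewrite patchE.
  case: ifPn => xA.
    rewrite [RHS]integral_mkcond; apply: eq_integral => y _.
    by rewrite /= gx !patchE xA; case: ifPn => //; rewrite normr0.
  under eq_integral do rewrite /= gx patchE (negbTE xA) normr0.
  by rewrite integral0.
have iF := integrable_fubini_F ig; have iG : mu.-integrable setT (fun y => \int[mu]_x (g (x, y))%:E)%E.
  have sg : measurable_fun [set: R * R] (fun z => g (z.2, z.1)).
    exact: (measurableT_comp mg (@measurable_swap _ _ R R)).
  have ig' : (mu \x mu)%E.-integrable setT (EFin \o (fun z => g (z.2, z.1))).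
    apply/integrable12ltyP; first exact/measurable_EFinP.
    have mEg : measurable_fun setT (EFin \o g) by exact/measurable_EFinP.
    exact: (integrable21ltyP mu mu mEg).1 ig.
  exact: integrable_fubini_F ig'.
have := Fubini ig.
have -> : (\int[mu]_x \int[mu]_y (EFin \o g) (x, y) =
           \int[mu]_(x in A) (Rintegral mu B (f x))%:E)%E.
  rewrite [RHS]integral_mkcond; apply: ae_eq_integral => //.
  - exact: measurable_int iF.
  - have -> : (fun x => (Rintegral mu B (f x))%:E) \_ A =
        EFin \o ((fun x => Rintegral mu B (f x)) \_ A) by rewrite -restrict_EFin.
    apply/measurable_EFinP/(measurable_restrictT _ mA)/measurable_funTS.
    exact: measurable_int_on.
  - have := integrable_ae measurableT iF; apply: filterS => x /(_ I) Fx _.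
    rewrite patchE; case: ifPn => xA; last first.
      by under eq_integral do rewrite /= gx patchE (negbTE xA); rewrite integral0.
    have E : (\int[mu]_y (EFin \o g) (x, y) = \int[mu]_(y in B) (f x y)%:E)%E.
      rewrite [RHS]integral_mkcond; apply: eq_integral => y _.
      by rewrite /= gx !patchE xA; case: ifPn.
    by rewrite /Rintegral -E fineK.
have -> : (\int[mu]_y \int[mu]_x (EFin \o g) (x, y) =
           \int[mu]_(y in B) (Rintegral mu A (f ^~ y))%:E)%E.
  rewrite [RHS]integral_mkcond; apply: ae_eq_integral => //.
  - exact: measurable_int iG.
  - have -> : (fun y => (Rintegral mu A (f ^~ y))%:E) \_ B =
        EFin \o ((fun y => Rintegral mu A (f ^~ y)) \_ B) by rewrite -restrict_EFin.
    apply/measurable_EFinP/(measurable_restrictT _ mB)/measurable_funTS.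
    apply: (@measurable_int_on _ A (fun y x => f x y)) => //.
    exact: (measurableT_comp mf (@measurable_swap _ _ R R)).
  - have := integrable_ae measurableT iG; apply: filterS => y /(_ I) Fy _.
    rewrite patchE; case: ifPn => yB; last first.
      by under eq_integral do rewrite /= gy patchE (negbTE yB); rewrite integral0.
    have E : (\int[mu]_x (EFin \o g) (x, y) = \int[mu]_(x in A) (f x y)%:E)%E.
      rewrite [RHS]integral_mkcond; apply: eq_integral => x _.
      by rewrite /= gy !patchE yB; case: ifPn.
    by rewrite /Rintegral -E fineK.
by rewrite /Rintegral => ->.
Qed.

End real_integrals.

(** * The kernel of the fractional integral *)

Section power_kernel.
Context {R : realType}.
Local Notation mu := (@lebesgue_measure R).
Local Notation I0 T := (`]0%R, T[%classic : set R).
Implicit Types (a b t x : R).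

(** Cutting the power off at 0 turns the integral over the moving interval (0,t) into a convolution
    on a fixed domain. *)
Definition rk a x : R := if 0 < x then x `^ (a - 1) else 0.

Lemma rk_ge0 a x : 0 <= rk a x.
Proof. by rewrite /rk; case: ifP => // _; exact: powR_ge0. Qed.

Lemma rk_gt0 a x : 0 < x -> rk a x = x `^ (a - 1).
Proof. by rewrite /rk => ->. Qed.

Lemma rk_le0 a x : x <= 0 -> rk a x = 0.
Proof. by rewrite /rk leNgt => /negbTE ->. Qed.

Lemma measurable_rk a : measurable_fun setT (rk a).
Proof.
have -> : rk a = (fun x => x `^ (a - 1)) \_ `]0, +oo[%classic.
  by apply/funext => x; rewrite /rk patchE mem_setE in_itv/= andbT.
apply/(measurable_restrictT _ (measurable_itv _))/measurable_funTS.
exact: measurable_powR.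
Qed.

Lemma measurable_rk_sub a t : measurable_fun setT (fun s : R => rk a (t - s)).
Proof.
by apply: (measurableT_comp (measurable_rk a)); exact: measurable_funB.
Qed.

Lemma measurable_rkB a : measurable_fun [set: R * R] (fun z => rk a (z.1 - z.2)).
Proof.
apply: (measurableT_comp (measurable_rk a)).
exact: (measurable_funB measurable_fst measurable_snd).
Qed.

Lemma integral_rk a x : 0 < a -> 0 <= x ->
  (\int[mu]_(y in `]-oo, x[) (rk a y)%:E = (x `^ a / a)%:E)%E.
Proof.
move=> a0 x0; rewrite -(integral_powR_oo a0 x0) [RHS]integral_mkcond.
rewrite [LHS]integral_mkcond; apply: eq_integral => y _.
rewrite !patchE !mem_setE !in_itv/= /rk.
by case: (y < x); rewrite ?andbF ?andbT//; case: (0 < y).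
Qed.

(** Together with [integral_rk_right], this gives the two kernel masses that [schur_test] asks
    for. *)
Lemma integral_rk_left a T s : 0 < a -> 0 < T -> 0 <= s ->
  (\int[mu]_(t in I0 T) (rk a (t - s))%:E <= (T `^ a / a)%:E)%E.
Proof.
move=> a0 T0 s0; rewrite -(integral_rk a0 (ltW T0)) integral_mkcond [leRHS]integral_mkcond.
have mr : measurable_fun setT ((fun y => (rk a y)%:E) \_ `]-oo, T[%classic).
  apply/(measurable_restrictT _ (measurable_itv _))/measurable_funTS.
  by apply/measurable_EFinP; exact: measurable_rk.
have r0 y : (0 <= ((fun y => (rk a y)%:E) \_ `]-oo, T[%classic) y)%E.
  by rewrite patchE; case: ifP => // _; rewrite lee_fin rk_ge0.
rewrite -(ge0_integral_shift (- s) mr r0).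
apply: ge0_le_integral => //.
- by move=> t _; rewrite patchE; case: ifP => // _; rewrite lee_fin rk_ge0.
- apply/(measurable_restrictT _ (measurable_itv _))/measurable_funTS.
  apply/measurable_EFinP; apply: (measurableT_comp (measurable_rk a)).
  exact: measurable_funB.
- by apply: measurableT_comp => //; exact: measurable_funD.
- move=> t _; rewrite patchE mem_setE in_itv/=; case: ifPn => // /andP[t1 t2].
  by rewrite patchE mem_setE in_itv/= (le_lt_trans _ t2)// gerDl oppr_le0.
Qed.

Lemma integral_rk_right a T t : 0 < a -> 0 < T -> t <= T ->
  (\int[mu]_(s in I0 T) (rk a (t - s))%:E <= (T `^ a / a)%:E)%E.
Proof.
move=> a0 T0 tT; rewrite -(integral_rk a0 (ltW T0)) integral_mkcond [leRHS]integral_mkcond.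
have mr : measurable_fun setT ((fun y => (rk a y)%:E) \_ `]-oo, T[%classic).
  apply/(measurable_restrictT _ (measurable_itv _))/measurable_funTS.
  by apply/measurable_EFinP; exact: measurable_rk.
have r0 y : (0 <= ((fun y => (rk a y)%:E) \_ `]-oo, T[%classic) y)%E.
  by rewrite patchE; case: ifP => // _; rewrite lee_fin rk_ge0.
rewrite -(ge0_integral_reflect t mr r0).
apply: ge0_le_integral => //.
- by move=> s _; rewrite patchE; case: ifP => // _; rewrite lee_fin rk_ge0.
- apply/(measurable_restrictT _ (measurable_itv _))/measurable_funTS.
  apply/measurable_EFinP; apply: (measurableT_comp (measurable_rk a)).
  exact: measurable_funB.
- by apply: measurableT_comp => //; exact: measurable_funB.
- move=> s _; rewrite patchE mem_setE in_itv/=; case: ifPn => // /andP[t1 t2].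
  by rewrite patchE mem_setE in_itv/= (lt_le_trans _ tT)// gtrDl oppr_lt0.
Qed.

End power_kernel.

(** * The Gamma function and the Beta integral *)

Section gamma_beta.
Context {R : realType}.
Local Notation mu := (@lebesgue_measure R).
Implicit Types (a b t x : R).

(** The Gamma integral as an extended real, where Tonelli's theorem applies without questions of
    finiteness. *)
Definition egamma a : \bar R := (\int[mu]_x (rk a x * expR (- x))%:E)%E.

Let mrke a : measurable_fun setT (fun x : R => (rk a x * expR (- x))%:E).
Proof.
apply/measurable_EFinP; apply: measurable_funM; first exact: measurable_rk.
by apply: measurableT_comp => //; exact: measurable_expR.
Qed.

Lemma GammaE a : Gamma a = fine (egamma a).
Proof.
rewrite /Gamma /Rintegral; congr fine; rewrite integral_mkcond.
apply: eq_integral => x _; rewrite patchE mem_setE in_itv/= andbT /rk.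
by case: ifP => _ //; rewrite mul0r.
Qed.

Lemma egamma_ge0 a : (0 <= egamma a)%E.
Proof.
by apply: integral_ge0 => x _; rewrite lee_fin mulr_ge0 ?rk_ge0 ?expR_ge0.
Qed.

(** One Taylor term of exp(x/2) dominates x^(a-1); the other half of the exponential is kept for
    integrability. *)
Lemma powR_le_expR a : exists2 C : R, 0 < C &
  forall x, 1 <= x -> x `^ (a - 1) <= C * expR (x / 2).
Proof.
pose n := Num.truncn `|a|.
exists (2 ^+ n.+1 * (n.+1)`!%:R); first by rewrite mulr_gt0 ?exprn_gt0// ltr0n fact_gt0.
move=> x x1; have x0 : 0 <= x by exact: le_trans x1.
apply: (@le_trans _ _ (x `^ n.+1%:R)).
  apply: ler_powR => //; rewrite lerBlDr (le_trans (ler_norm a))//.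
  by rewrite -natr1 (le_trans (ltW (truncnS_gt _)))// -natr1 lerDl.
rewrite powR_mulrn// -{1}[x](divfK (_ : 2 != 0))// exprMn mulrC -mulrA.
rewrite ler_wpM2l ?exprn_ge0//.
have := @expR_ge1Dxn _ (x / 2) n; rewrite divr_ge0// => /(_ isT) H.
rewrite [leRHS]mulrC -ler_pdivrMr ?ltr0n ?fact_gt0//; apply: le_trans H.
by rewrite lerDr.
Qed.

(** On (0,1) the integrand is at most x^(a-1). From 1 on it is at most C exp(-x/2), which is 2 C
    times the exponential density of rate 1/2. *)
Lemma egamma_lty a : 0 < a -> (egamma a < +oo)%E.
Proof.
move=> a0; have [C C0 HC] := powR_le_expR a.
have h0 : 0 < (2^-1 : R) by rewrite invr_gt0.
apply: (@le_lt_trans _ _ (\int[mu]_x ((((fun x => (x `^ (a - 1))%:E) \_ `]0%R, 1%R[) x) +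
     (2 * C)%:E * (exponential_pdf 2^-1 x)%:E))%E).
  apply: ge0_le_integral => //.
  - by move=> x _; rewrite lee_fin mulr_ge0 ?rk_ge0 ?expR_ge0.
  - exact: mrke.
  - apply: emeasurable_funD.
      apply/(measurable_restrictT _ (measurable_itv _))/measurable_funTS.
      by apply/measurable_EFinP; exact: measurable_powR.
    by apply: measurable_funeM; apply/measurable_EFinP; exact: measurable_exponential_pdf.
  - move=> x _; rewrite patchE mem_setE in_itv/=.
    have [x0|x0] := leP x 0.
      rewrite rk_le0// mul0r /= [X in (X + _)%E](_ : _ = 0%E)// add0e mule_ge0// lee_fin.
        by rewrite mulr_ge0// ltW.
      by rewrite exponential_pdf_ge0.
    rewrite rk_gt0//= exponential_pdfE ?(ltW x0)//.
    have [x1|x1] := ltP x 1.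
      rewrite /= -EFinM. rewrite -EFinD lee_fin -[leLHS]addr0 lerD//.
        by rewrite ler_piMr ?powR_ge0// -expR0 ler_expR oppr_le0 ltW.
      by rewrite !mulr_ge0// ?expR_ge0 ?ltW.
    rewrite /= [X in (X + _)%E](_ : _ = 0%E)// add0e -EFinM lee_fin mulrA (mulrAC 2) divff// mul1r.
    apply: (@le_trans _ _ (C * expR (x / 2) * expR (- x))).
      by rewrite ler_wpM2r ?expR_ge0// HC.
    rewrite -mulrA ler_wpM2l ?(ltW C0)// -expRD ler_expR; lra.
rewrite ge0_integralD//; last 4 first.
- by move=> x _; rewrite patchE; case: ifP => // _; rewrite lee_fin powR_ge0.
- apply/(measurable_restrictT _ (measurable_itv _))/measurable_funTS.
  by apply/measurable_EFinP; exact: measurable_powR.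
- move=> x _; rewrite mule_ge0// lee_fin ?exponential_pdf_ge0//.
  by rewrite mulr_ge0// ltW.
- by apply: measurable_funeM; apply/measurable_EFinP; exact: measurable_exponential_pdf.
rewrite -integral_mkcond integral_powR_oo// ge0_integralZl//; last 3 first.
- by apply/measurable_EFinP; exact: measurable_exponential_pdf.
- by move=> x _; rewrite lee_fin exponential_pdf_ge0.
- by rewrite lee_fin mulr_ge0// ltW.
by rewrite integral_exponential_pdf// mule1 -EFinD ltry.
Qed.

Lemma egamma1 : egamma 1 = 1%E.
Proof.
rewrite -(@integral_exponential_pdf _ 1)//; apply: ae_eq_integral => //.
- exact: mrke.
- by apply/measurable_EFinP; exact: measurable_exponential_pdf.
exists [set 0]; split => //; first exact: lebesgue_measure_set1.
move=> x /= H; apply: contrapT => x0; apply: H => _.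
have [x1|x1] := ltP x 0.
  by rewrite rk_le0 ?(ltW x1)// mul0r lt0_exponential_pdf.
have {}x1 : 0 < x by rewrite lt_neqAle x1 andbT eq_sym; apply/eqP.
by rewrite exponential_pdfE ?(ltW x1)// rk_gt0// subrr powRr0 mulN1r.
Qed.

Lemma Gamma1 : Gamma 1 = 1 :> R.
Proof. by rewrite GammaE egamma1. Qed.

(** If the integral were 0, the integrand would vanish almost everywhere, yet it is positive on
    (0,1). *)
Lemma egamma_gt0 a : (0 < egamma a)%E.
Proof.
rewrite lt0e egamma_ge0 andbT; apply/eqP => g0.
have := (@ae_eq_integral_abs _ _ _ mu setT measurableT _ (mrke a)).1.
under eq_integral do rewrite /= ger0_norm ?mulr_ge0 ?rk_ge0 ?expR_ge0//.
move=> /(_ g0)[N [mN N0 sub]].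
have : (mu (`]0%R, 1%R[%classic : set R) <= mu N)%E.
  apply: le_measure; rewrite ?inE//.
  move=> x /=; rewrite in_itv/= => /andP[x0 _]; apply: sub => /=.
  move=> /(_ I)/eqP; rewrite eqe mulf_eq0 (gt_eqF (expR_gt0 _)) orbF.
  by rewrite rk_gt0// gt_eqF// powR_gt0.
by rewrite N0 lebesgue_measure_itv/= lte_fin ltr01 oppr0 adde0 lee_fin ler10.
Qed.

Lemma egammaE a : 0 < a -> egamma a = (Gamma a)%:E.
Proof. by move=> a0; rewrite GammaE fineK// ge0_fin_numE ?egamma_ge0// egamma_lty. Qed.

Lemma Gamma_gt0 a : 0 < a -> 0 < Gamma a.
Proof. by move=> a0; rewrite -lte_fin -egammaE// egamma_gt0. Qed.

Let ebeta a b : \bar R := (\int[mu]_x (rk a (1 - x) * rk b x)%:E)%E.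

Let mbeta a b t : measurable_fun setT (fun x : R => (rk a (t - x) * rk b x)%:E).
Proof.
apply/measurable_EFinP; apply: measurable_funM; last exact: measurable_rk.
exact: measurable_rk_sub.
Qed.

Let beta_ge0 a b t x : (0 <= (rk a (t - x) * rk b x)%:E)%E.
Proof. by rewrite lee_fin mulr_ge0 ?rk_ge0. Qed.

(** Homogeneity: the substitution x -> t x extracts t^(a-1) t^(b-1) t. For t <= 0 the two cut-offs
    exclude each other. *)
Let ebeta_scale a b t :
  (\int[mu]_x (rk a (t - x) * rk b x)%:E = ebeta a b * (rk (a + b) t)%:E)%E.
Proof.
have [t0|t0] := leP t 0.
  rewrite (rk_le0 _ t0) mule0; apply: integral0_eq => x _.
  have [x0|x0] := leP x 0; first by rewrite (rk_le0 _ x0) mulr0.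
  by rewrite rk_le0 ?mul0r// subr_le0 (le_trans t0)// ltW.
rewrite -(ge0_integral_affine 0 t0 (mbeta a b t) (beta_ge0 a b t)).
rewrite (_ : (\int[mu]_x _)%E =
  ((t `^ (a + b - 2))%:E * ebeta a b)%E); last first.
  rewrite /ebeta -ge0_integralZl//; last 2 first.
  - exact: mbeta.
  - by rewrite lee_fin powR_ge0.
  apply: eq_integral => x _; rewrite addr0 -EFinM.
  congr (_%:E).
  have -> : t - t * x = t * (1 - x) by rewrite mulrBr mulr1.
  have [x0|x0] := leP x 0.
    by rewrite !(@rk_le0 _ b) ?mulr0// mulr_ge0_le0// ltW.
  have [x1|x1] := leP 1 x.
    rewrite !(@rk_le0 _ a) ?mul0r ?mulr0 ?subr_le0//.
    by rewrite mulr_ge0_le0 ?(ltW t0)// subr_le0.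
  have x10 : 0 < 1 - x by rewrite subr_gt0.
  rewrite !rk_gt0 ?mulr_gt0// !powRM ?(ltW t0) ?(ltW x0) ?(ltW x10)//.
  rewrite mulrACA; congr (_ * _); rewrite -powRD; last by rewrite (gt_eqF t0) implybT.
  by congr (_ `^ _); ring.
rewrite muleA -EFinM muleC rk_gt0//; congr (_ * _%:E)%E.
rewrite -{1}(powRr1 (ltW t0)) -powRD; last by rewrite (gt_eqF t0) implybT.
by congr (_ `^ _); ring.
Qed.

(** Euler's identity. A shift by y writes the product as a double integral with the factor exp(-t);
    after Tonelli the inner integral is the convolution computed by [ebeta_scale]. *)
Let ebetaE a b : 0 < a -> 0 < b ->
  (egamma a * egamma b = ebeta a b * egamma (a + b))%E.
Proof.
move=> a0 b0.
pose F (y t : R) : \bar R := (rk a (t - y) * rk b y * expR (- t))%:E.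
have F0 y t : (0 <= F y t)%E by rewrite lee_fin !mulr_ge0 ?rk_ge0 ?expR_ge0.
have mF : measurable_fun [set: R * R] (fun z => F z.1 z.2).
  apply/measurable_EFinP; apply: measurable_funM.
    apply: measurable_funM.
      apply: (measurableT_comp (measurable_rk a)).
      exact: (measurable_funB measurable_snd measurable_fst).
    exact: (measurableT_comp (measurable_rk b) measurable_fst).
  apply: (measurableT_comp (@measurable_expR R)).
  by apply: measurableT_comp => //; exact: measurable_snd.
transitivity (\int[mu]_y \int[mu]_t F y t)%E.
  have re0 c x : (0 <= (rk c x * expR (- x))%:E)%E.
    by rewrite lee_fin mulr_ge0 ?rk_ge0 ?expR_ge0.
  rewrite muleC [in LHS]/egamma -ge0_integralZr ?egamma_ge0//; last exact: mrke.
  apply: eq_integral => y _; rewrite -ge0_integralZl//; last exact: mrke.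
  have mG := measurable_funeM (rk b y * expR (- y))%:E (mrke a).
  rewrite -(@ge0_integral_shift _ _ (- y) mG); last first.
    by move=> x; rewrite mule_ge0.
  apply: eq_integral => t _; rewrite /F -EFinM; congr (_%:E).
  rewrite mulrACA -expRD mulrC (mulrC (rk b y)) opprD opprK.
  by rewrite addrCA addNr addr0 mulrC.
rewrite (@tonelli_on _ setT setT F)//.
rewrite /(egamma (a + b)) -ge0_integralZl//; last 2 first.
- by move=> x _; rewrite lee_fin mulr_ge0 ?rk_ge0 ?expR_ge0.
- by apply: integral_ge0.
  apply: eq_integral => t _; rewrite EFinM muleA -ebeta_scale.
  by rewrite -ge0_integralZr//; exact: mbeta.
exact: mrke.
Qed.

Lemma rk_convolution a b t : 0 < a -> 0 < b ->
  (\int[mu]_x (rk a (t - x) * rk b x)%:E =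
   (Gamma a * Gamma b / Gamma (a + b) * rk (a + b) t)%:E)%E.
Proof.
move=> a0 b0; have ab0 : 0 < a + b by rewrite addr_gt0.
rewrite ebeta_scale EFinM; congr (_ * _)%E.
have := ebetaE a0 b0; rewrite !egammaE// => H.
have Gn0 : Gamma (a + b) != 0 by rewrite gt_eqF// Gamma_gt0.
rewrite EFinM EFinM H -muleA -EFinM divff// mule1 //.
Qed.

End gamma_beta.

(** A common shape for almost-everywhere facts, of which [eq_ae0T] is an instance up to conversion;
    the two lemmas below combine such facts pointwise. *)
Definition ae_in d (U : measurableType d) (R : realType)
    (mu : {measure set U -> \bar R}) (D : set U) (P : U -> Prop) : Prop :=
  \forall x \ae mu, D x -> P x.

Lemma ae_imply d (U : measurableType d) (R : realType)
    (mu : {measure set U -> \bar R}) (D : set U) (P Q : U -> Prop) :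
  ae_in mu D P -> (forall x, D x -> P x -> Q x) -> ae_in mu D Q.
Proof.
by rewrite /ae_in => H PQ; move: H; apply: filterS => x Px Dx; exact/PQ/Px.
Qed.

Lemma ae_imply2 d (U : measurableType d) (R : realType)
    (mu : {measure set U -> \bar R}) (D : set U) (P1 P2 Q : U -> Prop) :
  ae_in mu D P1 -> ae_in mu D P2 ->
  (forall x, D x -> P1 x -> P2 x -> Q x) -> ae_in mu D Q.
Proof.
rewrite /ae_in => H1 H2 PQ; move: H1 H2; apply: filterS2 => x P1x P2x Dx.
by apply: PQ => //; [exact: P1x|exact: P2x].
Qed.

(** * Fractional integrals: Young's inequality and the semigroup law *)

Section riemann_liouville.
Context {R : realType}.
Local Notation mu := (@lebesgue_measure R).
Local Notation leb := (mu : {measure set (measurableTypeR R) -> \bar R}).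
Local Notation I0 T := (`]0%R, T[%classic : set R).
Implicit Types (a b p T : R) (u v w : R -> R).

(** The kernel vanishes from t on, so only the part of B below t matters. The choice ]0,
    T[ suits estimates; ]0, +oo[ does not depend on t and gives measurability of [RLint a v] on the
    whole line. *)
Lemma RLint_on a v t (B : set R) : measurable B ->
  (forall s, s < t -> (s \in B) = (0 < s)) -> measurable_fun B v ->
  RLint a v t = (Gamma a)^-1 * Rintegral mu B (fun s => rk a (t - s) * v s).
Proof.
move=> mB Bt mv; rewrite /RLint; congr (_ * _); rewrite /Rintegral; congr fine.
rewrite integral_mkcond [RHS]integral_mkcond; apply: eq_integral => s _.
rewrite !patchE mem_setE in_itv/= /rk subr_gt0; have [st|ts] := ltP s t.
  by rewrite Bt// andbT.
by rewrite andbF mul0r; case: ifP.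
Qed.

Lemma RLint_D a v T t : t <= T -> measurable_fun (I0 T) v ->
  RLint a v t = (Gamma a)^-1 * Rintegral mu (I0 T) (fun s => rk a (t - s) * v s).
Proof.
move=> tT mv; apply: RLint_on => // s st.
by rewrite mem_setE in_itv/= (lt_le_trans st tT) andbT.
Qed.

Lemma measurable_rk_mul a t v (B : set R) : measurable_fun B v ->
  measurable_fun B (fun s => rk a (t - s) * v s).
Proof.
move=> mv; apply: measurable_funM => //; apply: measurable_funTS.
exact: measurable_rk_sub.
Qed.

Lemma measurable_rk_mul2 a v : measurable_fun setT v ->
  measurable_fun [set: R * R] (fun z => rk a (z.1 - z.2) * v z.2).
Proof.
move=> mv; apply: measurable_funM; first exact: measurable_rkB.
exact: (measurableT_comp mv measurable_snd).
Qed.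

Lemma measurable_RLint a v : measurable_fun setT v ->
  measurable_fun setT (RLint a v).
Proof.
move=> mv; rewrite [X in measurable_fun _ X](_ : _ = fun t => (Gamma a)^-1 *
    Rintegral mu `]0%R, +oo[%classic (fun s => rk a (t - s) * v s)); last first.
  apply/funext => t; apply: RLint_on => // [s _|].
    by rewrite mem_setE in_itv/= andbT.
  exact: measurable_funTS.
apply: measurable_funM => //.
apply: (@measurable_int_on _ _ (fun t s => rk a (t - s) * v s)) => //.
exact: measurable_rk_mul2.
Qed.

Lemma eq_RLint a u v T t : t <= T ->
  measurable_fun (I0 T) u -> measurable_fun (I0 T) v -> eq_ae0T T u v ->
  RLint a u t = RLint a v t.
Proof.
move=> tT mu0 mv uv; rewrite !(@RLint_D _ _ T)//; congr (_ * _).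
rewrite /Rintegral; congr fine; apply: ae_eq_integral => //.
- by apply/measurable_EFinP; exact: measurable_rk_mul.
- by apply/measurable_EFinP; exact: measurable_rk_mul.
- by apply: filterS uv => s us Ds; rewrite us.
Qed.

Lemma le_RLint a v T t : 0 < a -> t <= T -> measurable_fun (I0 T) v ->
  (`|RLint a v t|%:E <=
   (Gamma a)^-1%:E * \int[mu]_(s in I0 T) (rk a (t - s) * `|v s|)%:E)%E.
Proof.
move=> a0 tT mv; rewrite (RLint_D _ tT)// normrM ger0_norm ?invr_ge0 ?(ltW (Gamma_gt0 a0))//.
rewrite EFinM; apply: lee_wpmul2l; first by rewrite lee_fin invr_ge0 ltW// Gamma_gt0.
apply: le_trans (le_Rintegral_abs _ _) _ => //; first exact: measurable_rk_mul.
rewrite le_eqVlt; apply/orP; left; apply/eqP; apply: eq_integral => s _.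
by rewrite normrM ger0_norm ?rk_ge0.
Qed.

(** The L^1 norm on (0,T) of the kernel s^(a-1)/Gamma(a), hence Young's bound for J^a on every
    L^p(0,T). *)
Definition RLnorm a T : R := T `^ a / a / Gamma a.

Lemma RLnorm_ge0 a T : 0 < a -> 0 <= RLnorm a T.
Proof.
move=> a0; rewrite /RLnorm divr_ge0 ?(ltW (Gamma_gt0 a0))//.
by rewrite divr_ge0 ?powR_ge0 ?ltW.
Qed.

Lemma energy_RLint a p T v : 0 < a -> 1 <= p -> 0 < T -> measurable_fun setT v ->
  (energy p T (RLint a v) <= (RLnorm a T `^ p)%:E * energy p T v)%E.
Proof.
move=> a0 p1 T0 mv.
have p0 : 0 < p by exact: lt_le_trans p1.
have G0 := Gamma_gt0 a0.
have Ta0 : 0 <= T `^ a / a by rewrite divr_ge0 ?powR_ge0 ?ltW.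
have mav : measurable_fun setT (fun s => `|v s|) by exact: measurableT_comp.
have mI : measurable_fun setT (fun t : R => \int[mu]_(s in I0 T) (rk a (t - s) * `|v s|)%:E)%E.
  apply: (@measurable_tonelli_on _ _ (fun t s => (rk a (t - s) * `|v s|)%:E)) => //.
    by apply/measurable_EFinP; exact: (measurable_rk_mul2 a mav).
  by move=> t s; rewrite lee_fin mulr_ge0// rk_ge0.
have I_ge0 t : (0 <= \int[mu]_(s in I0 T) (rk a (t - s) * `|v s|)%:E)%E.
  by apply: integral_ge0 => s _; rewrite lee_fin mulr_ge0// rk_ge0.
apply: (@le_trans _ _ (\int[mu]_(t in I0 T) ((((Gamma a)^-1) `^ p)%:E *
   (\int[mu]_(s in I0 T) (rk a (t - s) * `|v s|)%:E) `^ p))%E).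
  apply: ge0_le_integral => //.
  - by apply: measurable_energy; apply: measurable_funTS; exact: measurable_RLint.
  - apply: measurable_funTS; apply: measurable_funeM.
    exact: (measurableT_comp (measurable_poweR p)).
  - move=> t; rewrite /= in_itv/= => /andP[t0 tT].
    rewrite -poweR_EFin -[X in (X * _)%E]poweR_EFin -poweRM//; last first.
      by rewrite lee_fin invr_ge0 ltW.
    apply: poweR_le; [exact: ltW|by rewrite lee_fin|].
    by apply: le_RLint => //; [exact: ltW|exact: measurable_funTS].
rewrite ge0_integralZl//; last 3 first.
- apply: measurable_funTS; exact: (measurableT_comp (measurable_poweR p)).
- by move=> t _; exact: poweR_ge0.
- by rewrite lee_fin powR_ge0.
have Gi0 : 0 <= (Gamma a)^-1 by rewrite invr_ge0 ltW.
rewrite /RLnorm (mulrC (T `^ a / a)) (powRM _ Gi0)//.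
rewrite EFinM -muleA; apply: lee_wpmul2l; first by rewrite lee_fin powR_ge0.
have := @schur_test R p (T `^ a / a) (T `^ a / a) (I0 T) (I0 T)
  (fun t s => rk a (t - s)) (fun s => `|v s|) p1 (measurable_itv _) (measurable_itv _)
  (measurable_rkB a) mav _ _ Ta0 Ta0.
rewrite (mulrC (_ `^ (p - 1))) mulr_powRB1//; apply => //.
- by move=> t s; exact: rk_ge0.
- by move=> t; rewrite /= in_itv/= => /andP[_ /ltW tT]; exact: integral_rk_right.
- by move=> s; rewrite /= in_itv/= => /andP[/ltW s0 _]; exact: integral_rk_left.
Qed.

Lemma mLp_RLint a p T v : 0 < a -> 1 <= p -> 0 < T -> mLp p T v ->
  mLp p T (RLint a v).
Proof.
move=> a0 p1 T0 [mv ev]; split; first exact: measurable_RLint.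
apply: le_lt_trans (energy_RLint a0 p1 T0 mv) _.
by apply: lte_mul_pinfty => //; rewrite lee_fin powR_ge0.
Qed.

(** The case p = 1 of Schur's test: the integral of absolute values is integrable in t, hence finite
    for almost all t. At these points [RLint] is a genuine integral and not a default value. *)
Lemma ae_integrable_rk a T v : 0 < a -> 0 < T -> mLp 1 T v ->
  ae_in mu (I0 T) (fun t =>
    mu.-integrable (I0 T) (EFin \o (fun s => rk a (t - s) * v s))).
Proof.
move=> a0 T0 [mv ev].
have mav : measurable_fun setT (fun s => `|v s|) by exact: measurableT_comp.
pose J t := (\int[mu]_(s in I0 T) (rk a (t - s) * `|v s|)%:E)%E.
have J_ge0 t : (0 <= J t)%E.
  by apply: integral_ge0 => s _; rewrite lee_fin mulr_ge0// rk_ge0.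
have mJ : measurable_fun setT J.
  apply: (@measurable_tonelli_on _ _ (fun t s => (rk a (t - s) * `|v s|)%:E)) => //.
    by apply/measurable_EFinP; exact: (measurable_rk_mul2 a mav).
  by move=> t s; rewrite lee_fin mulr_ge0// rk_ge0.
have iJ : leb.-integrable (I0 T) J.
  apply/integrableP; split; first exact: measurable_funTS.
  rewrite [ltLHS](_ : _ = \int[mu]_(t in I0 T) (J t `^ 1))%E; last first.
    by apply: eq_integral => t _; rewrite gee0_abs// poweRe1.
  have Ta0 : 0 <= T `^ a / a by rewrite divr_ge0 ?powR_ge0 ?ltW.
  have := @schur_test R 1 (T `^ a / a) (T `^ a / a) (I0 T) (I0 T)
    (fun t s => rk a (t - s)) (fun s => `|v s|) (lexx _) (measurable_itv _) (measurable_itv _)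
    (measurable_rkB a) mav _ _ Ta0 Ta0.
  move=> H; apply: le_lt_trans (H _ _ _ _) _ => //.
  - by move=> t s; exact: rk_ge0.
  - by move=> t; rewrite /= in_itv/= => /andP[_ /ltW tT]; exact: integral_rk_right.
  - by move=> s; rewrite /= in_itv/= => /andP[/ltW s0 _]; exact: integral_rk_left.
  - by apply: lte_mul_pinfty => //; rewrite lee_fin mulr_ge0// powR_ge0.
have := @integrable_ae _ _ _ leb (I0 T) (measurable_itv _) J iJ.
apply: filterS => t Jt Dt.
apply: integrable_on.
  by apply: measurable_funTS; exact: measurable_rk_mul.
rewrite [ltLHS](_ : _ = J t); last first.
  by apply: eq_integral => s _; rewrite normrM ger0_norm// rk_ge0.
by rewrite -ge0_fin_numE//; exact: Jt.
Qed.

(** Additivity can fail at a point where one of the integrals diverges and is replaced by 0. *)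
Lemma RLintD_ae a T u v : 0 < a -> 0 < T -> mLp 1 T u -> mLp 1 T v ->
  eq_ae0T T (RLint a (fun s => u s + v s)) (fun t => RLint a u t + RLint a v t).
Proof.
move=> a0 T0 Lu Lv; have Iu := ae_integrable_rk a0 T0 Lu.
have Iv := ae_integrable_rk a0 T0 Lv; apply: (ae_imply2 Iu Iv) => t Dt ut vt.
have tT : t <= T by move: Dt; rewrite /= in_itv/= => /andP[_ /ltW].
rewrite !(RLint_D _ tT); [|exact: measurable_funTS Lv.1|exact: measurable_funTS Lu.1|]; last first.
  by apply: measurable_funTS; exact: measurable_funD Lu.1 Lv.1.
rewrite -mulrDr; congr (_ * _); rewrite -RintegralD//.
by apply: eq_Rintegral => s _; rewrite mulrDr.
Qed.

Lemma RLintZ a T c v t : t <= T -> measurable_fun (I0 T) v ->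
  RLint a (fun s => c * v s) t = c * RLint a v t.
Proof.
move=> tT mv; rewrite !(RLint_D _ tT)//; last exact: measurable_funM.
rewrite mulrCA; congr (_ * _).
rewrite -RintegralZl_measurable//; last exact: measurable_rk_mul.
by apply: eq_Rintegral => s _; rewrite mulrCA.
Qed.

Lemma RLintB_ae a T u v : 0 < a -> 0 < T -> mLp 1 T u -> mLp 1 T v ->
  eq_ae0T T (RLint a (fun s => u s - v s)) (fun t => RLint a u t - RLint a v t).
Proof.
move=> a0 T0 Lu Lv; have LN := mLpZ (-1) Lv.
apply: (ae_imply (RLintD_ae a0 T0 Lu LN)) => t Dt H.
have tT : t <= T by move: Dt; rewrite /= in_itv/= => /andP[_ /ltW].
have -> : RLint a (fun s => u s - v s) t = RLint a (fun s => u s + -1 * v s) t.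
  by congr RLint; apply/funext => s; rewrite mulN1r.
by rewrite H (@RLintZ _ T)// ?mulN1r//; exact: measurable_funTS Lv.1.
Qed.

(** Fubini's theorem reduces the composition to the Beta convolution of the two kernels. The
    absolute convergence it needs at t is, up to the Beta factor, that of the integral defining
    [RLint (a + b) v t]. *)
Lemma RLint_semigroup a b T v : 0 < a -> 0 < b -> 0 < T -> mLp 1 T v ->
  eq_ae0T T (RLint a (RLint b v)) (RLint (a + b) v).
Proof.
move=> a0 b0 T0 Lv; have mv := Lv.1; have ab0 : 0 < a + b by rewrite addr_gt0.
pose B := Gamma a * Gamma b / Gamma (a + b).
have Gn0 (c : R) : 0 < c -> Gamma c != 0 by move=> c0; rewrite gt_eqF// Gamma_gt0.
have inner t r : t <= T -> 0 < r ->
    (\int[mu]_(s in I0 T) (rk a (t - s) * rk b (s - r))%:E =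
     (B * rk (a + b) (t - r))%:E)%E.
  move=> tT r0; rewrite -(rk_convolution (t - r) a0 b0).
  have mc : measurable_fun setT (fun x : R => (rk a (t - r - x) * rk b x)%:E).
    apply/measurable_EFinP; apply: measurable_funM; last exact: measurable_rk.
    exact: measurable_rk_sub.
  rewrite -(ge0_integral_shift (- r) mc); last first.
    by move=> x; rewrite lee_fin mulr_ge0 ?rk_ge0.
  rewrite integral_mkcond; apply: eq_integral => s _.
  rewrite patchE mem_setE in_itv/=.
  have -> : t - r - (s - r) = t - s by ring.
  case: ifPn => //; rewrite negb_and -!leNgt => /orP[s0|Ts].
    by rewrite (@rk_le0 _ b) ?mulr0// subr_le0 (le_trans s0)// ltW.
  by rewrite (@rk_le0 _ a) ?mul0r// subr_le0 (le_trans tT).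
apply: (ae_imply (ae_integrable_rk ab0 T0 Lv)) => t Dt it.
have tT : t <= T by move: Dt; rewrite /= in_itv/= => /andP[_ /ltW].
have mvD : measurable_fun (I0 T) v by exact: measurable_funTS.
rewrite (RLint_D _ tT); last first.
  by apply: measurable_funTS; exact: measurable_RLint.
rewrite (RLint_D _ tT)//.
pose f s r := rk a (t - s) * (rk b (s - r) * v r).
have mf : measurable_fun [set: R * R] (fun z => f z.1 z.2).
  apply: measurable_funM; last exact: measurable_rk_mul2.
  apply: (measurableT_comp (measurable_rk a)).
  exact: (measurable_funB (measurable_cst _) measurable_fst).
have foo : (\int[mu]_(s in I0 T) \int[mu]_(r in I0 T) `|f s r|%:E < +oo)%E.
  rewrite (@tonelli_on _ (I0 T) (I0 T) (fun s r => `|f s r|%:E))//; last first.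
    by apply/measurable_EFinP; exact: measurableT_comp.
  rewrite [ltLHS](_ : _ = \int[mu]_(r in I0 T) (B%:E * `|(rk (a + b) (t - r) * v r)%:E|))%E; last first.
    apply: eq_integral => r; rewrite inE/= in_itv/= => /andP[r0 _].
    rewrite [LHS](_ : _ = \int[mu]_(s in I0 T) ((rk a (t - s) * rk b (s - r))%:E * `|v r|%:E))%E.
      rewrite ge0_integralZr//; last 2 first.
      - apply/measurable_EFinP; apply: measurable_funTS; apply: measurable_funM.
          exact: measurable_rk_sub.
        by apply: (measurableT_comp (measurable_rk b)); exact: measurable_funB.
      - by move=> s _; rewrite lee_fin mulr_ge0 ?rk_ge0.
      rewrite inner//= normrM (ger0_norm (rk_ge0 _ _)).
      by rewrite -!EFinM mulrA.
    apply: eq_integral => s _; rewrite /f !normrM !(ger0_norm (rk_ge0 _ _)).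
    by rewrite -EFinM mulrA.
  move/integrableP : it => [mi ii].
  rewrite ge0_integralZl//; last 2 first.
  - by apply: measurableT_comp.
  - rewrite lee_fin /B divr_ge0 ?mulr_ge0//; exact/ltW/Gamma_gt0.
  apply: lte_mul_pinfty => //.
  rewrite lee_fin /B divr_ge0 ?mulr_ge0//; exact/ltW/Gamma_gt0.
have H := fubini_on (measurable_itv _) (measurable_itv _) mf foo.
transitivity ((Gamma a)^-1 * ((Gamma b)^-1 *
    Rintegral mu (I0 T) (fun s => Rintegral mu (I0 T) (f s)))).
  congr (_ * _); rewrite -RintegralZl_measurable//; last first.
    by apply: measurable_funTS; exact: measurable_int_on.
  apply: eq_Rintegral => s; rewrite inE/= in_itv/= => /andP[_ /ltW sT].
  rewrite (RLint_D _ sT)// mulrCA; congr (_ * _).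
  rewrite /f RintegralZl_measurable//.
  exact: measurable_rk_mul.
rewrite H; transitivity ((Gamma a)^-1 * ((Gamma b)^-1 *
    (B * Rintegral mu (I0 T) (fun r => rk (a + b) (t - r) * v r)))).
  congr (_ * (_ * _)); rewrite -RintegralZl_measurable//; last exact: measurable_rk_mul.
  apply: eq_Rintegral => r; rewrite inE/= in_itv/= => /andP[r0 _].
  rewrite /f; under eq_Rintegral do rewrite mulrA mulrC.
  rewrite RintegralZl_measurable//; last first.
    apply: measurable_funTS; apply: measurable_funM.
      exact: measurable_rk_sub.
    by apply: (measurableT_comp (measurable_rk b)); exact: measurable_funB.
  by rewrite /Rintegral inner//= mulrC mulrA.
rewrite /B; move: (Rintegral _ _ _) (Gn0 _ a0) (Gn0 _ b0) (Gn0 _ ab0) => I.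
move: (Gamma a) (Gamma b) (Gamma (a + b)) => x y z x0 y0 z0.
by field; rewrite x0 y0 z0.
Qed.

Lemma RLint_comm a b T v : 0 < a -> 0 < b -> 0 < T -> mLp 1 T v ->
  eq_ae0T T (RLint a (RLint b v)) (RLint b (RLint a v)).
Proof.
move=> a0 b0 T0 Lv; have H := RLint_semigroup b0 a0 T0 Lv; rewrite addrC in H.
by apply: (ae_imply2 (RLint_semigroup a0 b0 T0 Lv) H) => t Dt -> ->.
Qed.

End riemann_liouville.

(** * Translations of the kernel in L^1 *)

Section translation.
Context {R : realType}.
Local Notation mu := (@lebesgue_measure R).
Local Notation I0 T := (`]0%R, T[%classic : set R).
Implicit Types (a b p T : R) (u v w : R -> R).

Lemma integral_shift (f : R -> \bar R) (c : R) : measurable_fun setT f ->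
  (\int[mu]_x f (x + c)%R = \int[mu]_x f x)%E.
Proof.
move=> mf; rewrite integralE [RHS]integralE; congr (_ - _)%E.
  have mp : measurable_fun setT (f^\+)%E by exact: measurable_funepos.
  by rewrite -(ge0_integral_shift c mp)//; apply: eq_integral => x _; rewrite !funeposE.
have mn : measurable_fun setT (f^\-)%E by exact: measurable_funeneg.
by rewrite -(ge0_integral_shift c mn)//; apply: eq_integral => x _; rewrite !funenegE.
Qed.

Lemma rk_nonincreasing a x y : a <= 1 -> 0 < x -> x <= y -> rk a y <= rk a x.
Proof.
move=> a1 x0 xy; have y0 : 0 < y by exact: lt_le_trans xy.
rewrite !rk_gt0//; have -> : a - 1 = - (1 - a) by rewrite opprB.
rewrite !powRN lef_pV2 ?posrE ?powR_gt0//.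
by apply: ler_powR_base; rewrite ?subr_ge0// ltW.
Qed.

(** Write r for the kernel. As r decreases on the positive axis, |r(x+h) - r(x)| + r(x+h) equals
    r(x) for x > 0 and 2 r(x+h) for x <= 0. All three integrals are explicit, and X^a <= (X+h)^a
    leaves 2 h^a/a. *)
Let rk_translation_pos a h X : 0 < a -> a < 1 -> 0 <= h -> 0 <= X ->
  (\int[mu]_(x in `]-oo, X[) `|rk a (x + h) - rk a x|%:E <=
   (2 * h `^ a / a)%:E)%E.
Proof.
move=> a0 a1 h0 X0.
have mr : measurable_fun setT (fun x : R => (rk a x)%:E).
  by apply/measurable_EFinP; exact: measurable_rk.
have mrh : measurable_fun setT (fun x : R => rk a (x + h)).
  by apply: (measurableT_comp (measurable_rk a)); exact: measurable_funD.
have mEh : measurable_fun setT (fun x : R => (rk a (x + h))%:E).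
  exact/measurable_EFinP.
have md : measurable_fun setT (fun x : R => `|rk a (x + h) - rk a x|%:E).
  apply/measurable_EFinP; apply: measurableT_comp => //; apply: measurable_funB => //.
  exact: measurable_rk.
have int_h Y : (0 <= Y + h)%R ->
    (\int[mu]_(x in `]-oo, Y[) (rk a (x + h))%:E = ((Y + h) `^ a / a)%:E)%E.
  move=> Yh; rewrite -integral_rk// integral_mkcond [RHS]integral_mkcond.
  rewrite -[RHS](@integral_shift _ h); last first.
    exact/(measurable_restrictT _ (measurable_itv _))/measurable_funTS.
  by apply: eq_integral => x _; rewrite !patchE !mem_setE !in_itv/= ltrD2r.
pose k x := if (x <= 0) then rk a (x + h) else 0.
have mk : measurable_fun setT (fun x => (k x)%:E).
  rewrite [X in measurable_fun _ X](_ : _ = (fun x => (rk a (x + h))%:E) \_ `]-oo, 0]%classic).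
    exact/(measurable_restrictT _ (measurable_itv _))/measurable_funTS.
  by apply/funext => x; rewrite patchE mem_setE in_itv/= /k; case: ifP.
have k0 x : 0 <= k x by rewrite /k; case: ifP => // _; exact: rk_ge0.
have int_k : (\int[mu]_(x in `]-oo, X[) (k x)%:E = (h `^ a / a)%:E)%E.
  rewrite -[X in (X `^ a)](add0r h) -int_h ?add0r// [RHS]integral_itv_bndo_bndc; last first.
    exact: measurable_funTS.
  have [->|Xn0] := eqVneq X 0.
    rewrite integral_itv_bndo_bndc; last exact: measurable_funTS.
    by apply: eq_integral => x; rewrite inE/= in_itv/= /k => ->.
  have {Xn0} X0 : 0 < X by rewrite lt_neqAle eq_sym Xn0.
  rewrite integral_mkcond [RHS]integral_mkcond; apply: eq_integral => x _.
  rewrite !patchE !mem_setE !in_itv/= /k.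
  case: (leP x 0) => [x0|_]; last by case: ifP.
  by rewrite (le_lt_trans x0 X0).
set G := (X in (X <= _)%E).
have G0 : (0 <= G)%E by apply: integral_ge0 => x _; rewrite lee_fin.
suff : (G + ((X + h) `^ a / a)%:E = (X `^ a / a)%:E + (2 * (h `^ a / a))%:E)%E.
  have Xh : X `^ a <= (X + h) `^ a by apply: ler_powR_base; rewrite ?lerDl// ltW.
  have {}Xh : X `^ a / a <= (X + h) `^ a / a by rewrite ler_pM2r ?invr_gt0.
  move: G0 Xh; rewrite -mulrA; case: G => [g| |]//= _ Xh.
  by rewrite -!EFinD lee_fin => -[?]; lra.
rewrite -int_h ?addr_ge0// -integral_rk// EFinM -int_k -ge0_integralZl//; last first.
- by move=> x _; rewrite lee_fin.
- exact: measurable_funTS.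
rewrite /G -!ge0_integralD//; [|by move=> x _; rewrite lee_fin rk_ge0|exact: measurable_funTS|by move=> x _; rewrite lee_fin mulr_ge0|by apply: measurable_funeM; exact: measurable_funTS|exact: measurable_funTS|by move=> x _; rewrite lee_fin rk_ge0|exact: measurable_funTS].
apply: eq_integral => x _; rewrite -EFinM -!EFinD; congr (_%:E); rewrite /k.
have [x0|x0] := leP x 0.
  by rewrite (rk_le0 a x0) subr0 ger0_norm ?rk_ge0// add0r mulr_natl mulr2n.
rewrite mulr0 addr0 ler0_norm; first by rewrite opprB subrK.
by rewrite subr_le0; apply: rk_nonincreasing; rewrite ?lerDl// ltW.
Qed.

Lemma rk_translation a h X : 0 < a -> a < 1 ->
  (\int[mu]_(x in `]-oo, X[) `|rk a (x + h) - rk a x|%:E <=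
   (2 * `|h| `^ a / a)%:E)%E.
Proof.
move=> a0 a1.
have md c : measurable_fun setT (fun x : R => `|rk a (x + c) - rk a x|%:E).
  apply/measurable_EFinP; apply: measurableT_comp => //; apply: measurable_funB.
    by apply: (measurableT_comp (measurable_rk a)); exact: measurable_funD.
  exact: measurable_rk.
have le_sub (Y Z : R) c : Y <= Z -> (\int[mu]_(x in `]-oo, Y[) `|rk a (x + c) - rk a x|%:E <=
   \int[mu]_(x in `]-oo, Z[) `|rk a (x + c) - rk a x|%:E)%E.
  move=> YZ; apply: ge0_subset_integral => //; first by apply: measurable_funTS; exact: md.
  by move=> x /=; rewrite !in_itv/= => /lt_le_trans; apply.
have [h0|h0] := leP 0 h.
  rewrite (ger0_norm h0).
  apply: le_trans (le_sub X (Num.max X 0) h _) _; first by rewrite le_max lexx.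
  by apply: rk_translation_pos => //; rewrite le_max lexx orbT.
(* For h < 0 the substitution x -> x + h exchanges the two terms of the difference. *)
rewrite (ltr0_norm h0); have nh0 : 0 <= - h by rewrite oppr_ge0 ltW.
apply: le_trans (rk_translation_pos (X := Num.max (X + h) 0) a0 a1 nh0 _); last first.
  by rewrite le_max lexx orbT.
apply: le_trans (le_sub (X + h) _ (- h) _); last by rewrite le_max lexx.
rewrite le_eqVlt; apply/orP; left; apply/eqP.
rewrite integral_mkcond [RHS]integral_mkcond -[RHS](@integral_shift _ h); last first.
  exact/(measurable_restrictT _ (measurable_itv _))/measurable_funTS.
apply: eq_integral => x _; rewrite !patchE !mem_setE !in_itv/= ltrD2r.
by rewrite addrK distrC.
Qed.


End translation.

(** * The Gagliardo seminorm of a fractional integral *)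

Section gagliardo_estimate.
Context {R : realType}.
Local Notation mu := (@lebesgue_measure R).
Local Notation I0 T := (`]0%R, T[%classic : set R).
Implicit Types (a b p T : R) (u v w : R -> R).

(* Where exactly one of the two integrals diverges the right-hand side is
   infinite; where both do, the junk values of [RLint] are equal. *)
Lemma RLint_diff a v T t t' : 0 < a -> t <= T -> t' <= T -> measurable_fun setT v ->
  (`|RLint a v t - RLint a v t'|%:E <= (Gamma a)^-1%:E *
   \int[mu]_(s in I0 T) (`|rk a (t - s) - rk a (t' - s)| * `|v s|)%:E)%E.
Proof.
move=> a0 tT t'T mv; have mvD : measurable_fun (I0 T) v by exact: measurable_funTS.
have mD : measurable (I0 T : set (measurableTypeR R)) by exact: measurable_itv.
rewrite (RLint_D _ tT)// (RLint_D _ t'T)// -mulrBr normrM.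
have G0 : 0 <= (Gamma a)^-1 by rewrite invr_ge0 ltW// Gamma_gt0.
rewrite (ger0_norm G0) EFinM; apply: lee_wpmul2l; first by rewrite lee_fin.
pose f x s := rk a (x - s) * v s.
have mf x : measurable_fun (I0 T) (f x) by exact: measurable_rk_mul.
have [[it it']|nii] := pselect (mu.-integrable (I0 T) (EFin \o f t) /\
    mu.-integrable (I0 T) (EFin \o f t')).
  rewrite -RintegralB//; apply: le_trans (le_Rintegral_abs _ _) _ => //.
    exact: measurable_funB (mf t) (mf t').
  rewrite le_eqVlt; apply/orP; left; apply/eqP; apply: eq_integral => s _.
  by rewrite /f -mulrBl normrM.
have [Ioo|] := eqVneq (\int[mu]_(s in I0 T)
    (`|rk a (t - s) - rk a (t' - s)| * `|v s|)%:E)%E +oo%E; first by rewrite Ioo leey.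
rewrite -ltey => Ioo.
have idiff : mu.-integrable (I0 T) (EFin \o (fun s => f t s - f t' s)).
  apply: integrable_on; first exact: measurable_funB (mf t) (mf t').
  apply: le_lt_trans Ioo; rewrite le_eqVlt; apply/orP; left; apply/eqP.
  by apply: eq_integral => s _; rewrite /f -mulrBl normrM.
have nt : ~ mu.-integrable (I0 T) (EFin \o f t).
  move=> it; apply: nii; split => //.
  have := @integrableB _ _ _ mu (I0 T) mD _ _ it idiff.
  by apply: eq_integrable => // s _; rewrite /= -EFinB subKr.
have nt' : ~ mu.-integrable (I0 T) (EFin \o f t').
  move=> it; apply: nii; split => //.
  have := @integrableD _ _ _ mu (I0 T) mD _ _ it idiff.
  by apply: eq_integrable => // s _; rewrite /= -EFinD addrC subrK.
rewrite (Rintegral_nonintegrable _ (mf t) nt)// (Rintegral_nonintegrable _ (mf t') nt')//.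
rewrite subrr normr0.
by apply: integral_ge0 => s _; rewrite lee_fin mulr_ge0.
Qed.

Lemma integral_rk_diff a T t t' : 0 < a -> a < 1 -> t <= T -> t' <= T ->
  (\int[mu]_(s in I0 T) `|rk a (t - s) - rk a (t' - s)|%:E <=
   (2 * `|t - t'| `^ a / a)%:E)%E.
Proof.
move=> a0 a1 tT t'T.
have md : measurable_fun setT (fun x : R => `|rk a (x + (t - t')) - rk a x|%:E).
  apply/measurable_EFinP; apply: measurableT_comp => //; apply: measurable_funB.
    by apply: (measurableT_comp (measurable_rk a)); exact: measurable_funD.
  exact: measurable_rk.
apply: le_trans (rk_translation (t - t') T a0 a1).
rewrite integral_mkcond [leRHS]integral_mkcond.
have mr : measurable_fun setT ((fun x : R => `|rk a (x + (t - t')) - rk a x|%:E)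
    \_ `]-oo, T[%classic).
  exact/(measurable_restrictT _ (measurable_itv _))/measurable_funTS.
rewrite -(ge0_integral_reflect t' mr); last first.
  by move=> x; apply: erestrict_ge0 => y _; rewrite lee_fin.
apply: ge0_le_integral => //.
- by move=> s _; apply: erestrict_ge0 => y _; rewrite lee_fin.
- apply/(measurable_restrictT _ (measurable_itv _))/measurable_funTS.
  apply/measurable_EFinP; apply: measurableT_comp => //; apply: measurable_funB.
    exact: measurable_rk_sub.
  exact: measurable_rk_sub.
- by apply: (measurableT_comp mr); exact: measurable_funB.
- move=> s _; rewrite !patchE !mem_setE !in_itv/=; case: ifPn => [/andP[s0 sT]|_]; last first.
    by case: ifP => // _; rewrite lee_fin.
  rewrite (lt_le_trans _ t'T) ?gtrDl ?oppr_lt0//.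
  by have -> : t' - s + (t - t') = t - s by ring.
Qed.

Lemma integral_powR_sym (q T : R) : 0 < q -> 0 < T ->
  (\int[mu]_(h in `](- T)%R, T[) (`|h| `^ (q - 1))%:E <= (2 * T `^ q / q)%:E)%E.
Proof.
move=> q0 T0.
have mq : measurable_fun setT (fun h : R => (h `^ (q - 1))%:E).
  by apply/measurable_EFinP; exact: measurable_powR.
have mr : measurable_fun setT ((fun h : R => (h `^ (q - 1))%:E) \_ `]0%R, T[%classic).
  exact/(measurable_restrictT _ (measurable_itv _))/measurable_funTS.
have r0 h : (0 <= ((fun h : R => (h `^ (q - 1))%:E) \_ `]0%R, T[%classic) h)%E.
  by apply: erestrict_ge0 => y _; rewrite lee_fin powR_ge0.
have E : (\int[mu]_h (((fun h : R => (h `^ (q - 1))%:E) \_ `]0%R, T[%classic) h) =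
   (T `^ q / q)%:E)%E by rewrite -integral_mkcond integral_powR_oo// ltW.
have -> : 2 * T `^ q / q = T `^ q / q + T `^ q / q by rewrite -mulrA mulr_natl mulr2n.
have mrN : measurable_fun setT (fun x : R => ((fun h : R => (h `^ (q - 1))%:E) \_ `]0%R, T[%classic) (- x)).
  exact: (measurableT_comp mr).
pose g := (fun h : R => (h `^ (q - 1))%:E) \_ `]0%R, T[%classic.
have -> : ((T `^ q / q + T `^ q / q)%:E = \int[mu]_x (g (- x)%R + g x))%E.
  by rewrite ge0_integralD// (ge0_integral_opp mr r0) EFinD -E.
rewrite /g [leLHS]integral_mkcond.  apply: (@ae_ge0_le_integral _ _ _ mu) => //.
- by move=> h _; apply: erestrict_ge0 => y _; rewrite lee_fin powR_ge0.
- apply/(measurable_restrictT _ (measurable_itv _))/measurable_funTS.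
  by apply/measurable_EFinP; apply: measurable_powR_comp; exact: normr_measurable.
- by move=> h _; rewrite adde_ge0.
- exact: emeasurable_funD.
(* The point 0 belongs to neither half of the interval, whereas for q = 1 the left-hand integrand
   there is 0^0 = 1. *)
exists [set 0]; split => //; first exact: lebesgue_measure_set1.
move=> h /= H; apply: contrapT => h0; apply: H => _.
rewrite !patchE !mem_setE !in_itv/=.
have [hp|hn|h00] := ltgtP h 0; last by have := h0 h00.
  rewrite oppr_gt0 hp/= ltr0_norm// [X in (_ + X)%E](_ : _ = 0%E)// adde0.
  by rewrite (ltrNl h); case: ifP => [/andP[-> _]//|_]; case: ifP => // _; rewrite lee_fin powR_ge0.
rewrite gtr0_norm// oppr_gt0 (lt_gtF hn)/= [X in (X + _)%E](_ : _ = 0%E)// add0e.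
by case: ifP => [/andP[_ ->]//|_]; case: ifP => // _; rewrite lee_fin powR_ge0.
Qed.

(** Schur's test for the kernel |r(x+h-s) - r(x-s)|, both masses of which are of order |h|^a. The
    domain keeps x + h below T. *)
Lemma RLint_translation a p T h v : 0 < a -> a < 1 -> 1 <= p -> 0 < T ->
  measurable_fun setT v ->
  (\int[mu]_(x in I0 T `&` `]-oo, (T - h)%R[%classic)
     (`|RLint a v (x + h) - RLint a v x| `^ p)%:E <=
   (((Gamma a)^-1 * (2 * `|h| `^ a / a)) `^ p)%:E * energy p T v)%E.
Proof.
move=> a0 a1 p1 T0 mv; set A := (X in (\int[mu]_(x in X) _)%E).
have p0 : 0 < p by exact: lt_le_trans p1.
pose G := (Gamma a)^-1; rewrite -/G.
have G0 : 0 <= G by rewrite invr_ge0 ltW// Gamma_gt0.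
pose M := 2 * `|h| `^ a / a; rewrite -/M.
have M0 : 0 <= M by rewrite divr_ge0 ?mulr_ge0 ?powR_ge0 ?(ltW a0).
have mA : measurable A by apply: measurableI; exact: measurable_itv.
have mav : measurable_fun setT (fun s => `|v s|) by exact: measurableT_comp.
pose k x s := `|rk a (x + h - s) - rk a (x - s)|.
have mk : measurable_fun [set: R * R] (fun z => k z.1 z.2).
  apply: measurableT_comp => //; apply: measurable_funB; last exact: measurable_rkB.
  apply: (measurableT_comp (measurable_rk a)).
  apply: (measurable_funB _ measurable_snd).
  exact: (measurable_funD measurable_fst (measurable_cst _)).
have k0 x s : 0 <= k x s by exact: normr_ge0.
have mkv : measurable_fun setT (fun x => \int[mu]_(s in I0 T) (k x s * `|v s|)%:E)%E.
  apply: (@measurable_tonelli_on _ _ (fun x s => (k x s * `|v s|)%:E)) => //.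
    apply/measurable_EFinP; apply: measurable_funM => //.
    exact: (measurableT_comp mav measurable_snd).
  by move=> x s; rewrite lee_fin mulr_ge0.
have kv0 x : (0 <= \int[mu]_(s in I0 T) (k x s * `|v s|)%:E)%E.
  by apply: integral_ge0 => s _; rewrite lee_fin mulr_ge0.
apply: (@le_trans _ _ (\int[mu]_(x in A) ((G `^ p)%:E *
   (\int[mu]_(s in I0 T) (k x s * `|v s|)%:E) `^ p))%E).
  apply: ge0_le_integral => //.
  - apply: measurable_funTS; apply/measurable_EFinP; apply: measurable_powR_comp.
    apply: measurableT_comp => //; apply: measurable_funB; last exact: measurable_RLint.
    apply: (measurableT_comp (measurable_RLint a mv)); exact: measurable_funD.
  - apply: measurable_funTS; apply: measurable_funeM.
    exact: (measurableT_comp (measurable_poweR p)).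
  - move=> x [] /=; rewrite !in_itv/= => /andP[x0 xT] xh.
    rewrite -poweR_EFin -[X in (X * _)%E]poweR_EFin -poweRM// ?lee_fin//.
    apply: poweR_le; [exact: ltW|by rewrite lee_fin|].
    by apply: RLint_diff => //; rewrite -?lerBrDr ltW.
rewrite ge0_integralZl//; last 3 first.
- apply: measurable_funTS; exact: (measurableT_comp (measurable_poweR p)).
- by move=> x _; exact: poweR_ge0.
- by rewrite lee_fin powR_ge0.
rewrite (powRM _ G0 M0) EFinM -muleA; apply: lee_wpmul2l; first by rewrite lee_fin powR_ge0.
rewrite -(mulr_powRB1 M0 p0) (mulrC M).
apply: schur_test => //.
  move=> x [] /=; rewrite !in_itv/= => /andP[x0 xT] xh.
  apply: le_trans (integral_rk_diff a0 a1 _ _) _; [by rewrite -lerBrDr ltW|exact: ltW|].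
  by rewrite addrAC subrr add0r.
move=> s; rewrite /= in_itv/= => /andP[s0 sT].
apply: le_trans (rk_translation h T a0 a1).
have md : measurable_fun setT (fun x : R => `|rk a (x + h) - rk a x|%:E).
  apply/measurable_EFinP; apply: measurableT_comp => //; apply: measurable_funB.
    by apply: (measurableT_comp (measurable_rk a)); exact: measurable_funD.
  exact: measurable_rk.
rewrite integral_mkcond [leRHS]integral_mkcond.
have mr : measurable_fun setT ((fun x : R => `|rk a (x + h) - rk a x|%:E)
    \_ `]-oo, T[%classic).
  exact/(measurable_restrictT _ (measurable_itv _))/measurable_funTS.
rewrite -(ge0_integral_shift (- s) mr); last first.
  by move=> x; apply: erestrict_ge0 => y _; rewrite lee_fin.
apply: ge0_le_integral => //.
- by move=> x _; apply: erestrict_ge0 => y _; rewrite lee_fin.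
- apply/(measurable_restrictT _ mA)/measurable_funTS.
  apply/measurable_EFinP; exact: (measurableT_comp mk (pair2_measurable s)).
- by apply: (measurableT_comp mr); exact: measurable_funD.
- move=> x _; rewrite !patchE; case: ifPn => [|_]; last first.
    by case: ifP => // _; rewrite lee_fin.
  rewrite inE /A /= !in_itv/= => -[/andP[x0 xT] xh].
  rewrite mem_setE in_itv/= (lt_trans _ xT) ?gtrDl ?oppr_lt0//.
  by rewrite /k addrAC.
Qed.

Lemma measurable_gagliardo theta p w : measurable_fun setT w ->
  measurable_fun [set: R * R]
    (fun z => (`|w z.2 - w z.1| `^ p / `|z.2 - z.1| `^ (1 + theta * p))%:E).
Proof.
move=> mw; apply/measurable_EFinP.
rewrite [X in measurable_fun _ X](_ : _ = fun z => `|w z.2 - w z.1| `^ p * `|z.2 - z.1| `^ (- (1 + theta * p))).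
  apply: measurable_funM; apply: measurable_powR_comp; apply: measurableT_comp => //.
    exact: (measurable_funB (measurableT_comp mw measurable_snd) (measurableT_comp mw measurable_fst)).
  exact: (measurable_funB measurable_snd measurable_fst).
by apply/funext => z; rewrite powRN.
Qed.

(** After the substitution t = x + h and Tonelli, the integral in x is bounded by |h|^(ap), and
    theta < a makes the remaining power of |h| integrable at 0. *)
Lemma gagliardo_RLint_lt1 a theta p T : 0 < theta -> theta < a -> a < 1 ->
  1 <= p -> 0 < T -> exists2 C : R, 0 <= C & forall v, measurable_fun setT v ->
  (gagliardo theta p T (RLint a v) <= C%:E * energy p T v)%E.
Proof.
move=> th0 tha a1 p1 T0.
have a0 : 0 < a by exact: lt_trans tha.
have p0 : 0 < p by exact: lt_le_trans p1.
pose G := (Gamma a)^-1.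
have G0 : 0 <= G by rewrite invr_ge0 ltW// Gamma_gt0.
(* The translation estimate contributes |h|^(ap) and the denominator |h|^(-1 - theta p), so
   |h|^(q-1) remains. *)
pose q := (a - theta) * p.
have q0 : 0 < q by rewrite mulr_gt0// subr_gt0.
pose c := (G * (2 / a)) `^ p.
have c0 : 0 <= c by exact: powR_ge0.
pose r := - (1 + theta * p).
exists (c * (2 * T `^ q / q)).
  by rewrite mulr_ge0// divr_ge0 ?(ltW q0)// mulr_ge0 ?powR_ge0.
move=> v mv; pose f := RLint a v.
have mf : measurable_fun setT f by exact: measurable_RLint.
(* The indicator keeps x + h in (0,T), so that h may range over an interval independent of x. *)
pose K x h := \1_(I0 T) (h + x) * (`|f (h + x) - f x| `^ p * `|h| `^ r) : R.
have K0 x h : 0 <= K x h by rewrite !mulr_ge0 ?powR_ge0.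
have mK : measurable_fun [set: R * R] (fun z => K z.1 z.2).
  have mhx : measurable_fun [set: R * R] (fun z => z.2 + z.1).
    exact: (measurable_funD measurable_snd measurable_fst).
  apply: measurable_funM.
    apply: (measurableT_comp _ mhx); exact: measurable_indic.
  apply: measurable_funM; apply: measurable_powR_comp; apply: measurableT_comp => //.
    apply: measurable_funB; first exact: (measurableT_comp mf mhx).
    exact: (measurableT_comp mf measurable_fst).
have -> : gagliardo theta p T (RLint a v) =
   (\int[mu]_(x in I0 T) \int[mu]_(h in `](- T)%R, T[) (K x h)%:E)%E.
  rewrite /gagliardo; apply: eq_integral => x; rewrite inE/= in_itv/= => /andP[x0 xT].
  have mg : measurable_fun setT (fun t => (`|f t - f x| `^ p / `|t - x| `^ (1 + theta * p))%:E).
    exact: (measurableT_comp (measurable_gagliardo theta p mf) (pair1_measurable x)).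
  rewrite integral_mkcond -(@integral_shift _ _ x); last first.
    exact/(measurable_restrictT _ (measurable_itv _))/measurable_funTS.
  rewrite [RHS]integral_mkcond; apply: eq_integral => h _.
  have Ehx : (h + x \in I0 T) = (0 < h + x < T) by rewrite mem_setE in_itv.
  rewrite !patchE /K indicE Ehx.
  case: ifPn => [/andP[hx0 hxT]|_]; last by rewrite mul0r; case: ifP.
  have -> : h \in (`]- T, T[%classic : set R).
    rewrite mem_setE in_itv/=; apply/andP; split; lra.
  by rewrite mul1r /r powRN addrK.
rewrite (@tonelli_on _ _ _ (fun x h => (K x h)%:E))//; last first.
  exact/measurable_EFinP.
have mh : measurable_fun setT (fun h : R => (`|h| `^ (q - 1))%:E).
  by apply/measurable_EFinP; apply: measurable_powR_comp; exact: normr_measurable.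
have h0 (h : R) : (0 <= (`|h| `^ (q - 1))%:E)%E by rewrite lee_fin powR_ge0.
apply: (@le_trans _ _ (\int[mu]_(h in `](- T)%R, T[) (c%:E * energy p T v * (`|h| `^ (q - 1))%:E))%E); last first.
  rewrite ge0_integralZl//; last 2 first.
  - exact: measurable_funTS.
  - by rewrite mule_ge0 ?energy_ge0// lee_fin.
  rewrite muleAC EFinM; apply: lee_wpmul2r; first exact: energy_ge0.
  by apply: lee_wpmul2l; [rewrite lee_fin|exact: integral_powR_sym].
have mTh (h : R) : measurable (I0 T `&` `]-oo, (T - h)%R[%classic).
  by apply: measurableI; exact: measurable_itv.
apply: ae_ge0_le_integral => //.
- by move=> h _; apply: integral_ge0 => x _; rewrite lee_fin.
- apply: measurable_funTS.
  apply: (@measurable_tonelli_on _ _ (fun h x => (K x h)%:E)) => //.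
    apply/measurable_EFinP; exact: (measurableT_comp mK (@measurable_swap _ _ R R)).
  by move=> h x; rewrite lee_fin.
- by move=> h _; rewrite !mule_ge0 ?energy_ge0// lee_fin.
- by apply: measurable_funTS; exact: measurable_funeM.
exists [set 0]; split => //; first exact: lebesgue_measure_set1.
move=> h /= H; apply: contrapT => /eqP hn0; apply: H => _.
have ah0 : 0 < `|h| by rewrite normr_gt0.
have mfsh : measurable_fun setT (fun x : R => f (x + h)).
  by apply: (measurableT_comp mf); exact: measurable_funD.
have mfh : measurable_fun setT (fun x : R => (`|f (x + h) - f x| `^ p)%:E).
  apply/measurable_EFinP; apply: measurable_powR_comp; apply: measurableT_comp => //.
  exact: (measurable_funB mfsh mf).
apply: (@le_trans _ _ ((`|h| `^ r)%:E * \int[mu]_(x in I0 T `&` `]-oo, (T - h)%R[%classic)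
     (`|f (x + h) - f x| `^ p)%:E)%E).
  rewrite -ge0_integralZl//; [|exact: mTh|exact: measurable_funTS].
  rewrite [leLHS]integral_mkcond [leRHS]integral_mkcond; apply: ge0_le_integral => //.
  - by move=> x _; apply: erestrict_ge0 => y _; rewrite lee_fin.
  - apply/(measurable_restrictT _ (measurable_itv _))/measurable_funTS/measurable_EFinP.
    exact: (measurableT_comp mK (pair2_measurable h)).
  - by apply/(measurable_restrictT _ (mTh h))/measurable_funTS; exact: measurable_funeM.
  - move=> x _; rewrite !patchE in_setI; case: ifPn => //= xT; last first.
    rewrite /K indicE !mem_setE !in_itv/= addrC ltrBrDr.
    case: (ltP (x + h) T) => xhT; last by rewrite andbF mul0r.
    rewrite -EFinM lee_fin mulrC (mulrC (`|h| `^ r)).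
    by case: (0 < x + h); rewrite ?mulr1// mulr0 mulr_ge0 ?powR_ge0.
apply: (@le_trans _ _ ((`|h| `^ r)%:E * ((((Gamma a)^-1 * (2 * `|h| `^ a / a)) `^ p)%:E * energy p T v))%E).
  by apply: lee_wpmul2l; [rewrite lee_fin powR_ge0|exact: RLint_translation].
rewrite muleA -EFinM [leRHS]muleAC -EFinM le_eqVlt; apply/orP; left; apply/eqP.
congr (_%:E * _)%E; rewrite -/G.
have -> : G * (2 * `|h| `^ a / a) = G * (2 / a) * `|h| `^ a by ring.
rewrite powRM ?mulr_ge0 ?powR_ge0 ?invr_ge0 ?(ltW a0) ?(ltW (Gamma_gt0 a0))//.
rewrite -/c mulrCA -powRrM -powRD; last by rewrite (gt_eqF ah0) implybT.
by congr (_ * _ `^ _); rewrite /r /q; ring.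
Qed.

Lemma ae_gagliardo theta p T u v :
  measurable_fun (I0 T) u -> measurable_fun (I0 T) v -> eq_ae0T T u v ->
  gagliardo theta p T u = gagliardo theta p T v.
Proof.
move=> mu0 mv uv.
pose u' := u \_ (I0 T); pose v' := v \_ (I0 T).
have mu' : measurable_fun setT u' by exact/(measurable_restrictT _ (measurable_itv _)).
have mv' : measurable_fun setT v' by exact/(measurable_restrictT _ (measurable_itv _)).
have E w : gagliardo theta p T w = gagliardo theta p T (w \_ (I0 T)).
  apply: eq_integral => x xT; apply: eq_integral => t tT.
  by rewrite !patchE xT tT.
have uv' : eq_ae0T T u' v'.
  apply: (ae_imply (mu := (@lebesgue_measure R)) (D := I0 T) uv) => x Dx uvx.
  by rewrite /u' /v' !patchE mem_set.
rewrite (E u) (E v) /gagliardo -/u' -/v'; apply: ge0_ae_eq_integral => //.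
- apply: measurable_funTS; apply: (@measurable_tonelli_on _ _
    (fun x t => (`|u' t - u' x| `^ p / `|t - x| `^ (1 + theta * p))%:E)) => //; exact: measurable_gagliardo.
- apply: measurable_funTS; apply: (@measurable_tonelli_on _ _
    (fun x t => (`|v' t - v' x| `^ p / `|t - x| `^ (1 + theta * p))%:E)) => //; exact: measurable_gagliardo.
- by move=> x _; apply: integral_ge0 => t _; rewrite lee_fin divr_ge0// powR_ge0.
- by move=> x _; apply: integral_ge0 => t _; rewrite lee_fin divr_ge0// powR_ge0.
apply: (ae_imply (mu := (@lebesgue_measure R)) (D := I0 T) uv') => x Dx uvx.
apply: ge0_ae_eq_integral => //.
- apply: measurable_funTS; exact: (measurableT_comp (measurable_gagliardo theta p mu') (pair1_measurable x)).
- apply: measurable_funTS; exact: (measurableT_comp (measurable_gagliardo theta p mv') (pair1_measurable x)).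
apply: (ae_imply (mu := (@lebesgue_measure R)) (D := I0 T) uv') => t Dt uvt.
by rewrite uvx uvt.
Qed.

Lemma gagliardo_RLint a theta p T : 0 < theta -> theta < 1 -> theta < a ->
  1 <= p -> 0 < T -> exists2 C : R, 0 <= C & forall v, mLp p T v ->
  (gagliardo theta p T (RLint a v) <= C%:E * energy p T v)%E.
Proof.
move=> th0 th1 tha p1 T0.
have [a1|a1] := ltP a 1.
  have [C C0 HC] := gagliardo_RLint_lt1 th0 tha a1 p1 T0.
  by exists C => // v [mv _]; exact: HC.
(* Any b strictly between theta and 1 would do: J^a = J^b J^(a-b), where J^b gives the seminorm
   bound and J^(a-b) is bounded on L^p. *)
pose b := (theta + 1) / 2.
have thb : theta < b by rewrite /b; lra.
have b1 : b < 1 by rewrite /b; lra.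
have b0 : 0 < b by exact: lt_trans thb.
have ab0 : 0 < a - b by rewrite subr_gt0 (lt_le_trans b1).
have [C C0 HC] := gagliardo_RLint_lt1 th0 thb b1 p1 T0.
exists (C * RLnorm (a - b) T `^ p); first by rewrite mulr_ge0// powR_ge0.
move=> v Lv; have [mv ev] := Lv; have L1 := mLp1 p1 T0 Lv.
rewrite (@ae_gagliardo _ _ _ _ (RLint b (RLint (a - b) v))); last first.
- have := RLint_semigroup b0 ab0 T0 L1; rewrite (addrC b) subrK => H.
  by apply: (ae_imply (mu := (@lebesgue_measure R)) (D := I0 T) H) => x _ ->.
- by apply: measurable_funTS; do 2 apply: measurable_RLint.
- by apply: measurable_funTS; exact: measurable_RLint.
apply: le_trans (HC _ (measurable_RLint _ mv)) _.
rewrite EFinM -muleA; apply: lee_wpmul2l; first by rewrite lee_fin.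
exact: energy_RLint.
Qed.

End gagliardo_estimate.

(** * Approximation of J^c by J^1 of bounded functions *)

Section truncation.
Context {R : realType}.
Local Notation mu := (@lebesgue_measure R).
Local Notation I0 T := (`]0%R, T[%classic : set R).
Implicit Types (p T : R) (u v w : R -> R).

Lemma RLint1E v t : RLint 1 v t = Rintegral mu (I0 t) v.
Proof.
rewrite /RLint Gamma1 invr1 mul1r; apply: eq_Rintegral => s _.
by rewrite subrr powRr0 mul1r.
Qed.

Variables (c d : R).
Hypotheses (c0 : 0 < c) (c1 : c < 1) (d0 : 0 < d).

(* [trunc] is the kernel [rk c] made Lipschitz near 0, and [trunc'] its
   derivative. *)
Let K := d `^ (c - 2).
Let trunc' x : R := if x <= 0 then 0 else if x < d then K else (c - 1) * x `^ (c - 2).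
Let trunc x : R := if x <= 0 then 0 else if x < d then K * x else x `^ (c - 1).

Let K0 : 0 <= K.
Proof. exact: powR_ge0.
Qed.

(** The slope [K] is the one for which the linear piece meets x^(c-1) at d. *)
Let powR_d : K * d = d `^ (c - 1).
Proof.
rewrite /K -{2}(powRr1 (ltW d0)) -powRD; last by rewrite (gt_eqF d0) implybT.
by congr (_ `^ _); ring.
Qed.

Let measurable_step (f g : R -> R) (e : R) : measurable_fun setT f ->
  measurable_fun setT g -> measurable_fun setT (fun x : R => if x <= e then f x else g x).
Proof.
by move=> mf mg; apply: measurable_fun_ifT => //; exact: measurable_fun_ler.
Qed.

Let measurable_step' (f g : R -> R) (e : R) : measurable_fun setT f ->
  measurable_fun setT g -> measurable_fun setT (fun x : R => if x < e then f x else g x).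
Proof.
by move=> mf mg; apply: measurable_fun_ifT => //; exact: measurable_fun_ltr.
Qed.

Let measurable_trunc' : measurable_fun setT trunc'.
Proof.
apply: measurable_step => //; apply: measurable_step' => //.
by apply: measurable_funM => //; exact: measurable_powR.
Qed.

Let measurable_trunc : measurable_fun setT trunc.
Proof.
apply: measurable_step => //; apply: measurable_step'; last exact: measurable_powR.
exact: measurable_funM.
Qed.

Let trunc'_le x : `|trunc' x| <= K.
Proof.
rewrite /trunc'; case: (leP x 0) => [_|x0]; first by rewrite normr0.
case: (ltP x d) => [_|dx]; first by rewrite ger0_norm.
rewrite normrM (ger0_norm (powR_ge0 _ _)) ltr0_norm ?subr_lt0// opprB.
apply: (@le_trans _ _ (1 * x `^ (c - 2))).
  by rewrite ler_wpM2r ?powR_ge0// gerBl ltW.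
rewrite mul1r /K; have -> : c - 2 = - (2 - c) by rewrite opprB.
rewrite !powRN lef_pV2 ?posrE ?powR_gt0//; apply: ler_powR_base => //; last exact: ltW.
by rewrite subr_ge0 (le_trans (ltW c1))// ler1n.
Qed.

Let integrable_trunc' (a b : R) : mu.-integrable (`[a, b]%classic : set R) (EFin \o trunc').
Proof.
apply: (@measurable_bounded_integrable _ _ _ mu).
- exact: measurable_itv.
- by rewrite /= lebesgue_measure_itv/=; case: ifP => // _; rewrite -EFinB ltry.
- exact: measurable_funTS.
exists K; split; first exact: num_real.
by move=> x Kx y _; apply: (le_trans (trunc'_le y)); exact: ltW.
Qed.

(** Absolute continuity of the truncated kernel: by Fubini, convolution with it becomes J^1 of the
    convolution with its bounded derivative. *)
Let truncE x : Rintegral mu (I0 x) trunc' = trunc x.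
Proof.
rewrite /trunc; have [x0|x0] := leP x 0.
  by rewrite set_itv_ge ?Rintegral_set0// bnd_simp -leNgt.
have small y : 0 < y -> y <= d -> Rintegral mu (I0 y) trunc' = K * y.
  move=> y0 yd; rewrite (@eq_Rintegral _ _ _ mu (I0 y) (cst K)).
    rewrite Rintegral_cst//= lebesgue_measure_itv/= lte_fin y0 /=.
    by rewrite oppr0 addr0.
  move=> s; rewrite inE/= in_itv/= => /andP[s0 sy].
  by rewrite /trunc' leNgt s0/= (lt_le_trans sy yd).
have [xd|dx] := ltP x d; first by apply: small => //; exact: ltW.
have isub (A : set R) : measurable A -> A `<=` `[0, x]%classic ->
    mu.-integrable A (EFin \o trunc').
  by move=> mA Ax; apply: integrableS (integrable_trunc' 0 x).
have -> : I0 x = I0 d `|` `[d, x[%classic.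
  rewrite (@itv_bndbnd_setU _ _ (BRight 0) (BLeft d))// bnd_simp //.
rewrite Rintegral_setU//=; last 2 first.
- rewrite -itv_bndbnd_setU ?bnd_simp//; apply: isub => // y /=.
  by rewrite !in_itv/= => /andP[/ltW -> /ltW ->].
- apply/disj_set2P; rewrite -subset0 => y/=; rewrite !in_itv/= => -[/andP[_ yd] /andP[dy _]].
  by move: (lt_le_trans yd dy); rewrite ltxx.
rewrite small// powR_d.
have -> : Rintegral mu (`[d, x[%classic : set R) trunc' =
    Rintegral mu (`[d, x[%classic : set R) (fun y => (c - 1) * y `^ (c - 2)).
  apply: eq_Rintegral => y; rewrite inE/= in_itv/= => /andP[dy _].
  by rewrite /trunc' leNgt (lt_le_trans d0 dy)/= ltNge dy.
have mp : measurable_fun setT (fun y : R => y `^ (c - 2)) by exact: measurable_powR.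
rewrite RintegralZl_measurable//; last exact: measurable_funTS.
rewrite /Rintegral integral_itv_bndo_bndc; last first.
  by apply: measurable_funTS; exact/measurable_EFinP.
have cn0 : c - 1 != 0 by rewrite lt_eqF// subr_lt0.
have -> : c - 2 = c - 1 - 1 by ring.
by rewrite integral_powR_cc//= mulrC divfK// addrC subrK.
Qed.

Let trunc_le x : trunc x <= rk c x.
Proof.
rewrite /trunc /rk ltNge; case: (leP x 0) => //= x0; case: (ltP x d) => // xd.
have -> : c - 1 = c - 2 + 1 by ring.
rewrite powRD; last by rewrite (gt_eqF x0) implybT.
rewrite (powRr1 (ltW x0)) ler_wpM2r ?(ltW x0)// /K.
have -> : c - 2 = - (2 - c) by rewrite opprB.
rewrite !powRN lef_pV2 ?posrE ?powR_gt0//; apply: ler_powR_base => //; try exact: ltW.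
by rewrite subr_ge0 (le_trans (ltW c1))// ler1n.
Qed.

Let trunc_ge0 x : 0 <= trunc x.
Proof.
rewrite /trunc; case: (leP x 0) => // x0; case: (ltP x d) => // _; first by rewrite mulr_ge0// ltW.
exact: powR_ge0.
Qed.

Let rem x := rk c x - trunc x.

Let rem_ge0 x : 0 <= rem x.
Proof. by rewrite subr_ge0.
Qed.

Let rem_le x : rem x <= if x < d then rk c x else 0.
Proof.
rewrite /rem; case: (ltP x d) => [_|dx]; first by rewrite gerBl.
by rewrite /trunc (leNgt x 0) (lt_le_trans d0 dx)/= (ltNge x d) dx/= rk_gt0 ?subrr// (lt_le_trans d0 dx).
Qed.

Let measurable_rem : measurable_fun setT rem.
Proof. by apply: measurable_funB => //; exact: measurable_rk. Qed.

(** The discarded part lives on (0,d) below the kernel itself; its mass tends to 0 with d and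
    controls the error of the approximation. *)
Let integral_rem : (\int[mu]_x (rem x)%:E <= (d `^ c / c)%:E)%E.
Proof.
rewrite -(integral_rk c0 (ltW d0)) [leRHS]integral_mkcond; apply: ge0_le_integral => //.
- by move=> x _; rewrite lee_fin.
- exact/measurable_EFinP.
- apply/(measurable_restrictT _ (measurable_itv _))/measurable_funTS.
  by apply/measurable_EFinP; exact: measurable_rk.
- move=> x _; rewrite patchE mem_setE in_itv/=.
  by case: (ltP x d) (rem_le x) => _ H; rewrite lee_fin.
Qed.

Let sub_integral (A : set R) (f : R -> R) : measurable A ->
  measurable_fun setT f -> (forall x, 0 <= f x) ->
  (\int[mu]_(x in A) (f x)%:E <= \int[mu]_x (f x)%:E)%E.
Proof.
move=> mA mf f0; apply: ge0_subset_integral => //; last by move=> x _; rewrite lee_fin.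
exact/measurable_EFinP.
Qed.

Let measurable_sub (f : R -> R) (t : R) : measurable_fun setT f ->
  measurable_fun setT (fun s : R => f (t - s)).
Proof. by move=> mf; apply: (measurableT_comp mf); exact: measurable_funB. Qed.

Let measurable_subl (f : R -> R) (s : R) : measurable_fun setT f ->
  measurable_fun setT (fun t : R => f (t - s)).
Proof. by move=> mf; apply: (measurableT_comp mf); exact: measurable_funB. Qed.

Let measurable_sub2 (f : R -> R) : measurable_fun setT f ->
  measurable_fun [set: R * R] (fun z => f (z.1 - z.2)).
Proof.
move=> mf; apply: (measurableT_comp mf).
exact: (measurable_funB measurable_fst measurable_snd).
Qed.

Let rem_right (T t : R) : (\int[mu]_(s in I0 T) (rem (t - s))%:E <= (d `^ c / c)%:E)%E.
Proof.
apply: le_trans integral_rem.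
have mE : measurable_fun setT (fun x => (rem x)%:E) by exact/measurable_EFinP.
rewrite -(ge0_integral_reflect t mE); last by move=> x; rewrite lee_fin.
by apply: (@sub_integral _ (fun s => rem (t - s))) => //; exact: measurable_sub.
Qed.

Let rem_left (T s : R) : (\int[mu]_(t in I0 T) (rem (t - s))%:E <= (d `^ c / c)%:E)%E.
Proof.
apply: le_trans integral_rem.
have mE : measurable_fun setT (fun x => (rem x)%:E) by exact/measurable_EFinP.
rewrite -(ge0_integral_shift (- s) mE); last by move=> x; rewrite lee_fin.
by apply: (@sub_integral _ (fun t => rem (t - s))) => //; exact: measurable_subl.
Qed.

(** The bounded function whose J^1 approximates J^c v. *)
Let reg T v t := (Gamma c)^-1 * Rintegral mu (I0 T) (fun s => trunc' (t - s) * v s).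

Let measurable_reg T v : measurable_fun setT v -> measurable_fun setT (reg T v).
Proof.
move=> mv; apply: measurable_funM => //.
apply: (@measurable_int_on _ _ (fun t s => trunc' (t - s) * v s)) => //.
apply: measurable_funM; first exact: measurable_sub2.
exact: (measurableT_comp mv measurable_snd).
Qed.

Let G0 : 0 <= (Gamma c)^-1.
Proof. by rewrite invr_ge0 ltW// Gamma_gt0.
Qed.

Let reg_le T v t : measurable_fun setT v ->
  (`|reg T v t|%:E <= ((Gamma c)^-1 * K)%:E * \int[mu]_(s in I0 T) `|v s|%:E)%E.
Proof.
move=> mv; rewrite normrM (ger0_norm G0) EFinM EFinM -muleA.
apply: lee_wpmul2l; first by rewrite lee_fin.
have mtv : measurable_fun setT (fun s : R => trunc' (t - s) * v s).
  by apply: measurable_funM => //; exact: measurable_sub.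
apply: le_trans (le_Rintegral_abs _ _) _ => //; first exact: measurable_funTS.
have mv' : measurable_fun setT (fun s => `|v s|%:E).
  by apply/measurable_EFinP; exact: measurableT_comp.
rewrite -ge0_integralZl//; last exact: measurable_funTS.
apply: ge0_le_integral => //.
- by apply: measurable_funTS; apply/measurable_EFinP; exact: measurableT_comp.
- by apply: measurable_funeM; exact: measurable_funTS.
- by move=> s _; rewrite -EFinM lee_fin normrM ler_wpM2r.
Qed.

Let integral_trunc'_shift (s t : R) : 0 < s ->
  Rintegral mu (I0 t) (fun x => trunc' (x - s)) = trunc (t - s).
Proof.
move=> s0; rewrite -truncE; apply: (congr1 fine).
rewrite [RHS]integral_mkcond -(@integral_shift _ _ (- s)); last first.
  apply/(measurable_restrictT _ (measurable_itv _))/measurable_funTS.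
  exact/measurable_EFinP.
rewrite integral_mkcond; apply: eq_integral => x _.
rewrite !patchE !mem_setE !in_itv/= ltrD2r /trunc'.
have [xs|] := leP (x - s) 0; first by case: ifP.
by rewrite subr_gt0 => sx; rewrite (lt_trans s0 sx).
Qed.

Let RLint1_reg T v t : 0 <= t -> t <= T -> mLp 1 T v ->
  RLint 1 (reg T v) t =
  (Gamma c)^-1 * Rintegral mu (I0 T) (fun s => trunc (t - s) * v s).
Proof.
move=> t0 tT [mv ev]; rewrite RLint1E.
pose f x s := trunc' (x - s) * v s.
have mf : measurable_fun [set: R * R] (fun z => f z.1 z.2).
  apply: measurable_funM; first exact: measurable_sub2.
  exact: (measurableT_comp mv measurable_snd).
rewrite /reg RintegralZl_measurable//; last first.
  by apply: measurable_funTS; exact: (@measurable_int_on _ _ f).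
congr (_ * _); have mv' : measurable_fun setT (fun s => `|v s|%:E).
  by apply/measurable_EFinP; exact: measurableT_comp.
have v1 : (\int[mu]_(s in I0 T) `|v s|%:E < +oo)%E.
  by move: ev; rewrite /energy; under eq_integral do rewrite powRr1//.
rewrite (@fubini_on _ (I0 t) (I0 T) f)//; last first.
  apply: (@le_lt_trans _ _ (\int[mu]_(x in I0 t) (cst (K%:E * \int[mu]_(s in I0 T) `|v s|%:E)) x)%E).
    apply: ge0_le_integral => //.
    - by move=> x _; apply: integral_ge0.
    - apply: measurable_funTS; apply: (@measurable_tonelli_on _ _ (fun x s => `|f x s|%:E)) => //.
      by apply/measurable_EFinP; exact: measurableT_comp.
    - move=> x _ /=; rewrite -ge0_integralZl//; last exact: measurable_funTS.
      apply: ge0_le_integral => //.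
      + apply: measurable_funTS; apply/measurable_EFinP; apply: measurableT_comp => //.
        exact: (measurableT_comp mf (pair1_measurable x)).
      + by apply: measurable_funeM; exact: measurable_funTS.
      + by move=> s _; rewrite -EFinM lee_fin normrM ler_wpM2r.
  rewrite integral_cst//= lebesgue_measure_itv/= lte_fin; case: ifP => _; last by rewrite mule0.
  rewrite oppr0 adde0 lte_mul_pinfty ?ltry//.
    by rewrite mule_ge0// ?lee_fin//; apply: integral_ge0.
  by rewrite fin_numM// ge0_fin_numE//; exact: integral_ge0.
apply: eq_Rintegral => s; rewrite inE/= in_itv/= => /andP[s0 sT].
rewrite /f; under eq_Rintegral do rewrite mulrC.
rewrite RintegralZl_measurable//; last by apply: measurable_funTS; exact: measurable_subl.
by rewrite integral_trunc'_shift// mulrC.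
Qed.

(** The integral with the truncated kernel always converges. So if the one defining J^c v(t)
    diverges, the right-hand side is infinite, and the bound holds at every t. *)
Let RLint_reg_diff T v t : 0 <= t -> t <= T -> mLp 1 T v ->
  (`|RLint c v t - RLint 1 (reg T v) t|%:E <=
   (Gamma c)^-1%:E * \int[mu]_(s in I0 T) (rem (t - s) * `|v s|)%:E)%E.
Proof.
move=> t0 tT Lv; have [mv ev] := Lv; rewrite RLint1_reg//.
have mD : measurable (I0 T : set (measurableTypeR R)) by exact: measurable_itv.
rewrite (RLint_D _ tT); last exact: measurable_funTS.
rewrite -mulrBr normrM (ger0_norm G0) EFinM; apply: lee_wpmul2l; first by rewrite lee_fin.
have mtv : measurable_fun (I0 T) (fun s => trunc (t - s) * v s).
  by apply: measurable_funTS; apply: measurable_funM => //; exact: measurable_sub.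
have mkv : measurable_fun (I0 T) (fun s => rk c (t - s) * v s).
  by apply: measurable_rk_mul; exact: measurable_funTS.
have itv : mu.-integrable (I0 T) (EFin \o (fun s => trunc (t - s) * v s)).
  apply: integrable_on => //.
  have v1 : (\int[mu]_(s in I0 T) `|v s|%:E < +oo)%E.
    by move: ev; rewrite /energy; under eq_integral do rewrite powRr1//.
  have tr_le x : x <= T -> trunc x <= K * T + K * d.
    rewrite /trunc => xT; have T0 : 0 <= T by exact: le_trans tT.
    case: (leP x 0) => x0; first by rewrite addr_ge0 ?mulr_ge0// ltW.
    case: (ltP x d) => xd.
      by rewrite -[leLHS]addr0 lerD ?ler_wpM2l// mulr_ge0// ltW.
    rewrite powR_d -[leLHS]add0r lerD ?mulr_ge0//.
    have := rk_nonincreasing (ltW c1) d0 xd.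
    by rewrite !rk_gt0.
  apply: (@le_lt_trans _ _ (\int[mu]_(s in I0 T) ((K * T + K * d)%:E * `|v s|%:E))%E).
    apply: ge0_le_integral => //.
    - by apply/measurable_EFinP; exact: measurableT_comp.
    - apply: measurable_funeM; apply: measurable_funTS; apply/measurable_EFinP.
      exact: measurableT_comp.
    - move=> s; rewrite /= in_itv/= => /andP[s0 _].
      rewrite -EFinM lee_fin normrM ler_wpM2r// ger0_norm// tr_le//.
      by rewrite (le_trans _ tT)// gerBl ltW.
  rewrite ge0_integralZl//; last 2 first.
  - apply: measurable_funTS; apply/measurable_EFinP; exact: measurableT_comp.
  - by rewrite lee_fin addr_ge0// mulr_ge0// ?(ltW d0)// (le_trans t0).
  apply: lte_mul_pinfty => //.
  by rewrite lee_fin addr_ge0// mulr_ge0// ?(ltW d0)// (le_trans t0).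
have E : (\int[mu]_(s in I0 T) `|rk c (t - s) * v s - trunc (t - s) * v s|%:E =
    \int[mu]_(s in I0 T) (rem (t - s) * `|v s|)%:E)%E.
  by apply: eq_integral => s _; rewrite -mulrBl normrM (ger0_norm (rem_ge0 _)).
have mB : measurable_fun (I0 T) (fun s => rk c (t - s) * v s - trunc (t - s) * v s).
  exact: measurable_funB mkv mtv.
have [ikv|nikv] := pselect (mu.-integrable (I0 T) (EFin \o (fun s => rk c (t - s) * v s))).
  by rewrite -E -RintegralB//; exact: le_Rintegral_abs.
have [Ioo|] := eqVneq (\int[mu]_(s in I0 T) (rem (t - s) * `|v s|)%:E)%E +oo%E.
  by rewrite Ioo leey.
rewrite -ltey -E => Ioo; exfalso; apply: nikv.
have := @integrableD _ _ _ mu (I0 T) mD _ _ itv (integrable_on mB Ioo).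
by apply: eq_integrable => // s _; rewrite /= -EFinD addrC subrK.
Qed.

Let energy_reg p T v : 1 <= p -> 0 < T -> mLp p T v ->
  (energy p T (fun t => RLint c v t - RLint 1 (reg T v) t)%R <=
   ((d `^ c / c / Gamma c) `^ p)%:E * energy p T v)%E.
Proof.
move=> p1 T0 Lv; have L1 := mLp1 p1 T0 Lv; have mv := Lv.1.
have p0 : 0 < p by exact: lt_le_trans p1.
have mav : measurable_fun setT (fun s => `|v s|) by exact: measurableT_comp.
have mk : measurable_fun [set: R * R] (fun z => rem (z.1 - z.2)) by exact: measurable_sub2.
have M0 : 0 <= d `^ c / c by rewrite divr_ge0 ?powR_ge0// ltW.
have mI : measurable_fun setT (fun t : R => \int[mu]_(s in I0 T) (rem (t - s) * `|v s|)%:E)%E.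
  apply: (@measurable_tonelli_on _ _ (fun t s => (rem (t - s) * `|v s|)%:E)) => //.
    apply/measurable_EFinP; apply: measurable_funM => //.
    exact: (measurableT_comp mav measurable_snd).
  by move=> t s; rewrite lee_fin mulr_ge0.
have I_ge0 t : (0 <= \int[mu]_(s in I0 T) (rem (t - s) * `|v s|)%:E)%E.
  by apply: integral_ge0 => s _; rewrite lee_fin mulr_ge0.
apply: (@le_trans _ _ (\int[mu]_(t in I0 T) ((((Gamma c)^-1) `^ p)%:E *
   (\int[mu]_(s in I0 T) (rem (t - s) * `|v s|)%:E) `^ p))%E).
  apply: ge0_le_integral => //.
  - apply: measurable_energy; apply: measurable_funTS; apply: measurable_funB.
      exact: measurable_RLint.
    by apply: measurable_RLint; exact: measurable_reg.
  - apply: measurable_funTS; apply: measurable_funeM.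
    exact: (measurableT_comp (measurable_poweR p)).
  - move=> t; rewrite /= in_itv/= => /andP[t0 tT].
    rewrite -poweR_EFin -[X in (X * _)%E]poweR_EFin -poweRM//.
    apply: poweR_le; [exact: ltW|by rewrite lee_fin|].
    by apply: RLint_reg_diff => //; exact: ltW.
rewrite ge0_integralZl//; last 3 first.
- apply: measurable_funTS; exact: (measurableT_comp (measurable_poweR p)).
- by move=> t _; exact: poweR_ge0.
- by rewrite lee_fin powR_ge0.
rewrite (mulrC (d `^ c / c)) (powRM _ G0 M0) EFinM -muleA.
apply: lee_wpmul2l; first by rewrite lee_fin powR_ge0.
rewrite -(mulr_powRB1 M0 p0) (mulrC (d `^ c / c)).
exact: (@schur_test R p _ _ (I0 T) (I0 T) (fun t s => rem (t - s)) (fun s => `|v s|)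
  p1 (measurable_itv _) (measurable_itv _) mk mav (fun t s => rem_ge0 _)
  (fun s => normr_ge0 _) M0 M0 (fun t _ => rem_right T t) (fun s _ => rem_left T s)).
Qed.

(** [M] does not depend on v, which enters the bound of [y] only through its L^1 norm: bounded
    families have uniformly bounded [y], as compactness requires. *)
Lemma RLint_truncation T : exists2 M : R, 0 <= M & forall p v,
  1 <= p -> 0 < T -> mLp p T v -> exists y : R -> R, [/\ measurable_fun setT y,
    forall t, (`|y t|%:E <= M%:E * \int[mu]_(s in I0 T) `|v s|%:E)%E &
    (energy p T (fun t => RLint c v t - RLint 1 y t)%R <=
     ((d `^ c / c / Gamma c) `^ p)%:E * energy p T v)%E].
Proof.
exists ((Gamma c)^-1 * K); first exact: mulr_ge0.
move=> p v p1 T0 Lv; exists (reg T v); split.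
- exact: measurable_reg Lv.1.
- by move=> t; exact: reg_le Lv.1.
- exact: energy_reg.
Qed.

End truncation.

(** * Smooth bump functions *)

Section bump_functions.
Context {R : realType}.
Implicit Types (f g : R -> R) (p : {poly R}).

(** [diffn n] asks for n + 1 derivatives. The recursion takes the innermost derivative first, so
    closure under sums, products and affine substitutions follows by induction. *)
Fixpoint diffn n f : Prop :=
  (forall x, derivable f x 1) /\ (if n is n'.+1 then diffn n' (derive1 f) else True).

Lemma diffn_der n f : diffn n f -> forall x, derivable f x 1.
Proof. by case: n => [|n] []. Qed.

Lemma diffnW n f : diffn n.+1 f -> diffn n f.
Proof.
elim: n f => [|n IH] f [df d1]; first by split.
by split; [exact: df|exact: IH].
Qed.

Lemma diffn_derive1n f : (forall n, diffn n f) ->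
  forall n x, derivable (derive1n n f) x 1.
Proof.
move=> df n; elim: n f df => [|n IH] f df x; first exact: (diffn_der (df 0%N)).
by rewrite /derive1n iterSr; apply: IH => k; have [] := df k.+1.
Qed.

Lemma diffnD n f g : diffn n f -> diffn n g -> diffn n (fun x => f x + g x).
Proof.
elim: n f g => [|n IH] f g.
  by move=> [df _] [dg _]; split; [move=> x; exact: (derivableD (df x) (dg x))|].
move=> [df d1f] [dg d1g]; split; first by move=> x; exact: derivableD.
have -> : derive1 (fun x => f x + g x) = fun x => derive1 f x + derive1 g x.
  by apply/funext => x; rewrite !derive1E deriveD.
exact: IH.
Qed.

Lemma diffnM n f g : diffn n f -> diffn n g -> diffn n (fun x => f x * g x).
Proof.
elim: n f g => [|n IH] f g.
  by move=> [df _] [dg _]; split; [move=> x; exact: (derivableM (df x) (dg x))|].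
move=> Hf Hg; have [df d1f] := Hf; have [dg d1g] := Hg.
split; first by move=> x; exact: derivableM.
have -> : derive1 (fun x => f x * g x) = fun x => f x * derive1 g x + g x * derive1 f x.
  by apply/funext => x; rewrite !derive1E deriveM.
by apply: diffnD; apply: IH => //; exact: diffnW.
Qed.

Lemma diffn_cst n (c : R) : diffn n (fun _ => c).
Proof.
elim: n c => [|n IH] c; split => //.
have -> : derive1 (fun _ : R => c) = fun _ => 0.
  by apply/funext => x; exact: derive1_cst.
exact: IH.
Qed.

Lemma diffn_affine n f (c d : R) : diffn n f -> diffn n (fun x => f (c * x + d)).
Proof.
have da (x : R) : is_derive x 1 (fun x => c * x + d) c.
  have -> : (fun x : R => c * x + d) = (c \*: (id : R -> R)) \+ cst d by [].
  by apply: is_derive_eq; rewrite addr0 /GRing.scale/= mulr1.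
elim: n f => [|n IH] f.
  move=> [df _]; split; last by [].
  move=> x; apply/derivable1_diffP; apply: (@differentiable_comp _ _ _ _ (fun x => c * x + d) f).
    by apply/derivable1_diffP; have [] := da x.
  by apply/derivable1_diffP.
move=> [df d1]; have dc x : derivable (fun x => f (c * x + d)) x 1.
  apply/derivable1_diffP; apply: (@differentiable_comp _ _ _ _ (fun x => c * x + d) f).
    by apply/derivable1_diffP; have [] := da x.
  by apply/derivable1_diffP.
split => //.
have -> : derive1 (fun x => f (c * x + d)) = fun x => c * (derive1 f (c * x + d)).
  apply/funext => x; rewrite (@derive1_comp _ (fun x => c * x + d) f); [|by case: (da x)|exact: df].
  by rewrite mulrC; congr (_ * _); rewrite derive1E; have [_ ->] := da x.
by apply: diffnM; [exact: diffn_cst|exact: IH].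
Qed.

(* The functions P(1/x) exp(-1/x), extended by 0, are stable under derivation. *)
Definition flat p (x : R) : R := if 0 < x then p.[x^-1] * expR (- x^-1) else 0.

(** With y = 1/x this reads |p(1/x)| exp(-1/x) <= C x^2; the square yields differentiability at
    0. *)
Lemma horner_le_expR p : exists2 C : R, 0 <= C &
  forall y, 1 <= y -> `|p.[y]| * y ^+ 2 <= C * expR y.
Proof.
pose n := size p; pose S := \sum_(i < n) `|p`_i|.
have S0 : 0 <= S by exact: sumr_ge0.
exists (S * (n.+2)`!%:R); first by rewrite mulr_ge0.
move=> y y1; have y0 : 0 <= y by exact: le_trans y1.
have py : `|p.[y]| <= S * y ^+ n.
  rewrite horner_coef (le_trans (ler_norm_sum _ _ _))// mulr_suml ler_sum// => i _.
  rewrite normrM normrX (ger0_norm y0) ler_wpM2l// ler_weXn2l//.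
  exact/ltnW/ltn_ord.
apply: (@le_trans _ _ (S * y ^+ n.+2)).
  by rewrite -[n.+2]addn2 exprD [leRHS]mulrA ler_wpM2r// exprn_ge0.
rewrite -mulrA ler_wpM2l//.
have := @expR_ge1Dxn _ y n.+1 y0 => H.
rewrite mulrC -ler_pdivrMr ?ltr0n ?fact_gt0//; apply: le_trans H.
by rewrite lerDr.
Qed.

(** The derivative of P(1/x) exp(-1/x) is (P - P')(1/x) x^-2 exp(-1/x), again of the same form; at 0
    the difference quotient is O(h). *)
Lemma is_derive_flat p (x : R) :
  is_derive x 1 (flat p) (flat ((p - p^`()) * 'X^2) x).
Proof.
have [x0|x0|->] := ltgtP x 0.
- rewrite {2}/flat (lt_gtF x0).
  apply: (@near_eq_is_derive _ _ _ (cst 0)) => //.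
  near=> z; rewrite /flat lt_gtF//; near: z; exact: lt_nbhsl.
- rewrite {2}/flat x0.
  apply: (@near_eq_is_derive _ _ _ (fun z : R => p.[z^-1] * expR (- z^-1))) => //.
    by near=> z; rewrite /flat ifT//; near: z; exact: lt_nbhsr.
  have xn0 : x != 0 by rewrite gt_eqF.
  have dV : is_derive x 1 (fun z : R => z^-1) (- x ^- 2).
    have := @is_deriveV _ (id : R -> R) x 1 1 xn0 (is_derive_id _ _).
    by rewrite /GRing.scale/= mulr1.
  have dN : is_derive x^-1 1 (fun y : R => - y) (-1).
    exact: is_deriveN.
  have de : is_derive x^-1 1 (fun y : R => expR (- y)) (expR (- x^-1) * -1).
    exact: (is_derive1_comp (is_derive_expR _) dN).
  have dp : is_derive x^-1 1 (fun y : R => p.[y] * expR (- y))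
      (p.[x^-1] *: (expR (- x^-1) * -1) + expR (- x^-1) *: p^`().[x^-1]).
    exact: is_deriveM (is_derive_poly p x^-1) de.
  have := is_derive1_comp dp dV; rewrite /comp => H.
  apply: (is_derive_eq H); rewrite /GRing.scale/=.
  rewrite hornerM hornerXn hornerD hornerN exprVn; ring.
have [C C0 HC] := horner_le_expR p.
have f0 : flat p 0 = 0 by rewrite /flat ltxx.
rewrite [X in is_derive _ _ _ X](_ : _ = 0); last by rewrite /flat ltxx.
have H : h^-1 *: (flat p (h *: 1 + 0) - flat p 0) @[h --> 0^'] --> (0 : R).
  apply/cvgrPdist_le => e e0; near=> h.
  have hn0 : h != 0 by near: h; exact: nbhs_dnbhs_neq.
  rewrite f0 subr0 addr0 /GRing.scale/= mulr1 sub0r normrN normrM normfV.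
  have ah0 : 0 < `|h| by rewrite normr_gt0.
  rewrite ler_pdivrMl//.
  apply: (@le_trans _ _ (C * `|h| ^+ 2)); last first.
    rewrite expr2 mulrA mulrC ler_wpM2l// mulrC.
    apply: (@le_trans _ _ (`|h| * (C + 1))); first by rewrite ler_wpM2l// lerDl.
    rewrite -ler_pdivlMr ?ltr_wpDl//.
    by near: h; apply: dnbhs0_le; rewrite divr_gt0// ltr_wpDl.
  rewrite /flat; case: (ltP 0 h) => [h0|_]; last by rewrite normr0 mulr_ge0// exprn_ge0.
  have h1 : 1 <= h^-1.
    rewrite invf_ge1//; apply: (le_trans (ler_norm h)).
    by near: h; exact: dnbhs0_le.
  have := HC _ h1; rewrite normrM (ger0_norm (expR_ge0 _)) (gtr0_norm h0) expRN.
  rewrite exprVn ler_pdivrMr ?exprn_gt0// => HC'.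
  by rewrite ler_pdivrMr ?expR_gt0// mulrAC.
apply: DeriveDef; first by apply/cvg_ex; exists 0.
exact: cvg_lim H.
Unshelve. all: by end_near.
Qed.

Lemma diffn_flat n p : diffn n (flat p).
Proof.
elim: n p => [|n IH] p; split => //.
- by move=> x; have := is_derive_flat p x; case.
- by move=> x; have := is_derive_flat p x; case.
have -> : derive1 (flat p) = flat ((p - p^`()) * 'X^2).
  by apply/funext => x; rewrite derive1E; have := is_derive_flat p x; case.
exact: IH.
Qed.

(** On ]a, b[ this is exp(-1/(k(x-a))) exp(-1/(k(b-x))), and it is 0 elsewhere; as k grows it tends
    to the indicator of ]a, b[. *)
Definition bump (a b k x : R) : R :=
  flat 1 (k * x + - (k * a)) * flat 1 (- k * x + k * b).

Lemma bump_test (T a b k : R) : 0 < a -> b < T -> 0 < k ->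
  test_function T (bump a b k).
Proof.
move=> a0 bT k0; split.
  apply: diffn_derive1n => n; apply: diffnM; apply: diffn_affine; exact: diffn_flat.
exists `[a, b]%classic; split; first exact: segment_compact.
  by move=> x /=; rewrite !in_itv/= => /andP[ax xb]; rewrite (lt_le_trans a0 ax) (le_lt_trans xb bT).
move=> x /= /negP; rewrite in_itv/= negb_and -!ltNge /bump /flat => /orP[xa|bx].
  rewrite [X in X * _]ifF ?mul0r//; apply/negbTE; rewrite -leNgt -mulrBr.
  by rewrite pmulr_rle0// subr_le0 ltW.
rewrite [X in _ * X]ifF ?mulr0//; apply/negbTE; rewrite -leNgt mulNr addrC -mulrBr.
by rewrite pmulr_rle0// subr_le0 ltW.
Qed.

Lemma bump_ge0_le1 (a b k x : R) : 0 <= bump a b k x <= 1.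
Proof.
have f01 y : 0 <= flat 1 y <= 1.
  rewrite /flat; case: (ltP 0 y) => y0; last by rewrite lexx ler01.
  by rewrite hornerE mul1r expR_ge0 -[leRHS]expR0 ler_expR oppr_le0 invr_ge0 ltW.
rewrite /bump; have /andP[u0 u1] := f01 (k * x + - (k * a)).
have /andP[v0 v1] := f01 (- k * x + k * b).
by rewrite mulr_ge0//= mulr_ile1.
Qed.

Lemma bump_out (a b k x : R) : 0 < k -> ~~ (a < x < b) -> bump a b k x = 0.
Proof.
move=> k0; rewrite negb_and -!leNgt /bump /flat => /orP[xa|bx].
  rewrite [X in X * _]ifF ?mul0r//; apply/negbTE; rewrite -leNgt -mulrBr.
  by rewrite pmulr_rle0// subr_le0.
rewrite [X in _ * X]ifF ?mulr0//; apply/negbTE; rewrite -leNgt mulNr addrC -mulrBr.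
by rewrite pmulr_rle0// subr_le0.
Qed.

Lemma cvg_bump (a b x : R) : a < x -> x < b ->
  bump a b n.+1%:R x @[n --> \oo] --> (1 : R).
Proof.
move=> ax xb.
have H y : 0 < y -> flat 1 (n.+1%:R * y) @[n --> \oo] --> (1 : R).
  move=> y0; have -> : (fun n => flat 1 (n.+1%:R * y)) =
      fun n => expR (- (n.+1%:R^-1 * y^-1)).
    by apply/funext => n; rewrite /flat pmulr_rgt0// y0 hornerE mul1r invfM.
  rewrite -[X in _ --> X]expR0; apply: continuous_cvg; first exact: continuous_expR.
  rewrite -[X in _ --> X]oppr0; apply: cvgN; rewrite -[X in _ --> X](mul0r y^-1).
  by apply: cvgM; [exact: cvg_harmonic|exact: cvg_cst].
rewrite -[X in _ --> X]mulr1; apply: cvgM.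
  have := H (x - a); rewrite subr_gt0 => /(_ ax).
  by under eq_fun do rewrite mulrBr.
have := H (b - x); rewrite subr_gt0 => /(_ xb).
by under eq_fun do rewrite mulrBr addrC -mulNr.
Qed.

Lemma measurable_bump (a b k : R) : measurable_fun setT (bump a b k).
Proof.
have dbump : diffn 0 (bump a b k).
  by apply: diffnM; apply: diffn_affine; exact: diffn_flat.
apply: continuous_measurable_fun => x.
by apply: differentiable_continuous; apply/derivable1_diffP; exact: (diffn_der dbump).
Qed.

End bump_functions.

(** * Weak derivatives: uniqueness, and those of fractional integrals *)

Section weak_derivatives.
Context {R : realType}.
Local Notation mu := (@lebesgue_measure R).
Local Notation leb := (mu : {measure set (measurableTypeR R) -> \bar R}).
Local Notation I0 T := (`]0%R, T[%classic : set R).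
Implicit Types (T : R) (f g h w phi : R -> R).

Lemma integrable_itv_sub T h (a b : R) : locally_integrable (I0 T) h ->
  0 < a -> b < T -> mu.-integrable (`[a, b]%classic : set R) (EFin \o h).
Proof.
move=> [mh _ lh] a0 bT.
have sub : (`[a, b]%classic : set R) `<=` I0 T.
  by move=> x /=; rewrite !in_itv/= => /andP[ax xb]; rewrite (lt_le_trans a0 ax) (le_lt_trans xb bT).
apply: integrable_on; first exact: measurable_funS mh.
by apply: lh => //; exact: segment_compact.
Qed.

(** The bumps converge to the indicator of ]a, b[ and are bounded by 1, while |h| is integrable on
    the compact [a, b]: dominated convergence. *)
Lemma bump_vanish T h (a b : R) : locally_integrable (I0 T) h ->
  (forall phi, test_function T phi -> Rintegral mu (I0 T) (fun t => h t * phi t) = 0) ->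
  0 < a -> b < T -> Rintegral mu (`]a, b[%classic : set R) h = 0.
Proof.
move=> lh H a0 bT; have [mh _ _] := lh.
have sub : (`[a, b]%classic : set R) `<=` I0 T.
  by move=> x /=; rewrite !in_itv/= => /andP[ax xb]; rewrite (lt_le_trans a0 ax) (le_lt_trans xb bT).
have mhab : measurable_fun (`[a, b]%classic : set R) h by exact: measurable_funS mh.
pose phi n := bump a b n.+1%:R.
pose f_ n x : \bar R := (h x * phi n x)%:E.
pose fl x : \bar R := (h x * \1_(`]a, b[%classic : set R) x)%:E.
have iab := integrable_itv_sub lh a0 bT.
have [_ _ cv] : [/\ mu.-integrable `[a, b]%classic fl,
    (\int[mu]_(x in `[a, b]) `|f_ n x - fl x|)%E @[n --> \oo] --> 0%E &
    (\int[mu]_(x in `[a, b]) f_ n x)%E @[n --> \oo] --> (\int[mu]_(x in `[a, b]) fl x)%E].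
  apply: (@dominated_convergence _ _ _ mu _ _ f_ fl (fun x => `|h x|%:E)) => //.
  - move=> n; apply/measurable_EFinP; apply: measurable_funM => //.
    by apply: measurable_funTS; exact: measurable_bump.
  - by apply/measurable_EFinP; apply: measurable_funM => //; exact: measurable_indic.
  - apply: aeW => x _; apply: cvg_EFin; first by near=> n.
    apply: cvgM; first exact: cvg_cst.
    rewrite indicE mem_setE in_itv/=; have [/andP[ax xb]|nx] := boolP (a < x < b).
      exact: cvg_bump.
    have -> : (fun n => phi n x) = fun _ => 0 by apply/funext => n; exact: bump_out.
    exact: cvg_cst.
  - exact: (integrable_abse iab).
  - apply: aeW => x n _; rewrite lee_fin normrM ler_piMr//.
    by have /andP[p0 p1] := bump_ge0_le1 a b n.+1%:R x; rewrite ger0_norm.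
have f0 n : (\int[mu]_(x in `[a, b]) f_ n x = 0)%E.
  have := H (phi n) (bump_test a0 bT (ltr0Sn _ _)).
  have E : (\int[mu]_(x in `[a, b]) f_ n x = \int[mu]_(x in I0 T) (h x * phi n x)%:E)%E.
    rewrite integral_mkcond [RHS]integral_mkcond; apply: eq_integral => x _.
    rewrite !patchE !mem_setE !in_itv/=.
    case: (boolP (a <= x <= b)) => [/andP[ax xb]|nx].
      by rewrite (lt_le_trans a0 ax) (le_lt_trans xb bT).
    rewrite /phi bump_out ?mulr0; [by case: ifP|by []|].
    by apply: contra nx => /andP[/ltW -> /ltW ->].
  rewrite /Rintegral -E => /eqP; rewrite fine_eq0; first by move/eqP.
  apply: integrable_fin_num => //.
  apply: (le_integrable _ _ _ iab) => //.
    apply/measurable_EFinP; apply: measurable_funM => //.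
    by apply: measurable_funTS; exact: measurable_bump.
  move=> x _; rewrite lee_fin normrM ler_piMr//.
  by have /andP[p0 p1] := bump_ge0_le1 a b n.+1%:R x; rewrite ger0_norm.
have fl0 : (\int[mu]_(x in `[a, b]) fl x = 0)%E.
  have c0 : (\int[mu]_(x in `[a, b]) f_ n x)%E @[n --> \oo] --> (0 : \bar R)%E.
    by under eq_fun do rewrite f0; exact: cvg_cst.
  exact: (cvg_unique _ cv c0).
rewrite /Rintegral -[RHS]/(fine 0%E) -fl0; congr fine.
rewrite integral_mkcond [RHS]integral_mkcond; apply: eq_integral => x _.
rewrite !patchE /fl indicE !mem_setE !in_itv/=.
case: (boolP (a < x < b)) => [/andP[/ltW -> /ltW ->]|_]; first by rewrite mulr1.
by rewrite mulr0; case: ifP.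
Unshelve. all: by end_near. Qed.

(** The primitive of h restricted to a compact subinterval is identically 0, so h vanishes almost
    everywhere there by Lebesgue's differentiation theorem; countably many such intervals exhaust
    (0,T). *)
Lemma integral_itv0_ae T h : 0 < T -> locally_integrable (I0 T) h ->
  (forall a b : R, 0 < a -> b < T -> Rintegral mu (`]a, b[%classic : set R) h = 0) ->
  eq_ae0T T h (cst 0).
Proof.
move=> T0 lh H.
have seg (a b : R) : 0 < a -> a <= b -> b < T ->
    \forall x \ae leb, (`[a, b]%classic : set R) x -> h x = 0.
  move=> a0 ab bT; have iab := integrable_itv_sub lh a0 bT.
  pose g := h \_ (`[a, b]%classic : set R).
  have ig : mu.-integrable setT (EFin \o g).
    by rewrite /g -restrict_EFin; apply/integrable_restrict => //=; rewrite setTI.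
  have lg : locally_integrable [set: R] g.
    by apply: open_integrable_locally => //; exact: openT.
  have ig' y : mu.-integrable (`]-oo, y]%classic : set R) (EFin \o g).
    exact: integrableS ig.
  have := FTC1Ny ig' lg; rewrite /=.
  have -> : (fun x : R => Rintegral mu (`]-oo, x]%classic : set R) g) = cst 0.
    apply/funext => x.
    rewrite /Rintegral /=.
    have -> : (\int[mu]_(t in `]-oo, x]) (g t)%:E =
       \int[mu]_(t in (`[a, Num.min b x]%classic : set R)) (h t)%:E)%E.
      rewrite integral_mkcond [RHS]integral_mkcond; apply: eq_integral => t _.
      rewrite !patchE !mem_setE !in_itv/= le_min /g patchE mem_setE in_itv/=.
      by case: (t <= x); case: (a <= t); case: (t <= b).
    have mx : measurable_fun (`]a, (Num.min b x)[%classic : set R) (EFin \o h).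
      apply/measurable_EFinP; have [mh _ _] := lh; apply: measurable_funS mh => //.
      move=> t /=; rewrite !in_itv/= lt_min => /andP[at0 /andP[tb _]].
      by rewrite (lt_trans a0 at0) (lt_trans tb bT).
    have [xa|ax] := ltP x a.
      rewrite set_itv_ge ?integral_set0// bnd_simp -ltNge (le_lt_trans _ xa)//.
      by rewrite ge_min lexx orbT.
    have minT : Num.min b x < T by rewrite (le_lt_trans _ bT)// ge_min lexx.
    rewrite -integral_itv_bndo_bndc; last first.
      exact/emeasurable_fun_itv_obnd_cbndP.
    rewrite -integral_itv_obnd_cbnd//.
    exact: (H a (Num.min b x) a0 minT).
  move=> FT; apply: (@filterS _ _ (ae_filter_ringOfSetsType leb) _ _ _ FT) => x [_ +] xab.
  by rewrite derive1_cst /g patchE mem_set.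
(* The denominator starts at 2, so that the left end never exceeds the right end. *)
pose F n : set R := `[T / n.+2%:R, T - T / n.+2%:R]%classic.
have : \forall x \ae leb, forall n, F n x -> h x = 0.
  apply: ae_foralln => n; apply: seg.
  - by rewrite divr_gt0.
  - rewrite lerBrDl -mulrDl ler_pdivrMr// (_ : T + T = T * 2%:R); last by rewrite mulr_natr mulr2n.
    by rewrite ler_pM2l// ler_nat.
  - by rewrite gtrBl divr_gt0.
move=> FT; apply: (@filterS _ _ (ae_filter_ringOfSetsType leb) _ _ _ FT) => x Fx.
rewrite /= in_itv/= => /andP[x0 xT].
pose e := Num.min x (T - x).
have e0 : 0 < e by rewrite lt_min x0 subr_gt0.
pose n := Num.truncn (T / e); apply: (Fx n); rewrite /F /= in_itv/=.
have Tn : T / n.+2%:R <= e.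
  rewrite ler_pdivrMr// mulrC -ler_pdivrMr// ltW//.
  by rewrite (lt_trans (truncnS_gt _))// ltr_nat.
have ex : e <= x by rewrite ge_min lexx.
have eTx : e <= T - x by rewrite ge_min lexx orbT.
apply/andP; split; first exact: le_trans ex.
by rewrite lerBrDr -lerBrDl; apply: le_trans eTx.
Qed.

Lemma test_bounded T phi : 0 < T -> test_function T phi ->
  [/\ continuous phi, (forall x, ~ I0 T x -> phi x = 0) &
   exists M, forall x, `|phi x| <= M].
Proof.
move=> T0 [dphi [K [cK KD phi0]]].
have cphi : continuous phi.
  by move=> x; apply: differentiable_continuous; apply/derivable1_diffP; exact: (dphi 0%N).
have phiD x : ~ I0 T x -> phi x = 0 by move=> Dx; apply: phi0 => /KD.
split => //.
have cn : {within `[0, T], continuous (fun x => `|phi x|)}.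
  apply: continuous_subspaceT => y; apply: continuous_comp; first exact: cphi.
  exact: norm_continuous.
have [c _ cmax] := EVT_max (ltW T0) cn.
exists `|phi c| => x; have [xT|xT] := boolP (x \in `[0, T]).
  exact: cmax.
rewrite phiD ?normr0// => /= Dx; move/negP : xT; apply.
by move: Dx; rewrite !in_itv/= => /andP[/ltW -> /ltW ->].
Qed.

Lemma test_derive1 T phi : test_function T phi -> test_function T (derive1 phi).
Proof.
move=> [dphi [K [cK KD phi0]]]; split.
  by move=> n x; have := dphi n.+1 x; rewrite /derive1n iterSr.
exists K; split => // x Kx; rewrite derive1E.
have cl : closed K by exact: compact_closed.
have : \forall y \near x, phi y = 0.
  have oK : open (~` K) by exact: closed_openC.
  have : nbhs x (~` K) by exact: open_nbhs_nbhs.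
  by apply: filterS => y; exact: phi0.
move=> near0; rewrite (@near_eq_derive _ _ _ phi (cst 0))//.
exact: derive_cst.
Qed.

Lemma test_derive1n T n phi : test_function T phi -> test_function T (derive1n n phi).
Proof. by move=> tphi; elim: n => [//|n IH]; rewrite derive1nS; exact: test_derive1. Qed.

Lemma integral_test_derive T phi (s : R) : 0 < T -> test_function T phi -> 0 < s -> s < T ->
  Rintegral mu (`]s, T[%classic : set R) (derive1 phi) = - phi s.
Proof.
move=> T0 tphi s0 sT; have [cphi phi0 _] := test_bounded T0 tphi.
have [cd _ _] := test_bounded T0 (test_derive1 tphi).
have dphi x : derivable phi x 1 by exact: (tphi.1 0%N).
have mE (A : set R) : measurable_fun A (EFin \o derive1 phi).
  apply/measurable_EFinP; apply: measurable_funTS; exact: continuous_measurable_fun.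
rewrite /Rintegral integral_itv_bndo_bndc// integral_itv_obnd_cbnd//.
rewrite (@continuous_FTC2 _ (derive1 phi) phi s T sT (continuous_subspaceT cd)).
- by rewrite (phi0 T) ?sub0e//= in_itv/= ltxx andbF.
- split; first by move=> x _.
    by apply: cvg_at_right_filter; exact: cphi.
  by apply: cvg_at_left_filter; exact: cphi.
- by move=> x _.
Qed.

Lemma mLp1_locally_integrable T f : 0 < T -> mLp 1 T f -> locally_integrable (I0 T) f.
Proof.
move=> T0 Lf; apply: open_integrable_locally; first exact: interval_open.
exact: mLp_integrable (lexx _) T0 Lf.
Qed.

Lemma eq_wderiv T j f g w : measurable_fun (I0 T) g -> eq_ae0T T f g ->
  is_wderiv T j f w -> is_wderiv T j g w.
Proof.
move=> mg fg [[mf oD lf] lw H]; split => //.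
  split => // K KD cK; have mK : measurable (K : set (measurableTypeR R)) by exact: compact_measurable.
  rewrite -(_ : \int[mu]_(x in K) `|f x|%:E = \int[mu]_(x in K) `|g x|%:E)%E; first exact: lf.
  apply: ge0_ae_eq_integral => //.
  - apply/measurable_EFinP; apply: measurableT_comp => //; exact: measurable_funS mf.
  - apply/measurable_EFinP; apply: measurableT_comp => //; exact: measurable_funS mg.
  - by apply: filterS fg => x fgx Kx; rewrite fgx//; exact: KD.
move=> phi tphi; rewrite -H// /Rintegral; congr fine; apply: ae_eq_integral => //.
- apply/measurable_EFinP; apply: measurable_funM => //; apply: measurable_funTS.
  apply: continuous_measurable_fun => x; apply: differentiable_continuous.
  by apply/derivable1_diffP; exact: tphi.1.
- apply/measurable_EFinP; apply: measurable_funM => //; apply: measurable_funTS.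
  apply: continuous_measurable_fun => x; apply: differentiable_continuous.
  by apply/derivable1_diffP; exact: tphi.1.
- by apply: filterS fg => x fgx Dx; rewrite fgx.
Qed.

Lemma test_integrable T phi h : 0 < T -> test_function T phi ->
  locally_integrable (I0 T) h -> mu.-integrable (I0 T) (EFin \o (fun t => h t * phi t)).
Proof.
move=> T0 tphi [mg _ lg].
have [cphi _ [M HM]] := test_bounded T0 tphi.
have [_ [K [cK KD phi0]]] := tphi.
have mphi : measurable_fun setT phi by exact: continuous_measurable_fun.
have mK : measurable (K : set (measurableTypeR R)) by exact: compact_measurable.
have mgphi : measurable_fun (I0 T) (fun t => h t * phi t).
  by apply: measurable_funM => //; exact: measurable_funTS.
apply: integrable_on => //.
apply: (@le_lt_trans _ _ (\int[mu]_(x in K) (M%:E * `|h x|%:E))%E).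
  have mKg : measurable_fun K (fun x => M%:E * `|h x|%:E)%E.
    apply: measurable_funeM; apply/measurable_EFinP; apply: measurableT_comp => //.
    exact: measurable_funS mg.
  rewrite integral_mkcond [leRHS]integral_mkcond; apply: ge0_le_integral => //.
  - by move=> x _; apply: erestrict_ge0 => y _; rewrite lee_fin.
  - apply/(measurable_restrictT _ (measurable_itv _))/measurable_EFinP.
    exact: measurableT_comp.
  - exact/(measurable_restrictT _ mK).
  - move=> x _; rewrite !patchE; have [xK|xK] := boolP (x \in K).
      rewrite mem_set; last by apply: KD; rewrite -inE.
      by rewrite -EFinM lee_fin normrM mulrC ler_wpM2r.
    by case: ifP => // _; rewrite phi0 ?mulr0 ?normr0// => /mem_set; exact/negP.
rewrite ge0_integralZl//; last 2 first.
- apply/measurable_EFinP; apply: measurableT_comp => //; exact: measurable_funS mg.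
- by rewrite lee_fin (le_trans _ (HM 0)).
apply: lte_mul_pinfty => //; last exact: lg.
by rewrite lee_fin (le_trans _ (HM 0)).
Qed.

(** The fundamental lemma of the calculus of variations, applied to w - w'. *)
Lemma wderiv_unique T j f w w' : 0 < T ->
  is_wderiv T j f w -> is_wderiv T j f w' -> eq_ae0T T w w'.
Proof.
move=> T0 [_ lw H] [_ lw' H'].
have lh : locally_integrable (I0 T) (fun x => w x - w' x).
  exact: locally_integrableB lw lw'.
have h0 : eq_ae0T T (fun x => w x - w' x) (cst 0).
  apply: integral_itv0_ae => // a b a0 bT; apply: bump_vanish lh _ a0 bT => phi tphi.
  rewrite (@eq_Rintegral _ _ _ mu _ (fun t => w t * phi t - w' t * phi t)); last first.
    by move=> t _; rewrite mulrBl.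
  rewrite RintegralB//; [|exact: test_integrable|exact: test_integrable].
  have e1 : (-1) ^+ j != 0 :> R by rewrite signr_eq0.
  by apply: (mulfI e1); rewrite mulr0 mulrBr -H// -H'// subrr.
by apply: filterS h0 => x hx Dx; apply/eqP; rewrite -subr_eq0; apply/eqP/hx.
Qed.

(** Fubini on the triangle s < t: the inner integral of the derivative of psi over ]s, T[ is -
    psi(s). *)
Lemma RLint1_parts T g psi : 0 < T -> mLp 1 T g -> test_function T psi ->
  Rintegral mu (I0 T) (fun t => RLint 1 g t * derive1 psi t) =
  - Rintegral mu (I0 T) (fun t => g t * psi t).
Proof.
move=> T0 Lg tpsi; have mg := Lg.1.
have [cd _ [M HM]] := test_bounded T0 (test_derive1 tpsi).
have [cpsi _ _] := test_bounded T0 tpsi.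
have md : measurable_fun setT (derive1 psi) by exact: continuous_measurable_fun.
have mpsi : measurable_fun setT psi by exact: continuous_measurable_fun.
have M0 : 0 <= M by rewrite (le_trans _ (HM 0)).
pose f t s := derive1 psi t * (rk 1 (t - s) * g s).
have mf : measurable_fun [set: R * R] (fun z => f z.1 z.2).
  apply: measurable_funM; last exact: measurable_rk_mul2.
  exact: (measurableT_comp md measurable_fst).
have rk1 x : `|rk 1 x : R| <= 1.
  rewrite /rk; case: ifP => _; last by rewrite normr0.
  by rewrite subrr powRr0 normr1.
have mag : measurable_fun setT (fun s => `|g s|%:E).
  by apply/measurable_EFinP; exact: measurableT_comp.
have g1 : (\int[mu]_(s in I0 T) `|g s|%:E < +oo)%E.
  by have [_] := Lg; rewrite /energy; under eq_integral do rewrite powRr1//.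
have foo : (\int[mu]_(t in I0 T) \int[mu]_(s in I0 T) `|f t s|%:E < +oo)%E.
  apply: (@le_lt_trans _ _ (\int[mu]_(t in I0 T) (cst (M%:E * \int[mu]_(s in I0 T) `|g s|%:E)) t)%E).
    apply: ge0_le_integral => //.
    - by move=> x _; apply: integral_ge0.
    - apply: measurable_funTS; apply: (@measurable_tonelli_on _ _ (fun x s => `|f x s|%:E)) => //.
      by apply/measurable_EFinP; exact: measurableT_comp.
    - move=> x _ /=; rewrite -ge0_integralZl//; last exact: measurable_funTS.
      apply: ge0_le_integral => //.
      + apply: measurable_funTS; apply/measurable_EFinP; apply: measurableT_comp => //.
        exact: (measurableT_comp mf (pair1_measurable x)).
      + by apply: measurable_funeM; exact: measurable_funTS.
      + move=> s _; rewrite -EFinM lee_fin /f !normrM ler_pM//.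
        by rewrite -[leRHS]mul1r ler_wpM2r.
  rewrite integral_cst//= lebesgue_measure_itv/= lte_fin T0.
  rewrite oppr0 adde0 lte_mul_pinfty ?ltry//.
    by rewrite mule_ge0// ?lee_fin//; apply: integral_ge0.
  by rewrite fin_numM// ge0_fin_numE//; exact: integral_ge0.
transitivity (Rintegral mu (I0 T) (fun t => Rintegral mu (I0 T) (f t))).
  apply: eq_Rintegral => t; rewrite inE/= in_itv/= => /andP[_ /ltW tT].
  rewrite (RLint_D _ tT); last exact: measurable_funTS.
  rewrite Gamma1 invr1 mul1r mulrC -RintegralZl_measurable//.
  by apply: measurable_rk_mul; exact: measurable_funTS.
rewrite (fubini_on _ _ mf foo)// -[RHS]mulN1r -RintegralZl_measurable//; last first.
  by apply: measurable_funTS; exact: measurable_funM.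
apply: eq_Rintegral => s; rewrite inE/= in_itv/= => /andP[s0 sT].
rewrite mulN1r -mulrN -(integral_test_derive T0 tpsi s0 sT).
rewrite -RintegralZl_measurable//; last exact: measurable_funTS.
rewrite [LHS]Rintegral_mkcond [RHS]Rintegral_mkcond; apply: eq_Rintegral => t _.
rewrite !patchE !mem_setE !in_itv/= /f /rk subr_gt0 subrr powRr0.
have [st|ts] := ltP s t; last by rewrite mul0r mulr0; case: ifP.
by rewrite (lt_trans s0 st)/=; case: ifP => // _; rewrite mul1r mulrC.
Qed.

Lemma wderiv_RLint1 T j g w : 0 < T -> mLp 1 T g ->
  is_wderiv T j g w -> is_wderiv T j.+1 (RLint 1 g) w.
Proof.
move=> T0 Lg [_ lw H]; split => //.
  exact: mLp1_locally_integrable T0 (mLp_RLint ltr01 (lexx _) T0 Lg).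
move=> phi tphi; rewrite derive1nS RLint1_parts//; last exact: test_derive1n.
by rewrite H// exprS mulN1r mulNr.
Qed.

Lemma wderiv0 T f : locally_integrable (I0 T) f -> is_wderiv T 0 f f.
Proof. by move=> lf; split => // phi _; rewrite expr0 mul1r. Qed.

(** Each derivative removes the outer factor in J^a = J^1 J^(a-1). The strict inequality i < a keeps
    the remaining order positive. *)
Lemma wderiv_RLint T i a v : 0 < T -> i%:R < a -> mLp 1 T v ->
  is_wderiv T i (RLint a v) (RLint (a - i%:R) v).
Proof.
elim: i a => [|i IH] a T0 ia Lv.
  have a0 : 0 < a by [].
  rewrite subr0; exact: wderiv0 (mLp1_locally_integrable T0 (mLp_RLint a0 (lexx _) T0 Lv)).
have a1 : 0 < a - 1 by rewrite subr_gt0 (le_lt_trans _ ia)// ler1n.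
have := IH (a - 1) T0; rewrite ltrBrDr natr1 => /(_ ia Lv) H.
have := wderiv_RLint1 T0 (mLp_RLint a1 (lexx _) T0 Lv) H.
have -> : a - 1 - i%:R = a - i.+1%:R by rewrite -natr1; ring.
apply: eq_wderiv; first by apply: measurable_funTS; exact: measurable_RLint Lv.1.
have := RLint_semigroup ltr01 a1 T0 Lv; by rewrite (addrC 1) subrK.
Qed.

(** The limiting case of [wderiv_RLint], separate because J^0 should be the identity while [RLint 0]
    vanishes. *)
Lemma wderiv_RLint_nat T i v : 0 < T -> mLp 1 T v ->
  is_wderiv T i.+1 (RLint i.+1%:R v) v.
Proof.
elim: i => [|i IH] T0 Lv.
  apply: wderiv_RLint1 => //; apply: wderiv0; exact: mLp1_locally_integrable.
have i0 : 0 < i.+1%:R :> R by rewrite ltr0n.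
have := wderiv_RLint1 T0 (mLp_RLint i0 (lexx _) T0 Lv) (IH T0 Lv).
apply: eq_wderiv; first by apply: measurable_funTS; exact: measurable_RLint Lv.1.
by have := RLint_semigroup ltr01 i0 T0 Lv; rewrite addrC natr1.
Qed.

Lemma is_wderiv_wderiv T j f w : is_wderiv T j f w -> is_wderiv T j f (wderiv T j f).
Proof.
case: j => [|j] H; first by have [lf _ _] := H; exact: wderiv0.
by rewrite /wderiv; case: xgetP => [w' -> //|/(_ w)].
Qed.

Lemma wderiv_ae T j f w : 0 < T -> is_wderiv T j f w -> eq_ae0T T (wderiv T j f) w.
Proof. by move=> T0 H; exact: wderiv_unique T0 (is_wderiv_wderiv H) H. Qed.

Lemma wderiv_cst0 T j : is_wderiv T j (cst 0) (cst 0).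
Proof.
have l0 : locally_integrable (I0 T) (cst 0 : R -> R).
  apply: open_integrable_locally; first exact: interval_open.
  exact: integrable0.
split => // phi _; rewrite (@eq_Rintegral _ _ _ mu _ (cst 0)); last first.
  by move=> t _; rewrite mul0r.
rewrite [in RHS](@eq_Rintegral _ _ _ mu _ (cst 0)); last first.
  by move=> t _; rewrite mul0r.
by rewrite /Rintegral integral0 mulr0.
Qed.

(** J^(n+1-a) raises J^a w to an integer order, where n + 1 weak derivatives recover w; uniqueness
    of weak derivatives then gives w = 0. *)
Lemma RLint_inj T a w : 0 < T -> 0 < a -> mLp 1 T w ->
  eq_ae0T T (RLint a w) (cst 0) -> eq_ae0T T w (cst 0).
Proof.
move=> T0 a0 Lw H.
pose n := Num.truncn a; have na : 0 < n.+1%:R - a by rewrite subr_gt0 truncnS_gt.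
have mw := measurable_RLint a Lw.1.
have E : eq_ae0T T (RLint n.+1%:R w) (cst 0).
  have := RLint_semigroup na a0 T0 Lw; rewrite subrK => S.
  apply: (ae_imply (mu := mu) (D := I0 T) S) => t Dt <-.
  have tT : t <= T by move: Dt; rewrite /= in_itv/= => /andP[_ /ltW].
  rewrite (eq_RLint _ tT _ _ H)//; last exact: measurable_funTS.
  rewrite /RLint (@eq_Rintegral _ _ _ mu _ (cst 0)); last first.
    by move=> s _; rewrite mulr0.
  by rewrite /Rintegral integral0 mulr0.
apply: (@wderiv_unique T n.+1 (cst 0)) => //; last exact: wderiv_cst0.
by apply: eq_wderiv E (wderiv_RLint_nat n T0 Lw).
Qed.

End weak_derivatives.

(** * Sobolev-Slobodecki norms in terms of energies; primitives *)

Section slobodecki_spaces.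
Context {R : realType}.
Local Notation mu := (@lebesgue_measure R).
Local Notation leb := (mu : {measure set (measurableTypeR R) -> \bar R}).
Local Notation I0 T := (`]0%R, T[%classic : set R).
Implicit Types (s p T : R) (u v w : R -> R) (d : nat -> R -> R).

Lemma is_wderiv_measurable T j u w : is_wderiv T j u w -> measurable_fun (I0 T) w.
Proof.
by move=> [_ [mw _ _] _].
Qed.

(** [gagliardo 0] need not vanish, whereas integer orders carry no seminorm; with this convention
    one formula covers both kinds of order. *)
Definition gagliardo0 theta p T u : \bar R :=
  if theta == 0 then 0%E else gagliardo theta p T u.

(* The p-th power of the norm of W^{s,p}(0,T), computed from a family [d] of
   derivatives. *)
Definition slobodecki_energy s p T d : \bar R :=
  (\sum_(i < (Num.truncn s).+1) energy p T (d i) +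
   gagliardo0 (s - (Num.truncn s)%:R)%R p T (d (Num.truncn s)))%E.

Lemma gagliardo_ge0 theta p T u : (0 <= gagliardo theta p T u)%E.
Proof.
apply: integral_ge0 => x _; apply: integral_ge0 => y _.
by rewrite lee_fin divr_ge0 ?powR_ge0.
Qed.

Lemma gagliardo0_ge0 theta p T u : (0 <= gagliardo0 theta p T u)%E.
Proof.
by rewrite /gagliardo0; case: ifP => // _; exact: gagliardo_ge0.
Qed.

Lemma slobodecki_energy_ge0 s p T d : (0 <= slobodecki_energy s p T d)%E.
Proof.
apply: adde_ge0; last exact: gagliardo0_ge0.
by apply: sume_ge0 => i _; exact: energy_ge0.
Qed.

Lemma energy_le_slobodecki s p T d i : (i <= Num.truncn s)%N ->
  (energy p T (d i) <= slobodecki_energy s p T d)%E.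
Proof.
move=> ij; rewrite /slobodecki_energy -[leLHS]adde0; apply: leeD; last exact: gagliardo0_ge0.
have i1 : (i < (Num.truncn s).+1)%N by rewrite ltnS.
rewrite (bigD1 (Ordinal i1))//= leeDl//.
by apply: sume_ge0 => k _; exact: energy_ge0.
Qed.

Lemma slobodecki_normE s p T u : 0 < p ->
  slobodecki_norm s p T u = (slobodecki_energy s p T (wderiv T ^~ u) `^ p^-1)%E.
Proof.
move=> p0; have pn0 : p != 0 by rewrite gt_eqF.
have S0 (n : nat) : (0 <= \sum_(i < n) energy p T (wderiv T i u))%E.
  by apply: sume_ge0 => i _; exact: energy_ge0.
have E : sobolev_norm (Num.truncn s) p T u =
    ((\sum_(i < (Num.truncn s).+1) energy p T (wderiv T i u)) `^ p^-1)%E.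
  rewrite /sobolev_norm; congr poweR; apply: eq_bigr => i _.
  by rewrite Lp_normE// -poweRrM mulVf// poweRe1// energy_ge0.
rewrite /slobodecki_norm /slobodecki_energy /gagliardo0 E; case: ifP => _; first by rewrite adde0.
by rewrite -poweRrM mulVf// poweRe1.
Qed.

(** Lets explicit derivatives replace those selected by [wderiv], with which they agree almost
    everywhere by uniqueness. *)
Lemma eq_slobodecki_energy s p T u d : 0 < T ->
  (forall i, (i <= Num.truncn s)%N -> is_wderiv T i u (d i)) ->
  slobodecki_energy s p T (wderiv T ^~ u) = slobodecki_energy s p T d.
Proof.
move=> T0 ud; have mw i : (i <= Num.truncn s)%N -> measurable_fun (I0 T) (wderiv T i u).
  by move=> /ud /is_wderiv_wderiv /is_wderiv_measurable.
have md i : (i <= Num.truncn s)%N -> measurable_fun (I0 T) (d i).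
  by move=> /ud /is_wderiv_measurable.
rewrite /slobodecki_energy (eq_bigr (fun i : 'I_ _ => energy p T (d i))); last first.
  move=> i _; have ij : (i <= Num.truncn s)%N by rewrite -ltnS.
  by rewrite (ae_energy _ (mw i ij) (md i ij) (wderiv_ae T0 (ud i ij))).
rewrite /gagliardo0 (ae_gagliardo _ _ (mw _ (leqnn _)) (md _ (leqnn _)))//.
exact: wderiv_ae T0 (ud _ (leqnn _)).
Qed.

Lemma slobodeckiP s p T u : 0 < p -> 0 < T ->
  slobodecki s p T u <-> exists d, [/\ d 0%N = u,
    forall i, (i <= Num.truncn s)%N -> is_wderiv T i u (d i) &
    (slobodecki_energy s p T d < +oo)%E].
Proof.
move=> p0 T0; have pn0 : p^-1 != 0 by rewrite invr_eq0 gt_eqF.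
split=> [[[Lu H]] |[d [d0 ud foo]]].
  rewrite slobodecki_normE// => foo; exists (wderiv T ^~ u); split => //.
    by move=> i /H[w /is_wderiv_wderiv].
  by apply: lty_poweRy foo.
have Ld i : (i <= Num.truncn s)%N -> Lp p T (d i).
  move=> ij; apply/LpP => //; split; first exact: is_wderiv_measurable (ud i ij).
  apply: le_lt_trans foo; exact: energy_le_slobodecki.
split; first split.
- by rewrite -d0; exact: Ld.
- by move=> i ij; exists (d i); [exact: ud|exact: Ld].
rewrite slobodecki_normE//; apply: poweR_lty.
by rewrite (eq_slobodecki_energy _ _ ud).
Qed.

Lemma RLint_derivs s a T v : 0 < T -> 0 <= s -> s < a -> mLp 1 T v ->
  forall i, (i <= Num.truncn s)%N -> is_wderiv T i (RLint a v) (RLint (a - i%:R) v).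
Proof.
move=> T0 s0 sa Lv i ij; apply: wderiv_RLint => //.
apply: le_lt_trans sa; apply: (@le_trans _ _ (Num.truncn s)%:R); last by rewrite truncn_le.
by rewrite ler_nat.
Qed.

Lemma slobodecki_energy_RLint s a p T : 0 <= s -> s < a -> 1 <= p -> 0 < T ->
  exists2 C : R, 0 <= C & forall v, mLp p T v ->
    (slobodecki_energy s p T (fun i => RLint (a - i%:R) v) <= C%:E * energy p T v)%E.
Proof.
move=> s0 sa p1 T0; set j := Num.truncn s; pose theta := s - j%:R.
have ia (i : nat) : (i <= j)%N -> 0 < a - i%:R.
  move=> ij; rewrite subr_gt0; apply: le_lt_trans sa; apply: (@le_trans _ _ j%:R); last by rewrite truncn_le.
  by rewrite ler_nat.
pose S := \sum_(i < j.+1) RLnorm (a - i%:R) T `^ p.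
have S0 : 0 <= S by apply: sumr_ge0 => i _; exact: powR_ge0.
have HS v : mLp p T v ->
    (\sum_(i < j.+1) energy p T (RLint (a - i%:R) v) <= S%:E * energy p T v)%E.
  move=> Lv; rewrite /S -sumEFin ge0_sume_distrl; last first.
    by move=> i _; rewrite lee_fin powR_ge0.
  apply: lee_sum => i _; apply: energy_RLint => //; last exact: Lv.1.
  by apply: ia; rewrite -ltnS.
have [t0|tn0] := eqVneq theta 0.
  exists S => // v Lv; rewrite /slobodecki_energy -/j -/theta /gagliardo0 t0 eqxx adde0.
  exact: HS.
have th0 : 0 < theta by rewrite lt_def tn0/= subr_ge0 truncn_le.
have th1 : theta < 1 by rewrite ltrBlDr addrC natr1 truncnS_gt.
have tha : theta < a - j%:R by rewrite ltrD2r.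
have [C C0 HC] := gagliardo_RLint th0 th1 tha p1 T0.
exists (S + C); first exact: addr_ge0.
move=> v Lv; rewrite /slobodecki_energy -/j -/theta /gagliardo0 (negbTE tn0) EFinD ge0_muleDl//.
by apply: leeD; [exact: HS|exact: HC].
Qed.

Lemma Rintegral_split v (a b c : R) : a <= b -> b <= c ->
  mu.-integrable (`]a, c[%classic : set R) (EFin \o v) ->
  Rintegral mu (`]a, c[%classic : set R) v - Rintegral mu (`]a, b[%classic : set R) v =
  Rintegral mu (`]b, c[%classic : set R) v.
Proof.
move=> ab bc iv; case: (ltgtP b c) bc => // [bc _|-> _]; last by rewrite subrr set_itv_ge ?Rintegral_set0// bnd_simp ltxx.
rewrite -[RHS](@Rintegral_itvB _ _ (BRight a) (BLeft c))//.
congr (_ - _); apply: Rintegral_itv_bndo_bndc.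
apply: integrableS iv => // t /=.
by rewrite !in_itv/= => /andP[-> /= tb]; exact: lt_trans bc.
Qed.

Lemma RLint1B v T t t' : mLp 1 T v -> 0 <= t -> t <= t' -> t' <= T ->
  RLint 1 v t' - RLint 1 v t = Rintegral mu (`]t, t'[%classic : set R) v.
Proof.
move=> Lv t0 tt' t'T; rewrite !RLint1E; apply: Rintegral_split => //.
have [T0|T0] := ltP 0 T; last first.
  have -> : t' = t by apply/eqP; rewrite eq_le tt' (le_trans t'T) ?(le_trans T0).
  by rewrite set_itv_ge ?bnd_simp -?leNgt ?(le_trans tt')//; [exact: integrable_set0|exact: le_trans T0].
apply: integrableS (mLp_integrable (lexx _) T0 Lv) => //.
by move=> x /=; rewrite !in_itv/= => /andP[-> /lt_le_trans ->].
Qed.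

Lemma RLint1_0 v : RLint 1 v 0 = 0.
Proof.
by rewrite RLint1E set_itv_ge ?Rintegral_set0// bnd_simp ltxx.
Qed.

Lemma continuous_RLint1 v T : 0 < T -> mLp 1 T v ->
  {within `[0, T], continuous (RLint 1 v)}.
Proof.
move=> T0 Lv.
have mvD : measurable_fun (I0 T) v by exact: measurable_funTS Lv.1.
have iv : mu.-integrable (`[0%R, T]%classic : set R) (EFin \o v).
  apply: integrable_on; first exact: measurable_funTS Lv.1.
  have /integrableP[_] := mLp_integrable (lexx _) T0 Lv.
  rewrite integral_itv_bndo_bndc ?integral_itv_obnd_cbnd//.
  - by apply/measurable_EFinP; apply: measurableT_comp => //; exact: measurable_funTS Lv.1.
  - by apply/measurable_EFinP; apply: measurableT_comp => //; exact: measurable_funTS Lv.1.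
have := parameterized_integral_continuous (ltW T0) iv.
have <- : RLint 1 v = (parameterized_integral mu 0)^~ v; last by [].
apply/funext => t; rewrite RLint1E /parameterized_integral /Rintegral.
rewrite -integral_itv_obnd_cbnd; last first.
  by apply/measurable_EFinP; exact: measurable_funTS Lv.1.
rewrite -integral_itv_bndo_bndc//.
by apply/measurable_EFinP; exact: measurable_funTS Lv.1.
Qed.

Lemma is_deriv_RLint1 v T t : 0 < T -> mLp 1 T v -> {within `[0, T], continuous v} ->
  t \in `[0, T] ->
  (fun s => (RLint 1 v s - RLint 1 v t) / (s - t)) @ within `[0, T] t^' --> v t.
Proof.
move=> T0 Lv cv tT.
apply/cvgrPdist_le => e e0.
have [d d0 Hd] : exists2 d : R, 0 < d & forall x, 0 <= x <= T -> `|x - t| < d -> `|v x - v t| <= e.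
  have /subspace_continuousP /(_ t) := cv.
  have tT' : `[0%R, T]%classic t by [].
  move=> /(_ tT') /cvgrPdist_le /(_ e e0) [d /= d0 Hd]; exists d => // x xT xd.
  by rewrite distrC; apply: Hd => //; rewrite /ball/= distrC.
(* Stated for an interval ]x, y[ on which v is close to v(t), so that t may be either end of it;
   this serves both sides of t and the endpoints 0 and T. *)
have key (x y : R) : 0 <= x -> x < y -> y <= T ->
    (forall z, x < z < y -> `|v z - v t| <= e) ->
    `|v t - (RLint 1 v y - RLint 1 v x) / (y - x)| <= e.
  move=> x0 xy yT Hz; rewrite (RLint1B Lv)// ?(ltW xy)//.
  have yx0 : 0 < y - x by rewrite subr_gt0.
  have muE : fine (mu (`]x, y[%classic : set R)) = y - x.
    by rewrite lebesgue_measure_itv/= lte_fin xy.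
  have vE : v t * (y - x) = Rintegral mu (`]x, y[%classic : set R) (cst (v t)).
    by rewrite Rintegral_cst// muE.
  have iv : mu.-integrable (`]x, y[%classic : set R) (EFin \o v).
    apply: integrableS (mLp_integrable (lexx _) T0 Lv) => // z /=.
    rewrite !in_itv/= => /andP[xz zy].
    by rewrite (le_lt_trans x0 xz) (lt_le_trans zy yT).
  have ic (r : R) : mu.-integrable (`]x, y[%classic : set R) (EFin \o cst r).
    apply: integrable_on => //; rewrite (integral_cst mu (measurable_itv _) `|r|%:E).
    by rewrite /= lebesgue_measure_itv/= lte_fin xy -EFinB -EFinM ltry.
  have iB : leb.-integrable (`]x, y[%classic : set R) (EFin \o (fun z => cst (v t) z - v z)).
    have := @integrableB _ _ _ leb _ (measurable_itv _) _ _ (ic (v t)) iv; by [].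
  rewrite -[v t](mulfK (lt0r_neq0 yx0)) -mulrBl normrM normfV (gtr0_norm yx0).
  rewrite ler_pdivrMr// vE -RintegralB//; last exact: ic.
  have -> : e * (y - x) = Rintegral mu (`]x, y[%classic : set R) (cst e).
    by rewrite Rintegral_cst// muE.
  apply: le_trans (le_normr_Rintegral _ _) _ => //.
  apply: le_Rintegral => //.
  - exact: (integrable_abse iB).
  - exact: ic.
  - by move=> z zxy; rewrite /= distrC; exact: Hz.
exists d => //= x; rewrite /ball/= => xd xt xT.
move: tT xT; rewrite /= !in_itv/= => /andP[t0 tT] /andP[x0 xT].
have [tx|xt'] := ltP t x.
  apply: key => // z /andP[tz zx]; apply: Hd.
    by rewrite (le_trans t0 (ltW tz)) (le_trans (ltW zx) xT).
  rewrite gtr0_norm ?subr_gt0//; apply: le_lt_trans xd.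
  by rewrite ltr0_norm ?subr_lt0// opprB lerB// ltW.
have {}xt' : x < t by rewrite lt_neqAle xt' andbT.
rewrite -[X in X / _]opprB -[X in _ / X]opprB invrN mulrNN.
apply: key => // z /andP[xz zt]; apply: Hd.
  by rewrite (le_trans x0 (ltW xz)) (le_trans (ltW zt) tT).
rewrite ltr0_norm ?subr_lt0// opprB; apply: le_lt_trans xd.
by rewrite gtr0_norm ?subr_gt0// lerB// ltW.
Qed.

End slobodecki_spaces.

(** * Density of smooth functions vanishing at 0, and the inclusion of (i) *)

Section density.
Context {R : realType}.
Local Notation mu := (@lebesgue_measure R).
Local Notation I0 T := (`]0%R, T[%classic : set R).
Implicit Types (s p T : R) (u v w : R -> R) (d : nat -> R -> R).

Lemma mLp_iter_RLint1 p T k x : 1 <= p -> 0 < T -> mLp p T x ->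
  mLp p T (iter k (RLint 1) x).
Proof.
move=> p1 T0 Lx; elim: k => [|k IH]; first exact: Lx.
exact: (mLp_RLint ltr01 p1 T0 IH).
Qed.

(** One integration more than k, because [x] is merely integrable: its first primitive is
    continuous, and k further ones give k derivatives, with value 0 at 0 below order k. *)
Lemma zeroC_iter_RLint1 k T x : 0 < T -> mLp 1 T x ->
  zeroC k T (iter k.+1 (RLint 1) x).
Proof.
move=> T0 Lx; have L n := mLp_iter_RLint1 n (lexx _) T0 Lx.
have S j : (j <= k)%N -> iter (k.+1 - j) (RLint 1) x = RLint 1 (iter (k - j) (RLint 1) x).
  by move=> jk; rewrite subSn.
exists (fun j => iter (k.+1 - j) (RLint 1) x); first split; first split.
- by move=> j jk; rewrite (S j jk); exact: (continuous_RLint1 T0 (L _)).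
- move=> j t jk tT; rewrite (S j (ltnW jk)) (S j.+1 jk) -(S j.+1 jk) subSS.
  apply: (is_deriv_RLint1 T0 (L _) _ tT).
  have -> : (k - j)%N = (k - j.+1).+1 by rewrite subnS prednK// subn_gt0.
  exact: (continuous_RLint1 T0 (L _)).
- by rewrite subn0.
- by move=> j jk; rewrite (S j (ltnW jk)) RLint1_0.
Qed.

Lemma mul_small (A eta : R) : 0 <= A -> 0 < eta ->
  exists2 e : R, 0 < e & A * e <= eta.
Proof.
move=> A0 e0; have A1 : 0 < A + 1 by rewrite ltr_wpDl.
exists (eta / (A + 1)); first by rewrite divr_gt0.
by rewrite mulrA ler_pdivrMr// mulrC ler_pM2l// lerDl.
Qed.

(** The bound [L] depends on v only through the energy bound [M], since Hölder's inequality on (0,T)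
    controls the L^1 norm of v. *)
Lemma RLint_truncation_uniform c p T (M eta : R) : 0 < c -> c < 1 -> 1 <= p -> 0 < T ->
  0 <= M -> 0 < eta -> exists L : R, forall v, mLp p T v -> (energy p T v <= M%:E)%E ->
  exists y : R -> R, [/\ measurable_fun setT y, forall t, `|y t| <= L &
    (energy p T (fun t => RLint c v t - RLint 1 y t)%R <= eta%:E)%E].
Proof.
move=> c0 c1 p1 T0 M0 eta0; have p0 : 0 < p by exact: lt_le_trans p1.
have [e e0 he] := mul_small M0 eta0.
pose delta := e `^ p^-1.
have delta0 : 0 < delta by rewrite powR_gt0.
have G0 := Gamma_gt0 c0.
(* Solves d^c / (c Gamma(c)) = delta, where delta^p M <= eta. *)
pose d := (delta * c * Gamma c) `^ c^-1.
have d0 : 0 < d by rewrite powR_gt0// !mulr_gt0.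
have dE : d `^ c / c / Gamma c = delta.
  rewrite -powRrM mulVf ?gt_eqF// powRr1 ?ltW ?mulr_gt0//.
  by rewrite mulrAC mulfK ?gt_eqF// mulfK ?gt_eqF.
have dp : delta `^ p = e by rewrite /delta -powRrM mulVf ?gt_eqF// powRr1// ltW.
have [K K0 H] := RLint_truncation c0 c1 d0 T.
exists (K * (T `^ (p - 1) * M) `^ p^-1) => v Lv vM.
have [y [my yM Ey]] := H p v p1 T0 Lv; exists y; split => //.
  move=> t; rewrite -lee_fin EFinM; apply: le_trans (yM t) _.
  apply: lee_wpmul2l; first by rewrite lee_fin.
  have H1 := integral_le_energy p1 T0 Lv.1.
  have i0 : (0 <= \int[mu]_(x in I0 T) `|v x|%:E)%E by exact: integral_ge0.
  rewrite -[leLHS](poweRe1 i0) -[X in (_ `^ X <= _)%E](mulfV (lt0r_neq0 p0)) poweRrM -poweR_EFin.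
  apply: poweR_le; [by rewrite invr_ge0 ltW|exact: poweR_ge0|].
  apply: le_trans H1 _; rewrite EFinM; apply: lee_wpmul2l => //.
  by rewrite lee_fin powR_ge0.
apply: le_trans Ey _; rewrite dE dp; apply: (@le_trans _ _ (e%:E * M%:E)%E).
  by apply: lee_wpmul2l => //; rewrite lee_fin ltW.
by rewrite -EFinM lee_fin mulrC.
Qed.

Lemma RLint_lt1_dense c p T v (eta : R) : 0 < c -> c < 1 -> 1 <= p -> 0 < T ->
  mLp p T v -> 0 < eta ->
  exists2 y, mLp p T y & (energy p T (fun t => RLint c v t - RLint 1 y t)%R <= eta%:E)%E.
Proof.
move=> c0 c1 p1 T0 Lv eta0; have p0 : 0 <= p by rewrite (le_trans _ p1).
have E0 : 0 <= fine (energy p T v) by rewrite fine_ge0// energy_ge0.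
have [L HL] := RLint_truncation_uniform c0 c1 p1 T0 E0 eta0.
have [|y [my yL Ey]] := HL v Lv.
  by rewrite fineK// ge0_fin_numE ?energy_ge0//; exact: Lv.2.
exists y; last exact: Ey.
apply: (mLp_bounded p0 (ltW T0) my (M := L)) => t _; exact: yL.
Qed.

Lemma RLint_dense1 c p T v (eta : R) : 0 < c -> 1 <= p -> 0 < T ->
  mLp p T v -> 0 < eta ->
  exists2 y, mLp p T y & (energy p T (fun t => RLint c v t - RLint 1 y t)%R <= eta%:E)%E.
Proof.
(* The truncation needs an order below 1: J^c v = J^b (J^(c-b) v) with b below both c and 1. *)
move=> c0 p1 T0 Lv eta0; pose b := Num.min c 1 / 2.
have m0 : 0 < Num.min c 1 by rewrite lt_min c0 ltr01.
have mc : Num.min c 1 <= c by rewrite ge_min lexx.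
have m1 : Num.min c 1 <= 1 by rewrite ge_min lexx orbT.
have b0 : 0 < b by rewrite divr_gt0.
have bc : 0 < c - b by rewrite /b; lra.
have b1 : b < 1 by rewrite /b; lra.
have Lw := mLp_RLint bc p1 T0 Lv.
have [y Ly Ey] := RLint_lt1_dense b0 b1 p1 T0 Lw eta0.
exists y; first exact: Ly.
rewrite (_ : energy p T _ = energy p T (fun t => RLint b (RLint (c - b) v) t - RLint 1 y t)); first exact: Ey.
apply: ae_energy.
- apply: measurable_funTS.
  exact: measurable_funB (measurable_RLint c Lv.1) (measurable_RLint 1 Ly.1).
- apply: measurable_funTS.
  exact: measurable_funB (measurable_RLint b Lw.1) (measurable_RLint 1 Ly.1).
have := RLint_semigroup b0 bc T0 (mLp1 p1 T0 Lv); rewrite (addrC b) subrK.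
by apply: filterS => t H Dt; rewrite H.
Qed.

Lemma energy_RLint_le a p T v (e : R) : 0 < a -> 1 <= p -> 0 < T ->
  measurable_fun setT v -> (energy p T v <= e%:E)%E ->
  (energy p T (RLint a v) <= (RLnorm a T `^ p * e)%:E)%E.
Proof.
move=> a0 p1 T0 mv ve; apply: le_trans (energy_RLint a0 p1 T0 mv) _.
by rewrite EFinM; apply: lee_wpmul2l => //; rewrite lee_fin powR_ge0.
Qed.

(** Induction with c = 2b: J^c v = J^b J^b v is close to J^b J^1 y = J^1 J^b y, and J^b y, of the
    positive order b, is in turn close to (J^1)^k z. Halving keeps an order available at every
    stage. *)
Lemma RLint_dense k c p T v (eta : R) : 0 < c -> 1 <= p -> 0 < T ->
  mLp p T v -> 0 < eta -> exists2 y, mLp p T y &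
  (energy p T (fun t => RLint c v t - iter k (RLint 1) y t)%R <= eta%:E)%E.
Proof.
move=> c0 p1 T0; elim: k c c0 v eta => [|k IH] c c0 v eta Lv eta0.
  exists (RLint c v); first exact: mLp_RLint c0 p1 T0 Lv.
  rewrite /energy integral0_eq ?lee_fin ?ltW// => t _.
  by rewrite /= subrr normr0 powR0// gt_eqF// (lt_le_trans _ p1).
have p0 : 0 <= p by rewrite (le_trans _ p1).
pose b := c / 2; have b0 : 0 < b by rewrite divr_gt0.
have A0 : 0 <= 2 `^ p * RLnorm b T `^ p by rewrite mulr_ge0 ?powR_ge0.
have B0 : 0 <= 2 `^ p * RLnorm 1 T `^ p by rewrite mulr_ge0 ?powR_ge0.
have eta2 : 0 < eta / 2 by rewrite divr_gt0.
have [e1 e10 he1] := mul_small A0 eta2.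
have [e2 e20 he2] := mul_small B0 eta2.
have [y Ly Ey] := RLint_dense1 b0 p1 T0 Lv e10.
have [z Lz Ez] := IH b b0 y e2 Ly e20.
exists z; first exact: Lz.
set f := (fun t => RLint c v t - _).
have Lbv := mLp_RLint b0 p1 T0 Lv.
have Lby := mLp_RLint b0 p1 T0 Ly.
have L1y := mLp_RLint ltr01 p1 T0 Ly.
have Lk := mLp_iter_RLint1 k p1 T0 Lz.
have Lf1 := mLpB p0 Lbv L1y; have Lf2 := mLpB p0 Lby Lk.
pose g := fun t => RLint b (fun t => RLint b v t - RLint 1 y t) t +
  RLint 1 (fun t => RLint b y t - iter k (RLint 1) z t) t.
have mg1 := measurable_RLint b Lf1.1.
have mg2 := measurable_RLint 1 Lf2.1.
have -> : energy p T f = energy p T g.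
  apply: ae_energy.
  - apply: measurable_funTS.
    exact: measurable_funB (measurable_RLint c Lv.1) (measurable_RLint 1 Lk.1).
  - by apply: measurable_funTS; exact: measurable_funD mg1 mg2.
  have S := RLint_semigroup b0 b0 T0 (mLp1 p1 T0 Lv).
  have bb : b + b = c by rewrite /b -splitr.
  rewrite bb in S.
  have H1 := RLintB_ae b0 T0 (mLp1 p1 T0 Lbv) (mLp1 p1 T0 L1y).
  have H2 := RLintB_ae ltr01 T0 (mLp1 p1 T0 Lby) (mLp1 p1 T0 Lk).
  have H3 := RLint_comm b0 ltr01 T0 (mLp1 p1 T0 Ly).
  have H12 := ae_imply2 H1 H2 (fun _ _ => @conj _ _).
  have H34 := ae_imply2 S H3 (fun _ _ => @conj _ _).
  apply: (ae_imply2 H12 H34) => t Dt [h1 h2] [h3 h4].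
  by rewrite /f /g h1 h2 h3 h4 /= addrA subrK.
apply: le_trans (energyD p0 (measurable_funTS mg1) (measurable_funTS mg2)) _.
rewrite [eta]splitr; apply: (@le_trans _ _
    ((2 `^ p)%:E * (RLnorm b T `^ p * e1 + RLnorm 1 T `^ p * e2)%:E)%E); last first.
  by rewrite -EFinM lee_fin mulrDr !mulrA lerD.
apply: lee_wpmul2l; first by rewrite lee_fin powR_ge0.
rewrite EFinD; apply: leeD.
  exact: (energy_RLint_le b0 p1 T0 Lf1.1 Ey).
exact: (energy_RLint_le ltr01 p1 T0 Lf2.1 Ez).
Qed.

Lemma RLint_restrict a T v : measurable_fun (I0 T) v ->
  {in I0 T, RLint a v =1 RLint a (v \_ (I0 T))}.
Proof.
move=> mv t; rewrite inE/= in_itv/= => /andP[_ /ltW tT].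
apply: (@eq_RLint _ _ _ _ T) => //.
  by apply: measurable_funTS; exact/(measurable_restrictT _ _).1.
by apply: aeW => x Dx; rewrite patchE mem_set.
Qed.

Lemma eq_in_ae T u v : {in I0 T, u =1 v} -> eq_ae0T T u v.
Proof.
by move=> uv; apply: aeW => x Dx; apply: uv; rewrite inE.
Qed.

Lemma ae_RLint a T u v : measurable_fun setT u -> measurable_fun setT v ->
  eq_ae0T T u v -> eq_ae0T T (RLint a u) (RLint a v).
Proof.
move=> mu0 mv uv; apply: eq_in_ae => t; rewrite inE/= in_itv/= => /andP[_ /ltW tT].
exact: (eq_RLint _ tT (measurable_funTS mu0) (measurable_funTS mv) uv).
Qed.

Lemma RLint_iter_RLint1 k a T y : 0 < a -> 0 < T -> mLp 1 T y ->
  eq_ae0T T (iter k (RLint 1) (RLint a y)) (RLint a (iter k (RLint 1) y)).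
Proof.
move=> a0 T0 Ly; elim: k => [|k IH]; first by apply: eq_in_ae.
have Lk := mLp_iter_RLint1 k (lexx _) T0 Ly.
have Lk' := mLp_iter_RLint1 k (lexx _) T0 (mLp_RLint a0 (lexx _) T0 Ly).
have H := RLint_comm ltr01 a0 T0 Lk.
have H' := ae_RLint 1 Lk'.1 (measurable_RLint a Lk.1) IH.
rewrite !iterS; apply: (ae_imply2 H' H) => t Dt H1 H2; rewrite H1 H2; reflexivity.
Qed.

Lemma RLint_slobodecki_bound s a p T : 0 <= s -> s < a -> 1 <= p -> 0 < T ->
  exists2 C : R, 0 < C & forall v, mLp p T v -> forall u, measurable_fun (I0 T) u ->
    eq_ae0T T (RLint a v) u ->
    slobodecki s p T u /\ (slobodecki_norm s p T u <= C%:E * Lp_norm p T v)%E.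
Proof.
move=> s0 sa p1 T0; have p0 : 0 < p by exact: lt_le_trans p1.
have [C C0 HC] := slobodecki_energy_RLint s0 sa p1 T0.
have D0 : 0 < (C + 1) `^ p^-1 by rewrite powR_gt0// ltr_wpDl.
(* C may be 0, while a positive constant is required. *)
exists ((C + 1) `^ p^-1) => // v Lv u mu0 ruv.
have Lv1 := mLp1 p1 T0 Lv.
have ud i (ij : (i <= Num.truncn s)%N) : is_wderiv T i u (RLint (a - i%:R) v).
  by apply: (eq_wderiv mu0 ruv); exact: (RLint_derivs T0 s0 sa Lv1).
have E : (slobodecki_energy s p T (wderiv T ^~ u) <= (C + 1)%:E * energy p T v)%E.
  rewrite (eq_slobodecki_energy _ T0 ud); apply: le_trans (HC v Lv) _.
  by apply: lee_wpmul2r; [exact: energy_ge0|rewrite lee_fin lerDl].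
split.
  apply/(slobodeckiP _ _ p0 T0); exists (wderiv T ^~ u); split => //.
    by move=> i ij; exact: is_wderiv_wderiv (ud i ij).
  by apply: le_lt_trans E _; apply: lte_mul_pinfty => //; [rewrite lee_fin addr_ge0|exact: Lv.2].
rewrite slobodecki_normE// Lp_normE ?gt_eqF// -poweR_EFin -poweRM ?energy_ge0//; last first.
  by rewrite lee_fin addr_ge0.
apply: gt0_ler_poweR => //; first by rewrite invr_ge0 ltW.
  by rewrite in_itv/= leey andbT slobodecki_energy_ge0.
by rewrite in_itv/= leey andbT mule_ge0 ?energy_ge0// lee_fin addr_ge0.
Qed.

(** J^b v is approximated in L^p by (J^1)^k y, and J^a', bounded from L^p to W^(s,p), carries the
    approximation over; J^a' (J^1)^k y = (J^1)^k J^a' y belongs to 0C^(k-1). *)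
Theorem RLspace_sub_zeroW s a p T : 0 <= s -> s < a -> 1 <= p -> 0 < T ->
  RLspace a p T `<=` zeroW s p T.
Proof.
move=> s0 sa p1 T0 u [Lu [v0 Lv0 vu0]]; have p0 : 0 < p by exact: lt_le_trans p1.
have mu0 := ((LpP T u p0).1 Lu).1.
pose v := v0 \_ (I0 T); have Lv : mLp p T v := Lp_mLp p0 Lv0.
have vu : eq_ae0T T (RLint a v) u.
  have H := RLint_restrict a ((LpP T v0 p0).1 Lv0).1.
  by apply: filterS vu0 => x Hx Dx; rewrite -H ?inE// Hx.
have [C C0 HC] := RLint_slobodecki_bound s0 sa p1 T0.
split; first exact: (HC v Lv u mu0 vu).1.
(* Half of the gap pays for the density argument, while a' still exceeds s. *)
move=> e e0; pose b := (a - s) / 2; pose a' := a - b.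
have b0 : 0 < b by rewrite divr_gt0// subr_gt0.
have sa' : s < a' by rewrite /a' /b; lra.
have a'0 : 0 < a' by exact: le_lt_trans sa'.
have [C' C'0 HC'] := RLint_slobodecki_bound s0 sa' p1 T0.
have e2 : 0 < e / 2 by rewrite divr_gt0.
have [eta eta0 heta] := mul_small (ltW C'0) e2.
have eta1 : 0 < eta `^ p by rewrite powR_gt0.
have [y Ly Ey] := RLint_dense (smoothness s).+1 b0 p1 T0 Lv eta1.
have Ly1 := mLp1 p1 T0 Ly.
exists (iter (smoothness s).+1 (RLint 1) (RLint a' y)).
  exact: (zeroC_iter_RLint1 _ T0 (mLp_RLint a'0 (lexx _) T0 Ly1)).
have comm k := RLint_iter_RLint1 k a'0 T0 Ly1.
set k := (smoothness s).+1 in Ey *.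
have Lk := mLp_iter_RLint1 k p1 T0 Ly.
have Lb := mLp_RLint b0 p1 T0 Lv.
have Lx := mLpB (ltW p0) Lb Lk.
have ux : eq_ae0T T (RLint a' (fun t => RLint b v t - iter k (RLint 1) y t))
    (u \- iter k (RLint 1) (RLint a' y)).
  have H1 := RLintB_ae a'0 T0 (mLp1 p1 T0 Lb) (mLp1 p1 T0 Lk).
  have H2 := RLint_semigroup a'0 b0 T0 (mLp1 p1 T0 Lv).
  rewrite subrK in H2.
  have H12 := ae_imply2 H1 H2 (fun _ _ => @conj _ _).
  have H34 := ae_imply2 (comm k) vu (fun _ _ => @conj _ _).
  apply: (ae_imply2 H12 H34) => t Dt [h1 h2] [h3 h4].
  by rewrite h1 h2 h4 -h3.
have mux : measurable_fun (I0 T) (u \- iter k (RLint 1) (RLint a' y)).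
  apply: measurable_funB => //; apply: measurable_funTS.
  exact: (mLp_iter_RLint1 k (lexx _) T0 (mLp_RLint a'0 (lexx _) T0 Ly1)).1.
apply: le_lt_trans (HC' _ Lx _ mux ux).2 _.
apply: (@le_lt_trans _ _ (C' * eta)%:E).
  rewrite EFinM; apply: lee_wpmul2l; first by rewrite lee_fin ltW.
  rewrite Lp_normE ?gt_eqF//.
  have -> : eta%:E = ((eta `^ p)%:E `^ p^-1)%E.
    by rewrite poweR_EFin -powRrM mulfV ?gt_eqF// powRr1// ltW.
  apply: gt0_ler_poweR => //; first by rewrite invr_ge0 ltW.
    by rewrite in_itv/= leey andbT energy_ge0.
  by rewrite in_itv/= leey andbT lee_fin ltW.
by rewrite lte_fin (le_lt_trans heta)// ltr_pdivrMr// mulr_natr mulr2n ltrDl.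
Qed.

End density.

(** * A Hardy inequality controlled by the Gagliardo seminorm *)

Section hardy.
Context {R : realType}.
Local Notation mu := (@lebesgue_measure R).
Local Notation I0 T := (`]0%R, T[%classic : set R).
Implicit Types (p q T theta : R) (f : R -> R).

(** Convexity with weights m and 1 - m gives a = m/m^p. Taking m^p = c with rho < c < 1 makes a rho
    = m rho/c < 1, so the dilation factor rho outweighs a. *)
Lemma powRD_convex p rho : 1 <= p -> 0 < rho -> rho < 1 ->
  exists a b : R, [/\ 0 <= a, 0 <= b, a * rho < 1 &
    forall x y, 0 <= x -> 0 <= y -> (x + y) `^ p <= a * x `^ p + b * y `^ p].
Proof.
move=> p1 r0 r1; have p0 : 0 < p by exact: lt_le_trans p1.
pose c := (1 + rho) / 2; have c0 : 0 < c by rewrite /c; lra.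
have c1 : c < 1 by rewrite /c; lra.
have rc : rho < c by rewrite /c; lra.
pose m := c `^ p^-1; have m0 : 0 < m by rewrite powR_gt0.
have m1 : m < 1.
  suff : m < 1 `^ p^-1 by rewrite powR1.
  apply: gt0_ltr_powR; rewrite ?invr_gt0 ?nnegrE ?ler01 ?(ltW c0)//.
have mp : m `^ p = c by rewrite -powRrM mulVf ?gt_eqF// powRr1// ltW.
have n0 : 0 < 1 - m by rewrite subr_gt0.
exists (m * (m `^ p)^-1), ((1 - m) * ((1 - m) `^ p)^-1); split.
- by rewrite mulr_ge0 ?invr_ge0 ?powR_ge0// ltW.
- by rewrite mulr_ge0 ?invr_ge0 ?powR_ge0// ltW.
- rewrite mp mulrAC ltr_pdivrMr// mul1r (lt_trans _ rc)// -[ltRHS]mul1r.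
  by rewrite ltr_pM2r.
move=> x y x0 y0.
have mm : 0 <= m <= 1 by rewrite !ltW.
have := convex_powR p1 (Itv01 (ltW m0) (ltW m1)).
move=> /(_ (x / m) (y / (1 - m))); rewrite !inE/= !in_itv/= !andbT.
rewrite !divr_ge0 ?(ltW m0) ?(ltW n0)// => /(_ isT isT).
rewrite convRE [X in X `^ _ <= _ -> _]convRE/=.
rewrite -[unstable.onem m]/(1 - m) (mulrC m (x / m)) (mulrC (1 - m) (y / (1 - m))).
rewrite !divfK ?gt_eqF//.
have E (z d : R) : 0 <= z -> 0 < d -> d * (z / d) `^ p = d / d `^ p * z `^ p.
  move=> z0 d0; rewrite powRM ?invr_ge0 ?(ltW d0)//.
  by rewrite -powR_inv1 ?(ltW d0)// powRAC powR_inv1 ?powR_ge0// mulrCA mulrC.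
by rewrite !E.
Qed.

(** Finiteness of H is what allows kH to be subtracted. *)
Lemma ereal_absorb (H Z : \bar R) (k : R) : (0 <= H)%E -> (H < +oo)%E ->
  (0 <= Z)%E -> 0 <= k -> k < 1 ->
  (H <= k%:E * H + Z)%E -> (H <= (1 - k)^-1%:E * Z)%E.
Proof.
move=> H0 Hoo Z0 k0 k1; have k10 : 0 < 1 - k by rewrite subr_gt0.
case: Z Z0 => [z| |]//; last by rewrite gt0_muley ?leey// lte_fin invr_gt0.
case: H H0 Hoo => [h| |]// _ _ _; rewrite -!EFinM -EFinD !lee_fin => H.
by rewrite ler_pdivlMl//; lra.
Qed.

Let pw p q f t := t `^ (- q) * `|f t| `^ p.

Let pw_ge0 p q f t : 0 <= pw p q f t.
Proof.
by rewrite mulr_ge0 ?powR_ge0.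
Qed.

Let measurable_pw0 p q f : measurable_fun setT f ->
  measurable_fun setT (fun t : R => (pw p q f t)%:E).
Proof.
move=> mf; apply/measurable_EFinP; apply: measurable_funM; first exact: measurable_powR.
by apply: measurable_powR_comp; apply: measurableT_comp.
Qed.

(** The substitution s = l t; the factor l^(q-1) is the gain that drives the Hardy inequality. *)
Let scaling p q f (l L : R) : 0 < l -> 0 < L -> measurable_fun setT f ->
  (\int[mu]_(t in I0 L) (t `^ (- q) * `|f (l * t)| `^ p)%:E =
   (l `^ (q - 1))%:E * \int[mu]_(s in I0 (l * L)%R) (pw p q f s)%:E)%E.
Proof.
move=> l0 L0 mf.
have mr : measurable_fun setT ((fun s => (pw p q f s)%:E) \_ (I0 (l * L))).
  apply/(measurable_restrictT _ (measurable_itv _)); apply: measurable_funTS.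
  exact: measurable_pw0.
have r0 s : (0 <= ((fun s => (pw p q f s)%:E) \_ (I0 (l * L)%R)) s)%E.
  by apply: erestrict_ge0 => y _; rewrite lee_fin pw_ge0.
rewrite [X in (_ * X)%E]integral_mkcond -(ge0_integral_affine 0 l0 mr r0).
rewrite -[X in (_ * (_ * X))%E]/(\int[mu]_x _)%E muleA -EFinM.
have E : l `^ (q - 1) * l = l `^ q.
  by rewrite -{2}(powRr1 (ltW l0)) -powRD ?subrK// (gt_eqF l0) implybT.
rewrite E -ge0_integralZl//; last 2 first.
- apply: (measurableT_comp mr); apply: measurable_funD => //; exact: measurable_funM.
- by rewrite lee_fin powR_ge0.
rewrite [LHS]integral_mkcond; apply: eq_integral => t _.
rewrite addr0 !patchE !mem_setE !in_itv/= pmulr_rgt0// ltr_pM2l//.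
case: ifPn => [/andP[t0 _]|_]; last by rewrite mule0.
rewrite -EFinM /pw powRM ?(ltW l0) ?(ltW t0)// mulrA mulrA -powRD ?subrr ?(gt_eqF l0) ?implybT//.
by rewrite powRr0 mul1r.
Qed.

Let cut p q T f (L : R) : 0 < L -> 0 <= q -> measurable_fun setT f ->
  (\int[mu]_(t in I0 T) (pw p q f t)%:E <=
   \int[mu]_(t in I0 L) (pw p q f t)%:E + (L `^ (- q))%:E * energy p T f)%E.
Proof.
move=> L0 q0 mf.
have mw := measurable_pw0 p q mf.
have me : measurable_fun (I0 T) (fun t => (`|f t| `^ p)%:E).
  by apply: measurable_energy; exact: measurable_funTS.
rewrite /energy -ge0_integralZl//; last by rewrite lee_fin powR_ge0.
rewrite [leLHS]integral_mkcond [X in (_ <= X + _)%E]integral_mkcond [X in (_ <= _ + X)%E]integral_mkcond.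
rewrite -ge0_integralD//.
- apply: ge0_le_integral => //.
  + by move=> t _; apply: erestrict_ge0 => s _; rewrite lee_fin pw_ge0.
  + exact/(measurable_restrictT _ (measurable_itv _))/measurable_funTS.
  + apply: emeasurable_funD.
      exact/(measurable_restrictT _ (measurable_itv _))/measurable_funTS.
    by apply/(measurable_restrictT _ (measurable_itv _)); exact: measurable_funeM.
  move=> t _; rewrite !patchE !mem_setE !in_itv/=.
  case: ifPn => [/andP[t0 tT]|_]; last first.
    by rewrite adde0; case: ifP => // _; rewrite lee_fin pw_ge0.
  rewrite t0/=; case: (ltP t L) => tL.
    by rewrite leeDl// mule_ge0// lee_fin powR_ge0.
  rewrite add0e -EFinM lee_fin ler_wpM2r ?powR_ge0// !powRN lef_pV2 ?posrE ?powR_gt0//.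
  by apply: ler_powR_base => //; exact: ltW.
- by move=> t _; apply: erestrict_ge0 => s _; rewrite lee_fin pw_ge0.
- exact/(measurable_restrictT _ (measurable_itv _))/measurable_funTS.
- by move=> t _; apply: erestrict_ge0 => s _; rewrite mule_ge0// lee_fin powR_ge0.
- by apply/(measurable_restrictT _ (measurable_itv _)); exact: measurable_funeM.
Qed.

(** The weighted energy of the difference between f and its dilation by l. *)
Let K p q f (L l : R) : \bar R :=
  (\int[mu]_(t in I0 L) (t `^ (- q) * `|f (l * t) - f t| `^ p)%:E)%E.

(** Integration over l turns the dilation difference into a double integral in t and s = l t. Since
    0 < s < 4t, one has |s - t| <= 3t, so the weight t^(-q-1) is at most a constant times |s -
    t|^(-1 - theta p). The alternative on x keeps s away from t. *)
Let averaging p q T theta f (x L : R) : 0 < T -> 0 < p -> 0 < theta ->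
  q <= theta * p -> 0 <= q ->
  0 < x -> x <= 2 -> (2 * x <= 1) || (1 <= x) -> 0 < L -> L <= T -> 2 * x * L <= T ->
  measurable_fun setT f ->
  (\int[mu]_(l in `]x, (2 * x)%R[) K p q f L l <=
   (3 `^ (1 + theta * p) * T `^ (theta * p - q))%:E * gagliardo theta p T f)%E.
Proof.
move=> T0 p0 th0 qth q0 x0 x2 x1 L0 LT xLT mf.
have mK : measurable_fun [set: R * R]
    (fun z => (z.2 `^ (- q) * `|f (z.1 * z.2) - f z.2| `^ p)%:E).
  apply/measurable_EFinP; apply: measurable_funM.
    exact: (measurableT_comp (measurable_powR (- q)) measurable_snd).
  apply: measurable_powR_comp; apply: measurableT_comp => //.
  apply: measurable_funB.
    apply: (measurableT_comp mf); exact: (measurable_funM measurable_fst measurable_snd).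
  exact: (measurableT_comp mf measurable_snd).
rewrite /K (@tonelli_on _ _ _ (fun l t => (t `^ (- q) * `|f (l * t) - f t| `^ p)%:E))//; last first.
  by move=> l t; rewrite lee_fin mulr_ge0 ?powR_ge0.
set C := 3 `^ _ * _; have C0 : 0 <= C by rewrite mulr_ge0 ?powR_ge0.
pose g t s : \bar R := (`|f s - f t| `^ p / `|s - t| `^ (1 + theta * p))%:E.
have mg : measurable_fun [set: R * R] (fun z => g z.1 z.2) := measurable_gagliardo theta p mf.
have g0 t s : (0 <= g t s)%E by rewrite lee_fin divr_ge0 ?powR_ge0.
have mgt t : measurable_fun setT (g t) by exact: (measurableT_comp mg (pair1_measurable t)).
have mG : measurable_fun setT (fun t => \int[mu]_(s in I0 T) g t s)%E.
  exact: measurable_tonelli_on.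
rewrite /gagliardo -[X in (_ <= _ * X)%E]/(\int[mu]_(t in I0 T) \int[mu]_(s in I0 T) g t s)%E.
apply: (@le_trans _ _ (\int[mu]_(t in I0 L) (C%:E * \int[mu]_(s in I0 T) g t s))%E); last first.
  rewrite -ge0_integralZl//; last 2 first.
  - exact: measurable_funTS.
  - by move=> t _; exact: integral_ge0.
  apply: ge0_subset_integral => //.
  - by apply: measurable_funTS; exact: measurable_funeM.
  - by move=> t _; rewrite mule_ge0// integral_ge0.
  - by move=> t /=; rewrite !in_itv/= => /andP[-> /lt_le_trans ->].
apply: ge0_le_integral => //.
- by move=> t _; apply: integral_ge0 => l _; rewrite lee_fin mulr_ge0 ?powR_ge0.
- apply: measurable_funTS.
  apply: (@measurable_tonelli_on _ _ (fun t l => (t `^ (- q) * `|f (l * t) - f t| `^ p)%:E)) => //.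
    exact: (measurableT_comp mK (@measurable_swap _ _ R R)).
  by move=> l t; rewrite lee_fin mulr_ge0 ?powR_ge0.
- by apply: measurable_funTS; exact: measurable_funeM.
move=> t; rewrite /= in_itv/= => /andP[t0 tL].
pose h s : \bar R := (t `^ (- q) * `|f s - f t| `^ p)%:E.
pose B : set R := `](x * t)%R, (2 * x * t)%R[%classic.
have mh : measurable_fun setT h.
  apply/measurable_EFinP; apply: measurable_funM => //; apply: measurable_powR_comp.
  by apply: measurableT_comp => //; exact: (measurable_funB mf (measurable_cst (f t))).
have mhB : measurable_fun setT (h \_ B).
  exact/(measurable_restrictT _ (measurable_itv _))/measurable_funTS.
have h0 s : (0 <= (h \_ B) s)%E.
  by apply: erestrict_ge0 => y _; rewrite lee_fin mulr_ge0 ?powR_ge0.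
have -> : (\int[mu]_(l in `]x, (2 * x)%R[) (t `^ (- q) * `|f (l * t) - f t| `^ p)%:E =
    t^-1%:E * \int[mu]_s (h \_ B) s)%E.
  rewrite -(ge0_integral_affine 0 t0 mhB h0) muleA -EFinM mulVf ?gt_eqF// mul1e.
  rewrite integral_mkcond; apply: eq_integral => l _.
  rewrite addr0 !patchE !mem_setE !in_itv/= (mulrC t l) !ltr_pM2r//.
rewrite -ge0_integralZl//; last by rewrite lee_fin invr_ge0 ltW.
rewrite -ge0_integralZl//; last first.
  exact: (measurable_funTS (mgt t)).
rewrite [leRHS]integral_mkcond; apply: ge0_le_integral => //.
- by move=> s _; rewrite mule_ge0// lee_fin invr_ge0 ltW.
- exact: measurable_funeM.
- apply/(measurable_restrictT _ (measurable_itv _))/measurable_funTS.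
  exact: measurable_funeM.
move=> s _; rewrite [(h \_ B) s]patchE mem_setE in_itv/=; case: ifPn => [/andP[xs sx]|_]; last first.
  by rewrite mule0; apply: erestrict_ge0 => y _; rewrite mule_ge0.
have s0 : 0 < s by rewrite (lt_trans _ xs)// mulr_gt0.
have sT : s < T.
  rewrite (lt_le_trans sx)// (le_trans _ xLT)// ler_pM2l ?mulr_gt0// ltW//.
rewrite patchE mem_setE in_itv/= s0 sT /h /g -!EFinM lee_fin mulrCA (mulrCA C).
rewrite mulrA (mulrC _ (`|f s - f t| `^ p)) ler_wpM2l ?powR_ge0//.
have st0 : 0 < `|s - t|.
  rewrite normr_gt0 subr_eq0; apply/eqP => st; case/orP: x1 => x1.
    have : 2 * x * t <= t by rewrite -[leRHS]mul1r ler_pM2r.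
    by rewrite leNgt -{1}st sx.
  have : t <= x * t by rewrite -[leLHS]mul1r ler_pM2r.
  by rewrite leNgt -{2}st xs.
have st3 : `|s - t| <= 3 * t.
  rewrite ler_norml; apply/andP; split; first by lra.
  have : 2 * x * t <= 4 * t by rewrite ler_pM2r//; lra.
  by move: sx; lra.
rewrite ler_pdivlMr ?powR_gt0//.
have e0 : 0 <= 1 + theta * p by rewrite addr_ge0// mulr_ge0// ltW.
have t0' : 0 <= t^-1 * t `^ (- q) by rewrite mulr_ge0 ?powR_ge0// invr_ge0 ltW.
apply: (@le_trans _ _ (t^-1 * t `^ (- q) * (3 * t) `^ (1 + theta * p))).
  by rewrite (mulrC (t `^ _)) ler_wpM2l//; apply: ler_powR_base => //; exact: ltW.
rewrite powRM ?(ltW t0)// mulrCA /C ler_wpM2l ?powR_ge0//.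
have tn q' q'' : t `^ q' * t `^ q'' = t `^ (q' + q'').
  by rewrite powRD// (gt_eqF t0) implybT.
have -> : t^-1 = t `^ (- 1) by rewrite powRN powRr1// ltW.
rewrite !tn; have -> : -1 + - q + (1 + theta * p) = theta * p - q by ring.
by apply: ler_powR_base; [rewrite subr_ge0|exact: ltW|exact: ltW (lt_le_trans tL LT)].
Qed.

Let hardy_cut p q T theta (x L rho : R) : 0 < T -> 1 <= p -> 0 < theta ->
  0 < q -> q <= theta * p -> q < p ->
  0 < x -> x <= 2 -> (2 * x <= 1) || (1 <= x) -> 0 < L -> L <= T -> 2 * x * L <= T ->
  0 < rho -> rho < 1 -> (forall l, x < l -> l < 2 * x -> l `^ (q - 1) <= rho) ->
  exists2 C : R, 0 <= C & forall f (M : R), measurable_fun setT f ->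
    (forall t, 0 < t -> t < T -> `|f t| <= M * t) ->
    (\int[mu]_(t in I0 T) (t `^ (- q) * `|f t| `^ p)%:E <=
     C%:E * (energy p T f + gagliardo theta p T f))%E.
Proof.
move=> T0 p1 th0 q0 qth qp x0 x2 x1 L0 LT xLT r0 r1 Hrho.
have p0 : 0 < p by exact: lt_le_trans p1.
have [a [b [a0 b0 ar Hab]]] := powRD_convex p1 r0 r1.
pose C1 := 3 `^ (1 + theta * p) * T `^ (theta * p - q).
have C10 : 0 <= C1 by rewrite mulr_ge0 ?powR_ge0.
pose k := a * rho; have k0 : 0 <= k by rewrite mulr_ge0// ltW.
have k10 : 0 <= (1 - k)^-1 by rewrite invr_ge0 subr_ge0 ltW.
pose D := L `^ (- q) + b * C1 / x.
have bC : 0 <= b * C1 / x by rewrite divr_ge0 ?(ltW x0)// mulr_ge0.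
have D0 : 0 <= D by rewrite addr_ge0 ?powR_ge0.
exists ((1 - k)^-1 * D + L `^ (- q)).
  by rewrite addr_ge0 ?powR_ge0// mulr_ge0.
move=> f M mf HM; set E := energy p T f; set G := gagliardo theta p T f.
have E0 : (0 <= E)%E by exact: energy_ge0.
have G0 : (0 <= G)%E by exact: gagliardo_ge0.
pose H S := (\int[mu]_(t in I0 S) (pw p q f t)%:E)%E.
have H0 S : (0 <= H S)%E by apply: integral_ge0 => t _; rewrite lee_fin pw_ge0.
have mw := measurable_pw0 p q mf.
have HS S S' : S <= S' -> (H S <= H S')%E.
  move=> SS'; apply: ge0_subset_integral => //.
  - exact: measurable_funTS.
  - by move=> t _; rewrite lee_fin pw_ge0.
  - by move=> t /=; rewrite !in_itv/= => /andP[-> /lt_le_trans ->].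
(* The only use of |f(t)| <= M t: with q < p it makes the weighted energy finite, so that it can be
   absorbed, and M does not enter the constant. *)
have Hoo : (H T < +oo)%E.
  apply: (@le_lt_trans _ _ (\int[mu]_(t in I0 T) (cst (`|M| `^ p * T `^ (p - q))%:E) t)%E).
    apply: ge0_le_integral => //.
    - by move=> t _; rewrite lee_fin pw_ge0.
    - exact: measurable_funTS.
    move=> t; rewrite /= in_itv/= => /andP[t0 tT]; rewrite lee_fin /pw.
    apply: (@le_trans _ _ (t `^ (- q) * (`|M| * t) `^ p)).
      rewrite ler_wpM2l ?powR_ge0//; apply: ler_powR_base; rewrite ?(ltW p0)//.
      by apply: le_trans (HM t t0 tT) _; rewrite ler_pM2r// ler_norm.
    rewrite powRM ?(ltW t0)// mulrCA ler_wpM2l ?powR_ge0//.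
    rewrite -powRD ?(gt_eqF t0) ?implybT// addrC.
    by apply: ler_powR_base; [rewrite subr_ge0 ltW|exact: ltW|exact: ltW].
  rewrite integral_cst//= lebesgue_measure_itv/= lte_fin T0 -EFinB -EFinM.
  by rewrite ltry.
have HTL : (H T <= H L + (L `^ (- q))%:E * E)%E by apply: cut => //; exact: ltW.
have HLoo : (H L < +oo)%E by exact: le_lt_trans (HS _ _ LT) Hoo.
have avg := averaging T0 p0 th0 qth (ltW q0) x0 x2 x1 L0 LT xLT mf.
have mdil (l : R) : measurable_fun setT (fun t : R => f (l * t)).
  by apply: (measurableT_comp mf); exact: measurable_funM.
have step l : x < l -> l < 2 * x ->
    (H L <= k%:E * H T + b%:E * K p q f L l)%E.
  move=> xl lx; have l0 : 0 < l by exact: lt_trans xl.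
  have m1 : measurable_fun setT (fun t : R => (t `^ (- q) * `|f (l * t)| `^ p)%:E).
    apply/measurable_EFinP; apply: measurable_funM; first exact: measurable_powR.
    by apply: measurable_powR_comp; apply: measurableT_comp.
  have m2 : measurable_fun setT (fun t : R => (t `^ (- q) * `|f (l * t) - f t| `^ p)%:E).
    apply/measurable_EFinP; apply: measurable_funM; first exact: measurable_powR.
    by apply: measurable_powR_comp; apply: measurableT_comp => //; exact: measurable_funB (mdil l) mf.
  apply: (@le_trans _ _ (a%:E * (\int[mu]_(t in I0 L) (t `^ (- q) * `|f (l * t)| `^ p)%:E) +
      b%:E * K p q f L l)%E).
    rewrite /K -!ge0_integralZl//; last 4 first.
    - exact: measurable_funTS.
    - by move=> t _; rewrite lee_fin mulr_ge0 ?powR_ge0.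
    - exact: measurable_funTS.
    - by move=> t _; rewrite lee_fin mulr_ge0 ?powR_ge0.
    rewrite -ge0_integralD//; last 4 first.
    - by move=> t _; rewrite mule_ge0// lee_fin mulr_ge0 ?powR_ge0.
    - by apply: measurable_funTS; exact: measurable_funeM.
    - by move=> t _; rewrite mule_ge0// lee_fin mulr_ge0 ?powR_ge0.
    - by apply: measurable_funTS; exact: measurable_funeM.
    apply: ge0_le_integral => //.
    - by move=> t _; rewrite lee_fin pw_ge0.
    - exact: measurable_funTS.
    - by apply: measurable_funTS; apply: emeasurable_funD; exact: measurable_funeM.
    move=> t _; rewrite -!EFinM -EFinD lee_fin /pw (mulrCA a) (mulrCA b) -mulrDr.
    rewrite ler_wpM2l ?powR_ge0//; apply: le_trans (Hab _ _ _ _) => //.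
    apply: ler_powR_base; rewrite ?(ltW p0)//.
    by rewrite distrC -{1}(subrKC (f (l * t)) (f t)); exact: ler_normD.
  apply: leeD2r; rewrite scaling// muleA -EFinM; apply: (@le_trans _ _ (k%:E * H (l * L)%R)%E).
    by apply: lee_wpmul2r; [exact: H0|rewrite lee_fin ler_wpM2l// Hrho].
  apply: lee_wpmul2l; first by rewrite lee_fin.
  by apply: HS; apply: le_trans xLT; rewrite ler_pM2r// ltW.
have mKf : measurable_fun setT (K p q f L).
  apply: (@measurable_tonelli_on _ _ (fun l t => (t `^ (- q) * `|f (l * t) - f t| `^ p)%:E)) => //.
    apply/measurable_EFinP; apply: measurable_funM.
      exact: (measurableT_comp (measurable_powR (- q)) measurable_snd).
    apply: measurable_powR_comp; apply: measurableT_comp => //.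
    apply: measurable_funB.
      apply: (measurableT_comp mf); exact: (measurable_funM measurable_fst measurable_snd).
    exact: (measurableT_comp mf measurable_snd).
  by move=> l t; rewrite lee_fin mulr_ge0 ?powR_ge0.
have K0 l : (0 <= K p q f L l)%E.
  by apply: integral_ge0 => t _; rewrite lee_fin mulr_ge0 ?powR_ge0.
have xx : x < 2 * x by rewrite mulr_natl mulr2n ltrDl.
have muL : mu (`]x, 2 * x[%classic : set R) = x%:E.
  by rewrite lebesgue_measure_itv/= lte_fin xx -EFinB; congr EFin; ring.
(* The estimate for each l, integrated over ]x, 2x[, an interval of length x. *)
have int : (x%:E * H L <= x%:E * (k%:E * H T) + (b * C1)%:E * G)%E.
  have c1 (c : \bar R) : (x%:E * c = \int[mu]_(l in `]x, (2 * x)%R[) (cst c) l)%E.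
    by rewrite integral_cst//= muL muleC.
  rewrite (c1 (H L)) (c1 (k%:E * H T)%E).
  apply: (@le_trans _ _ (\int[mu]_(l in `]x, (2 * x)%R[) (cst (k%:E * H T) l + b%:E * K p q f L l))%E).
    apply: ge0_le_integral => //.
    - by move=> l _; exact: H0.
    - by apply: measurable_funTS; apply: emeasurable_funD => //; exact: measurable_funeM.
    - by move=> l; rewrite /= in_itv/= => /andP[xl lx]; exact: step.
  rewrite ge0_integralD//; last 3 first.
  - by move=> l _; rewrite /cst mule_ge0.
  - by move=> l _; rewrite mule_ge0.
  - by apply: measurable_funTS; exact: measurable_funeM.
  apply: leeD2l; rewrite ge0_integralZl//; last exact: measurable_funTS.
  by rewrite EFinM -muleA; apply: lee_wpmul2l.
have int' : (H L <= k%:E * H T + (b * C1 / x)%:E * G)%E.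
  have -> : H L = (x^-1%:E * (x%:E * H L))%E by rewrite muleA -EFinM mulVf ?mul1e// gt_eqF.
  apply: le_trans (lee_wpmul2l _ int) _; first by rewrite lee_fin invr_ge0 ltW.
  rewrite ge0_muleDr; last 2 first.
  - by rewrite mule_ge0 ?lee_fin ?(ltW x0)// mule_ge0 ?lee_fin.
  - by rewrite mule_ge0// lee_fin mulr_ge0.
  rewrite !muleA -!EFinM mulVf ?gt_eqF// mul1r.
  by rewrite (mulrC x^-1 (b * C1)).
have key : (H L <= (1 - k)^-1%:E * (D%:E * (E + G)))%E.
  apply: ereal_absorb => //; first by apply: mule_ge0; [rewrite lee_fin|exact: adde_ge0].
  apply: le_trans int' _; apply: (@le_trans _ _ (k%:E * (H L + (L `^ (- q))%:E * E) + (b * C1 / x)%:E * G)%E).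
    by apply: leeD2r; apply: lee_wpmul2l.
  rewrite ge0_muleDr ?mule_ge0 ?lee_fin ?powR_ge0// -addeA; apply: leeD2l.
  rewrite [leRHS]ge0_muleDr//; apply: leeD.
    rewrite muleA -EFinM; apply: lee_wpmul2r => //; rewrite lee_fin /D.
    apply: (@le_trans _ _ (1 * L `^ (- q))); last by rewrite mul1r lerDl.
    by rewrite ler_wpM2r ?powR_ge0// ltW.
  by apply: lee_wpmul2r => //; rewrite lee_fin /D lerDr powR_ge0.
apply: le_trans HTL _; rewrite EFinD ge0_muleDl ?adde_ge0//; last 2 first.
- by rewrite lee_fin mulr_ge0.
- by rewrite lee_fin powR_ge0.
apply: leeD; first by rewrite EFinM -muleA.
by apply: lee_wpmul2l; [rewrite lee_fin powR_ge0|rewrite leeDl].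
Qed.

(* A Hardy inequality with a loss: |f(t)| is compared with |f(lt)|, where l
   ranges over (1/4, 1/2) if q > 1 and over (2, 4) if q < 1, so that the change
   of variables s = lt produces a factor l^(q-1) smaller than 1. *)
Lemma hardy_inequality p q T theta : 0 < T -> 1 <= p -> 0 < theta ->
  0 < q -> q < theta * p -> theta < 1 ->
  exists2 C : R, 0 <= C & forall f (M : R), measurable_fun setT f ->
    (forall t, 0 < t -> t < T -> `|f t| <= M * t) ->
    (\int[mu]_(t in I0 T) (t `^ (- q) * `|f t| `^ p)%:E <=
     C%:E * (energy p T f + gagliardo theta p T f))%E.
Proof.
move=> T0 p1 th0 q0 qth th1; have p0 : 0 < p by exact: lt_le_trans p1.
have thp : theta * p < p by rewrite -[ltRHS]mul1r ltr_pM2r.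
have qp : q < p by exact: lt_trans thp.
(* For q = 1 a dilation gains nothing. As q < theta p, there is room for a larger exponent q', and
   t^(-q) <= T^(q'-q) t^(-q'). *)
wlog qn1 : q q0 qth qp / q != 1.
  move=> wl; have [q1|] := eqVneq q 1; last exact: wl.
  pose q' := (q + theta * p) / 2.
  have qq' : q < q' by rewrite /q'; lra.
  have q'th : q' < theta * p by rewrite /q'; lra.
  have [||C C0 HC] := wl q' _ q'th (lt_trans q'th thp).
  - exact: lt_trans qq'.
  - by rewrite -q1 gt_eqF.
  exists (T `^ (q' - q) * C); first by rewrite mulr_ge0 ?powR_ge0.
  move=> f M mf HM; rewrite EFinM -muleA.
  apply: le_trans (lee_wpmul2l _ (HC f M mf HM)); last by rewrite lee_fin powR_ge0.
  have mw r := measurable_pw0 p r mf.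
  rewrite -ge0_integralZl//; last 3 first.
  - exact: measurable_funTS (mw _).
  - by move=> t _; rewrite lee_fin pw_ge0.
  - by rewrite lee_fin powR_ge0.
  apply: ge0_le_integral => //.
  - by move=> t _; rewrite lee_fin pw_ge0.
  - exact: measurable_funTS (mw _).
  - by apply: measurable_funTS; apply: measurable_funeM; exact: mw.
  move=> t; rewrite /= in_itv/= => /andP[t0 tT]; rewrite -EFinM lee_fin mulrA.
  rewrite ler_wpM2r ?powR_ge0//; apply: (@le_trans _ _ (t `^ (q' - q) * t `^ (- q'))).
    rewrite -powRD ?(gt_eqF t0) ?implybT//.
    by have -> : q' - q + - q' = - q by ring.
  rewrite ler_wpM2r ?powR_ge0//.
  by apply: ler_powR_base; [rewrite subr_ge0 ltW|exact: ltW|exact: ltW].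
have [q1|q1|/eqP] := ltgtP q 1; last by rewrite (negbTE qn1).
- have r1 : (2 : R) `^ (q - 1) < 1.
    have -> : q - 1 = - (1 - q) by rewrite opprB.
    rewrite powRN invf_lt1 ?powR_gt0//.
    suff : (1 : R) `^ (1 - q) < 2 `^ (1 - q) by rewrite powR1.
    by apply: gt0_ltr_powR; rewrite ?subr_gt0 ?nnegrE// ltr1n.
  (* Dilating by up to 4 stays inside (0,T) only from (0, T/4). *)
  apply: (@hardy_cut p q T theta 2 (T / 4) (2 `^ (q - 1))) => //.
  + exact: ltW.
  + by apply/orP; right; rewrite ler1n.
  + by rewrite divr_gt0.
  + lra.
  + lra.
  + move=> l l2 _; have -> : q - 1 = - (1 - q) by rewrite opprB.
    have l0 : 0 < l by exact: lt_trans l2.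
    rewrite !powRN lef_pV2 ?posrE ?powR_gt0//.
    by apply: ler_powR_base; rewrite ?subr_ge0// ltW.
- have r1 : (2^-1 : R) `^ (q - 1) < 1.
    suff : (2^-1 : R) `^ (q - 1) < 1 `^ (q - 1) by rewrite powR1.
    apply: gt0_ltr_powR; rewrite ?subr_gt0 ?nnegrE//.
    by rewrite invf_lt1// ltr1n.
  apply: (@hardy_cut p q T theta 4^-1 T (2^-1 `^ (q - 1))) => //.
  + exact: ltW.
  + lra.
  + by apply/orP; left; lra.
  + lra.
  + move=> l l2 l4; have l0 : 0 < l by apply: lt_trans l2.
    apply: ler_powR_base; [by rewrite subr_ge0 ltW|exact: ltW|lra].
Qed.

End hardy.

(** * Marchaud's formula *)

Section marchaud.
Context {R : realType}.
Local Notation mu := (@lebesgue_measure R).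
Local Notation I0 T := (`]0%R, T[%classic : set R).
Implicit Types (p q T theta sigma : R) (f g : R -> R).

(** Provides the bound M t under which the Hardy inequality is stated. *)
Lemma RLint1_lipschitz0 T g (M : R) t : mLp 1 T g -> 0 < t -> t < T ->
  (forall s, 0 < s -> s < T -> `|g s| <= M) -> `|RLint 1 g t| <= M * t.
Proof.
move=> Lg t0 tT HM; rewrite RLint1E -lee_fin.
have mg : measurable_fun (I0 t) g by exact: measurable_funTS Lg.1.
apply: le_trans (le_Rintegral_abs (measurable_itv _) mg) _.
apply: (@le_trans _ _ (\int[mu]_(x in I0 t) (cst M%:E) x)%E).
  apply: ge0_le_integral => //.
  - by apply/measurable_EFinP; exact: measurableT_comp.
  - move=> s; rewrite /= in_itv/= => /andP[s0 st].
    by rewrite lee_fin HM// (lt_trans st).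
rewrite integral_cst//= lebesgue_measure_itv/= lte_fin t0 -EFinB -EFinM subr0.
by [].
Qed.

(* Integration by parts in the Marchaud form of the fractional derivative;
   proved by Fubini from f(t) - f(s) = \int_s^t g. *)
Lemma marchaud sigma T g (M : R) t : 0 < sigma -> sigma < 1 ->
  measurable_fun setT g -> mLp 1 T g ->
  (forall s, 0 < s -> s < T -> `|g s| <= M) -> 0 < t -> t < T ->
  (`|RLint (1 - sigma) g t|%:E <= (Gamma (1 - sigma))^-1%:E *
    ((t `^ (- sigma) * `|RLint 1 g t|)%:E +
     sigma%:E * \int[mu]_(s in I0 T) (rk (- sigma) (t - s) * `|RLint 1 g t - RLint 1 g s|)%:E))%E.
Proof.
move=> s0 s1 mg Lg HM t0 tT; have c0 : 0 < 1 - sigma by rewrite subr_gt0.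
have T0 : 0 < T by exact: lt_trans tT.
have mgT : measurable_fun (I0 T) g by exact: measurable_funTS.
have mgt : measurable_fun (I0 t) g by exact: measurable_funTS.
have M0 : 0 <= M by rewrite (le_trans _ (HM t t0 tT)).
set f := RLint 1 g.
have G0 : 0 <= (Gamma (1 - sigma))^-1 by rewrite invr_ge0 ltW// Gamma_gt0.
rewrite (RLint_D _ (lexx t))// normrM (ger0_norm G0) EFinM.
apply: lee_wpmul2l; first by rewrite lee_fin.
(* Here s is the variable of Marchaud's integral and r that of f(t) - f(s), the integral of g over
   (s,t). *)
pose k s r := rk (- sigma) (t - s) * (if s < r then g r else 0) : R.
have mk : measurable_fun [set: R * R] (fun z => k z.1 z.2).
  apply: measurable_funM.
    apply: (measurableT_comp (measurable_rk (- sigma))).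
    exact: (measurable_funB (measurable_cst t) measurable_fst).
  apply: measurable_fun_ifT => //; first exact: (measurable_fun_ltr measurable_fst measurable_snd).
  exact: (measurableT_comp mg measurable_snd).
have mk' : measurable_fun [set: R * R] (fun z => k z.2 z.1).
  exact: (measurableT_comp mk (@measurable_swap _ _ R R)).
have inner r : 0 < r -> r < t ->
    (\int[mu]_(s in I0 t) (rk (- sigma) (t - s) * (if s < r then 1 else 0))%:E =
     (((t - r) `^ (- sigma) - t `^ (- sigma)) / sigma)%:E)%E.
  move=> r0 rt; have tr0 : 0 < t - r by rewrite subr_gt0.
  have trt : t - r <= t by rewrite gerBl ltW.
  have sn0 : - sigma != 0 by rewrite oppr_eq0 gt_eqF.
  have := integral_powR_cc sn0 tr0 trt.
  have -> : (t `^ (- sigma) - (t - r) `^ (- sigma)) / - sigma =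
      ((t - r) `^ (- sigma) - t `^ (- sigma)) / sigma.
    by rewrite invrN mulrN -mulNr opprB.
  have mp (A : set R) : measurable_fun A (fun x : R => (x `^ (- sigma - 1))%:E).
    by apply: measurable_funTS; apply/measurable_EFinP; exact: measurable_powR.
  move=> <-; rewrite -integral_itv_bndo_bndc// -integral_itv_obnd_cbnd//.
  have mr : measurable_fun setT ((fun x : R => (x `^ (- sigma - 1))%:E) \_ `](t - r)%R, t[%classic).
    exact/(measurable_restrictT _ (measurable_itv _)).
  have r0' x : (0 <= ((fun x : R => (x `^ (- sigma - 1))%:E) \_ `](t - r)%R, t[%classic) x)%E.
    by apply: erestrict_ge0 => y _; rewrite lee_fin powR_ge0.
  rewrite [RHS]integral_mkcond -(ge0_integral_reflect t mr r0') [LHS]integral_mkcond.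
  apply: eq_integral => s _; rewrite !patchE !mem_setE !in_itv/=.
  rewrite ltrD2l ltrN2 gtrBl; case: (ltP 0 s) => /= s0'; rewrite ?andbF// andbT.
  case: (ltP s r) => sr; rewrite ?(lt_trans sr rt).
    by rewrite mulr1 rk_gt0// subr_gt0 (lt_trans sr).
  by rewrite mulr0; case: ifP.
(* (t-r)^(-sigma) is t^(-sigma) plus sigma times the integral of (t-s)^(-sigma-1) over 0 < s < r;
   since r < t, the singularity s = t is not met. *)
have decomp : {in I0 t, forall x, rk (1 - sigma) (t - x) * g x =
    t `^ (- sigma) * g x + sigma * Rintegral mu (I0 t) (fun s => k s x)}.
  move=> r; rewrite inE/= in_itv/= => /andP[r0 rt].
  have -> : Rintegral mu (I0 t) (fun s => k s r) =
      ((t - r) `^ (- sigma) - t `^ (- sigma)) / sigma * g r.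
    rewrite (@eq_Rintegral _ _ _ mu _ (fun s => g r * (rk (- sigma) (t - s) * (if s < r then 1 else 0)))).
      rewrite RintegralZl_measurable//; first by rewrite /Rintegral inner// mulrC.
      apply: measurable_funTS; apply: measurable_funM.
        exact: measurable_rk_sub.
      by apply: measurable_fun_ifT => //; exact: measurable_fun_ltr.
    by move=> s _; rewrite /k mulrCA; case: ifP => _; rewrite ?mulr1 ?mulr0.
  rewrite rk_gt0 ?subr_gt0//; have -> : 1 - sigma - 1 = - sigma by ring.
  rewrite mulrA (mulrC sigma) divfK ?gt_eqF//; ring.
(* Boundedness of g is used here: the integral in s is at most M/sigma times (t-r)^(-sigma), which
   is integrable because sigma < 1. *)
have absK : (\int[mu]_(r in I0 t) \int[mu]_(s in I0 t) `|k s r|%:E < +oo)%E.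
  have mrk : measurable_fun setT (fun r : R => rk (1 - sigma) (t - r)).
    exact: measurable_rk_sub.
  apply: (@le_lt_trans _ _ (\int[mu]_(r in I0 t) ((M / sigma)%:E * (rk (1 - sigma) (t - r))%:E))%E); last first.
    rewrite ge0_integralZl//; last 3 first.
    - by apply/measurable_EFinP; exact: measurable_funTS.
    - by move=> r _; rewrite lee_fin rk_ge0.
    - by rewrite lee_fin divr_ge0// ltW.
    apply: lte_mul_pinfty => //; first by rewrite lee_fin divr_ge0// ltW.
    exact: le_lt_trans (integral_rk_right c0 t0 (lexx t)) (ltry _).
  apply: ge0_le_integral => //.
  - by move=> r _; apply: integral_ge0 => s _; rewrite lee_fin.
  - apply: measurable_funTS; apply: (@measurable_tonelli_on _ _ (fun r s => `|k s r|%:E)) => //.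
    by apply/measurable_EFinP; exact: measurableT_comp.
  - by apply: measurable_funTS; apply: measurable_funeM; apply/measurable_EFinP.
  move=> r; rewrite /= in_itv/= => /andP[r0 rt].
  have mone : measurable_fun setT (fun s : R => rk (- sigma) (t - s) * (if s < r then 1 else 0)).
    apply: measurable_funM.
      exact: measurable_rk_sub.
    by apply: measurable_fun_ifT => //; exact: measurable_fun_ltr.
  have one0 s : 0 <= rk (- sigma) (t - s) * (if s < r then 1 else 0).
    by rewrite mulr_ge0 ?rk_ge0//; case: ifP.
  apply: (@le_trans _ _ (M%:E * \int[mu]_(s in I0 t) (rk (- sigma) (t - s) * (if s < r then 1 else 0))%:E)%E).
    rewrite -ge0_integralZl//; last 2 first.
    - by apply/measurable_EFinP; exact: measurable_funTS.
    - by move=> s _; rewrite lee_fin.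
    apply: ge0_le_integral => //.
    - apply/measurable_EFinP; apply: measurableT_comp => //; apply: measurable_funTS.
      exact: (measurableT_comp mk (pair2_measurable r)).
    - by apply: measurable_funeM; apply/measurable_EFinP; exact: measurable_funTS.
    move=> s _; rewrite -EFinM lee_fin /k normrM (ger0_norm (rk_ge0 _ _)) mulrCA.
    rewrite ler_wpM2l ?rk_ge0//; case: ifP => _; last by rewrite normr0 mulr0.
    by rewrite mulr1 HM// (lt_trans rt).
  rewrite inner// -!EFinM lee_fin -mulrA ler_wpM2l// mulrC ler_wpM2l ?invr_ge0 ?(ltW s0)//.
  rewrite rk_gt0 ?subr_gt0//; have -> : 1 - sigma - 1 = - sigma by ring.
  by rewrite gerBl powR_ge0.
have ig : mu.-integrable (I0 t) (EFin \o g).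
  apply: integrableS (mLp_integrable (lexx _) T0 Lg) => //.
  by move=> x /=; rewrite !in_itv/= => /andP[-> /lt_trans ->].
have mKr : measurable_fun setT (fun r => Rintegral mu (I0 t) (fun s => k s r)).
  exact: (@measurable_int_on _ _ (fun r s => k s r)).
have iK : mu.-integrable (I0 t) (EFin \o (fun r => Rintegral mu (I0 t) (fun s => k s r))).
  apply: integrable_on; first exact: measurable_funTS.
  apply: le_lt_trans absK; apply: ge0_le_integral => //.
  - by apply: measurable_funTS; apply/measurable_EFinP; exact: measurableT_comp.
  - apply: measurable_funTS; apply: (@measurable_tonelli_on _ _ (fun r s => `|k s r|%:E)) => //.
    by apply/measurable_EFinP; exact: measurableT_comp.
  - move=> r _; apply: le_Rintegral_abs => //; apply: measurable_funTS.
    exact: (measurableT_comp mk (pair2_measurable r)).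
have E : Rintegral mu (I0 t) (fun r => rk (1 - sigma) (t - r) * g r) =
    t `^ (- sigma) * f t +
    sigma * Rintegral mu (I0 t) (fun s => rk (- sigma) (t - s) * (f t - f s)).
  rewrite (eq_Rintegral mu decomp) RintegralD//; last 2 first.
  - by have := @integrableZl _ _ _ mu _ (measurable_itv _) (t `^ (- sigma)) _ ig.
  - by have := @integrableZl _ _ _ mu _ (measurable_itv _) sigma _ iK.
  rewrite RintegralZl_measurable// -RLint1E RintegralZl_measurable//; last exact: measurable_funTS.
  congr (_ + _ * _).
  rewrite (@fubini_on _ _ _ (fun r s => k s r))//.
  apply: eq_Rintegral => s; rewrite inE/= in_itv/= => /andP[s0' st].
  rewrite /k RintegralZl_measurable//; last first.
    apply: measurable_funTS; apply: measurable_fun_ifT => //; exact: measurable_fun_ltr.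
  congr (_ * _); rewrite (RLint1B Lg) ?ltW//.
  rewrite Rintegral_mkcond [RHS]Rintegral_mkcond; apply: eq_Rintegral => r _.
  rewrite !patchE !mem_setE !in_itv/=; case: (ltP s r) => sr; last by case: ifP.
  by rewrite (lt_trans s0' sr).
rewrite E; apply: (@le_trans _ _ (`|t `^ (- sigma) * f t|%:E + `|sigma * Rintegral mu (I0 t) (fun s => rk (- sigma) (t - s) * (f t - f s))|%:E)%E).
  by rewrite -EFinD lee_fin ler_normD.
apply: leeD; first by rewrite normrM (ger0_norm (powR_ge0 _ _)).
rewrite normrM (gtr0_norm s0) EFinM; apply: lee_wpmul2l; first by rewrite lee_fin ltW.
have mf : measurable_fun setT f by exact: measurable_RLint.
have mh : measurable_fun setT (fun s : R => rk (- sigma) (t - s) * (f t - f s)).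
  apply: measurable_funM.
    exact: measurable_rk_sub.
  exact: (measurable_funB (measurable_cst (f t)) mf).
apply: le_trans (le_Rintegral_abs (measurable_itv _) (measurable_funTS mh)) _.
rewrite [leLHS](_ : _ = \int[mu]_(s in I0 t) (rk (- sigma) (t - s) * `|f t - f s|)%:E)%E; last first.
  by apply: eq_integral => s _; rewrite normrM (ger0_norm (rk_ge0 _ _)).
apply: ge0_subset_integral => //.
- apply/measurable_EFinP; apply: measurable_funTS; apply: measurable_funM.
    exact: measurable_rk_sub.
  by apply: measurableT_comp => //; exact: (measurable_funB (measurable_cst (f t)) mf).
- by move=> s _; rewrite lee_fin mulr_ge0 ?rk_ge0.
- by move=> s /=; rewrite !in_itv/= => /andP[-> /lt_trans ->].
Qed.

End marchaud.

(** * Fractional derivatives bounded by a seminorm of slightly higher order *)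

Section fractional_derivative_bound.
Context {R : realType}.
Local Notation mu := (@lebesgue_measure R).
Local Notation I0 T := (`]0%R, T[%classic : set R).
Implicit Types (p T theta sigma : R) (f g u v : R -> R).

Lemma poweRD_le p (x y : \bar R) : 0 < p -> (0 <= x)%E -> (0 <= y)%E ->
  ((x + y) `^ p <= (2 `^ p)%:E * (x `^ p + y `^ p))%E.
Proof.
move=> p0; have c0 : 0 < (2 : R) `^ p by rewrite powR_gt0.
case: x => [x| |]//; case: y => [y| |]// x0 y0.
- by rewrite -EFinD !poweR_EFin -EFinD -EFinM lee_fin; apply: powRD_le => //; exact: ltW.
- by rewrite !poweRyr ?gt_eqF// addey ?poweR_EFin// gt0_muley ?lte_fin// leey.
- by rewrite !poweRyr ?gt_eqF// addye ?poweR_EFin// gt0_muley ?lte_fin// leey.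
- by rewrite !poweRyr ?gt_eqF// addye// gt0_muley ?lte_fin// leey.
Qed.

(** x^(c-1) x^(-theta p) = x^c / x^(1 + theta p), where x^c <= T^c. *)
Let pow_kernel_le theta p (c x y T : R) : 0 <= c -> 0 < x -> x <= T -> 0 <= y ->
  rk c x * (y * x `^ (- theta)) `^ p <= T `^ c * (y `^ p / x `^ (1 + theta * p)).
Proof.
move=> c0 x0 xT y0; rewrite rk_gt0// powRM ?powR_ge0// mulrCA [leRHS]mulrCA.
rewrite ler_wpM2l ?powR_ge0//.
have xn q' q'' : x `^ q' * x `^ q'' = x `^ (q' + q'').
  by rewrite powRD// (gt_eqF x0) implybT.
rewrite -powRrM xn; have -> : c - 1 + - theta * p = c + - (1 + theta * p) by ring.
rewrite -xn -powRN ler_wpM2r ?powR_ge0//.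
by apply: ler_powR_base; [|exact: ltW|].
Qed.

Let kernel_le theta p (y z c s t T : R) : 0 <= c -> s < t -> t - s <= T ->
  rk c (t - s) * (`|y - z| * `|t - s| `^ (- theta)) `^ p <=
  T `^ c * (`|z - y| `^ p / `|s - t| `^ (1 + theta * p)).
Proof.
move=> c0 st tsT; have ts0 : 0 < t - s by rewrite subr_gt0.
by rewrite (distrC z) (distrC s) (gtr0_norm ts0); exact: pow_kernel_le.
Qed.

(** The first Marchaud term is a Hardy integral with q = sigma p < theta p. In the second,
    (t-s)^(-1-sigma) is split into (t-s)^(c-1), an integrable weight for Jensen because c = theta -
    sigma > 0, and (t-s)^(-theta), whose p-th power completes the Gagliardo quotient. The constant
    is independent of M. *)
Lemma RLint_marchaud_bound p T sigma theta : 0 < T -> 1 <= p -> 0 < sigma ->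
  sigma < theta -> theta < 1 -> exists2 C : R, 0 <= C &
  forall g (M : R), measurable_fun setT g -> (forall t, 0 < t -> t < T -> `|g t| <= M) ->
  (energy p T (RLint (1 - sigma) g) <=
   C%:E * (energy p T (RLint 1 g) + gagliardo theta p T (RLint 1 g)))%E.
Proof.
move=> T0 p1 s0 sth th1; have p0 : 0 < p by exact: lt_le_trans p1.
have th0 : 0 < theta by exact: lt_trans sth.
have s1 : sigma < 1 by exact: lt_trans th1.
have q0 : 0 < sigma * p by rewrite mulr_gt0.
have qth : sigma * p < theta * p by rewrite ltr_pM2r.
have [C C0 HC] := hardy_inequality T0 p1 th0 q0 qth th1.
pose c := theta - sigma; have c0 : 0 < c by rewrite subr_gt0.
pose G0 := (Gamma (1 - sigma))^-1.
have G00 : 0 <= G0 by rewrite invr_ge0 ltW// Gamma_gt0// subr_gt0.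
pose B := (T `^ c / c) `^ (p - 1) * T `^ c.
have Tc0 : 0 <= T `^ c / c by rewrite divr_ge0 ?powR_ge0// ltW.
have B0 : 0 <= B by rewrite mulr_ge0 ?powR_ge0.
exists (G0 `^ p * (2 `^ p * (C + sigma `^ p * B))).
  by rewrite !mulr_ge0 ?powR_ge0// addr_ge0// mulr_ge0 ?powR_ge0.
move=> g M mg HM.
have Lp' q : 0 <= q -> mLp q T g.
  by move=> q0'; apply: (@mLp_bounded _ q T g M) => //; [exact: ltW|move=> x /andP[]; exact: HM].
have Lg : mLp 1 T g by exact: Lp'.
set f := RLint 1 g; have mf : measurable_fun setT f by exact: measurable_RLint.
set E := energy p T f; set Ga := gagliardo theta p T f.
have E0 : (0 <= E)%E by exact: energy_ge0.
have Ga0 : (0 <= Ga)%E by exact: gagliardo_ge0.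
have HE := HC f M mf (fun t t0 tT => RLint1_lipschitz0 Lg t0 tT HM).
pose A t := t `^ (- sigma) * `|f t|.
have A0 t : 0 <= A t by rewrite mulr_ge0 ?powR_ge0.
pose I t := (\int[mu]_(s in I0 T) (rk (- sigma) (t - s) * `|f t - f s|)%:E)%E.
have I00 t : (0 <= I t)%E by apply: integral_ge0 => s _; rewrite lee_fin mulr_ge0 ?rk_ge0.
pose g2 t s : \bar R := (`|f s - f t| `^ p / `|s - t| `^ (1 + theta * p))%:E.
have mg2 : measurable_fun [set: R * R] (fun z => g2 z.1 z.2) := measurable_gagliardo theta p mf.
have g20 t s : (0 <= g2 t s)%E by rewrite lee_fin divr_ge0 ?powR_ge0.
pose J t := (\int[mu]_(s in I0 T) g2 t s)%E.
have J0 t : (0 <= J t)%E by exact: integral_ge0.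
have mJ : measurable_fun setT J by exact: measurable_tonelli_on.
have mI : measurable_fun setT I.
  apply: (@measurable_tonelli_on _ _ (fun t s => (rk (- sigma) (t - s) * `|f t - f s|)%:E)) => //.
    apply/measurable_EFinP; apply: measurable_funM; first exact: measurable_rkB.
    apply: measurableT_comp => //.
    exact: (measurable_funB (measurableT_comp mf measurable_fst) (measurableT_comp mf measurable_snd)).
  by move=> t s; rewrite lee_fin mulr_ge0 ?rk_ge0.
have IJ t : 0 < t -> t < T -> (I t `^ p <= B%:E * J t)%E.
  move=> t0 tT.
  pose k s := rk c (t - s); pose F s := `|f t - f s| * `|t - s| `^ (- theta).
  have mk : measurable_fun setT k.
    exact: measurable_rk_sub.
  have mF : measurable_fun setT F.
    apply: measurable_funM.
      by apply: measurableT_comp => //; exact: (measurable_funB (measurable_cst (f t)) mf).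
    by apply: measurable_powR_comp; apply: measurableT_comp => //; exact: measurable_funB.
  have k0 s : 0 <= k s by exact: rk_ge0.
  have F0 s : 0 <= F s by rewrite mulr_ge0 ?powR_ge0.
  have -> : I t = (\int[mu]_(s in I0 T) (k s * F s)%:E)%E.
    apply: eq_integral => s _; congr EFin; rewrite /k /F.
    case: (leP t s) => ts; first by rewrite !rk_le0 ?subr_le0// !mul0r.
    rewrite !rk_gt0 ?subr_gt0// (gtr0_norm (_ : 0 < t - s)) ?subr_gt0//.
    rewrite mulrCA mulrC -powRD; last by rewrite [t - s == 0]gt_eqF ?implybT// subr_gt0.
    by congr (_ * _ `^ _); rewrite /c; ring.
  apply: le_trans (jensen_weighted p1 (measurable_itv _) mk mF k0 F0) _.
  rewrite /B EFinM -muleA; apply: lee_pmul.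
  - exact: poweR_ge0.
  - by apply: integral_ge0 => s _; rewrite lee_fin mulr_ge0 ?powR_ge0.
  - rewrite -poweR_EFin; apply: poweR_le; first by rewrite subr_ge0.
      by apply: integral_ge0 => s _; rewrite lee_fin.
    by apply: integral_rk_right => //; exact: ltW.
  rewrite -ge0_integralZl//; last 2 first.
  - by apply: measurable_funTS; exact: (measurableT_comp mg2 (pair1_measurable t)).
  - by rewrite lee_fin powR_ge0.
  apply: ge0_le_integral => //.
  - by move=> s _; rewrite lee_fin mulr_ge0 ?powR_ge0.
  - apply: measurable_funTS; apply/measurable_EFinP; apply: measurable_funM => //.
    exact: measurable_powR_comp.
  - apply: measurable_funTS; apply: measurable_funeM.
    exact: (measurableT_comp mg2 (pair1_measurable t)).
  move=> s; rewrite /= in_itv/= => /andP[sp sT].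
  rewrite /g2 -EFinM lee_fin /k /F.
  case: (leP t s) => ts.
    by rewrite rk_le0 ?subr_le0// mul0r mulr_ge0 ?powR_ge0// divr_ge0 ?powR_ge0.
  have tsT : t - s <= T by rewrite (le_trans _ (ltW tT))// gerBl ltW.
  exact: (kernel_le theta p (f t) (f s) (ltW c0) ts tsT).
have pt t : 0 < t -> t < T -> ((`|RLint (1 - sigma) g t| `^ p)%:E <=
    (G0 `^ p)%:E * ((2 `^ p)%:E * ((t `^ (- (sigma * p)) * `|f t| `^ p)%:E + (sigma `^ p * B)%:E * J t)))%E.
  move=> t0 tT; have := marchaud s0 s1 mg Lg HM t0 tT; rewrite -/f -/(I t) -/(A t) -/G0 => H.
  rewrite -poweR_EFin; apply: le_trans (poweR_le (ltW p0) _ H) _ => //.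
  have s0e : (0 <= sigma%:E)%E by rewrite lee_fin ltW.
  rewrite poweRM ?lee_fin//; last by rewrite adde_ge0 ?mule_ge0 ?lee_fin.
  rewrite poweR_EFin; apply: lee_wpmul2l; first by rewrite lee_fin powR_ge0.
  apply: le_trans (poweRD_le p0 _ _) _; [by rewrite lee_fin|by rewrite mule_ge0|].
  apply: lee_wpmul2l; first by rewrite lee_fin powR_ge0.
  apply: leeD.
    by rewrite poweR_EFin lee_fin /A powRM ?powR_ge0// -powRrM mulNr.
  rewrite poweRM// poweR_EFin EFinM -muleA; apply: lee_wpmul2l; first by rewrite lee_fin powR_ge0.
  exact: IJ.
have mA : measurable_fun setT (fun t : R => (t `^ (- (sigma * p)) * `|f t| `^ p)%:E).
  apply/measurable_EFinP; apply: measurable_funM; first exact: measurable_powR.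
  by apply: measurable_powR_comp; apply: measurableT_comp.
have sB0 : (0 <= (sigma `^ p * B)%:E)%E by rewrite lee_fin mulr_ge0 ?powR_ge0.
have A1 t : (0 <= (t `^ (- (sigma * p)) * `|f t| `^ p)%:E)%E.
  by rewrite lee_fin mulr_ge0 ?powR_ge0.
have msum : measurable_fun setT (fun t => (t `^ (- (sigma * p)) * `|f t| `^ p)%:E + (sigma `^ p * B)%:E * J t)%E.
  by apply: emeasurable_funD => //; exact: measurable_funeM.
have sum0 t : (0 <= (t `^ (- (sigma * p)) * `|f t| `^ p)%:E + (sigma `^ p * B)%:E * J t)%E.
  by rewrite adde_ge0// mule_ge0.
apply: (@le_trans _ _ (\int[mu]_(t in I0 T) ((G0 `^ p)%:E * ((2 `^ p)%:E *
   ((t `^ (- (sigma * p)) * `|f t| `^ p)%:E + (sigma `^ p * B)%:E * J t))))%E).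
  apply: ge0_le_integral => //.
  - apply: measurable_energy; apply: measurable_funTS; exact: measurable_RLint.
  - by apply: measurable_funTS; do 2 apply: measurable_funeM.
  - by move=> t; rewrite /= in_itv/= => /andP[]; exact: pt.
have h2 : (0 <= (2 `^ p)%:E :> \bar R)%E by rewrite lee_fin powR_ge0.
rewrite ge0_integralZl//; last 3 first.
- by apply: measurable_funTS; exact: measurable_funeM.
- by move=> t _; rewrite mule_ge0.
- by rewrite lee_fin powR_ge0.
rewrite (EFinM (G0 `^ p)) -muleA; apply: lee_wpmul2l; first by rewrite lee_fin powR_ge0.
rewrite ge0_integralZl//; last exact: measurable_funTS.
rewrite (EFinM (2 `^ p)) -muleA; apply: lee_wpmul2l => //.
rewrite ge0_integralD//; last 3 first.
- exact: measurable_funTS.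
- by move=> t _; rewrite mule_ge0.
- by apply: measurable_funTS; exact: measurable_funeM.
have C0e : (0 <= C%:E)%E by rewrite lee_fin.
rewrite EFinD ge0_muleDl//; apply: leeD; first exact: HE.
rewrite ge0_integralZl//; last exact: measurable_funTS.
by apply: lee_wpmul2l => //; exact: leeDr.
Qed.

Lemma gagliardoB theta p T u v : 0 <= p -> measurable_fun setT u -> measurable_fun setT v ->
  (gagliardo theta p T (fun x => u x - v x)%R <=
   (2 `^ p)%:E * (gagliardo theta p T u + gagliardo theta p T v))%E.
Proof.
move=> p0 mu0 mv.
pose k (w : R -> R) t s : \bar R := (`|w s - w t| `^ p / `|s - t| `^ (1 + theta * p))%:E.
have mk w : measurable_fun setT w -> measurable_fun [set: R * R] (fun z => k w z.1 z.2) := @measurable_gagliardo R theta p w.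
have k0 w t s : (0 <= k w t s)%E by rewrite lee_fin divr_ge0 ?powR_ge0.
have mkt w t : measurable_fun setT w -> measurable_fun (I0 T) (k w t).
  by move=> mw; apply: measurable_funTS; exact: (measurableT_comp (mk w mw) (pair1_measurable t)).
have mJ w : measurable_fun setT w -> measurable_fun (I0 T) (fun t => \int[mu]_(s in I0 T) k w t s)%E.
  move=> mw; apply: measurable_funTS; apply: measurable_tonelli_on => //; exact: mk.
have J0 w t : (0 <= \int[mu]_(s in I0 T) k w t s)%E by exact: integral_ge0.
have h2 : (0 <= (2 `^ p)%:E :> \bar R)%E by rewrite lee_fin powR_ge0.
have mB : measurable_fun setT (fun x => u x - v x) by exact: measurable_funB mu0 mv.
change (\int[mu]_(t in I0 T) \int[mu]_(s in I0 T) k (fun x => u x - v x)%R t s <=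
  (2 `^ p)%:E * (\int[mu]_(t in I0 T) \int[mu]_(s in I0 T) k u t s +
                 \int[mu]_(t in I0 T) \int[mu]_(s in I0 T) k v t s))%E.
rewrite -ge0_integralD//; [|exact: mJ|exact: mJ].
rewrite -ge0_integralZl//; last 2 first.
- by apply: emeasurable_funD; exact: mJ.
- by move=> t _; rewrite adde_ge0.
apply: ge0_le_integral => //; first exact: mJ.
  by apply: measurable_funeM; apply: emeasurable_funD; exact: mJ.
move=> t _; rewrite -ge0_integralD//; [|exact: mkt|exact: mkt].
rewrite -ge0_integralZl//; last 2 first.
- by apply: emeasurable_funD; exact: mkt.
- by move=> s _; rewrite adde_ge0.
apply: ge0_le_integral => //; first exact: mkt.
  by apply: measurable_funeM; apply: emeasurable_funD; exact: mkt.
move=> s _; rewrite /k -EFinD -EFinM lee_fin -mulrDl mulrA ler_wpM2r ?invr_ge0 ?powR_ge0//.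
apply: le_trans (powRD_le p0 (normr_ge0 (u s - u t)) (normr_ge0 (v s - v t))).
apply: ler_powR_base => //; have -> : u s - v s - (u t - v t) = (u s - u t) - (v s - v t) by ring.
exact: ler_normB.
Qed.

Lemma gagliardo0B theta p T u v : 0 <= p -> measurable_fun setT u -> measurable_fun setT v ->
  (gagliardo0 theta p T (fun x => u x - v x)%R <=
   (2 `^ p)%:E * (gagliardo0 theta p T u + gagliardo0 theta p T v))%E.
Proof.
move=> p0 mu0 mv; rewrite /gagliardo0; case: (theta == 0).
  by rewrite adde0 mule0.
exact: gagliardoB.
Qed.

Lemma slobodecki_energyB s p T (d d' : nat -> R -> R) : 0 <= p ->
  (forall i, (i <= Num.truncn s)%N -> measurable_fun setT (d i)) ->
  (forall i, (i <= Num.truncn s)%N -> measurable_fun setT (d' i)) ->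
  (slobodecki_energy s p T (fun i x => d i x - d' i x)%R <=
   (2 `^ p)%:E * (slobodecki_energy s p T d + slobodecki_energy s p T d'))%E.
Proof.
move=> p0 md md'; rewrite /slobodecki_energy addeACA ge0_muleDr; last 2 first.
- by apply: adde_ge0; apply: sume_ge0 => i _; exact: energy_ge0.
- by apply: adde_ge0; exact: gagliardo0_ge0.
apply: leeD.
  rewrite -big_split/= ge0_sume_distrr; last by move=> i _; rewrite adde_ge0 ?energy_ge0.
  apply: lee_sum => i _; have ij : (i <= Num.truncn s)%N by rewrite -ltnS.
  exact: energyB p0 (measurable_funTS (md i ij)) (measurable_funTS (md' i ij)).
exact: gagliardo0B p0 (md _ (leqnn _)) (md' _ (leqnn _)).
Qed.

Lemma is_wderivB T j u v w z : 0 < T -> is_wderiv T j u w -> is_wderiv T j v z ->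
  is_wderiv T j (fun t => u t - v t) (fun t => w t - z t).
Proof.
move=> T0 [lu lw Hw] [lv lz Hz]; split; [exact: locally_integrableB|exact: locally_integrableB|].
move=> phi tphi; have tphij := test_derive1n j tphi.
rewrite (@eq_Rintegral _ _ _ mu _ (fun t => u t * derive1n j phi t - v t * derive1n j phi t)); last first.
  by move=> t _; rewrite mulrBl.
rewrite [in RHS](@eq_Rintegral _ _ _ mu _ (fun t => w t * phi t - z t * phi t)); last first.
  by move=> t _; rewrite mulrBl.
rewrite RintegralB//; [|exact: test_integrable|exact: test_integrable].
rewrite RintegralB//; [|exact: test_integrable|exact: test_integrable].
by rewrite Hw// Hz// mulrBr.
Qed.

End fractional_derivative_bound.

(** * Smooth functions vanishing at 0 as iterated primitives *)

Section zero_trace_spaces.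
Context {R : realType}.
Local Notation mu := (@lebesgue_measure R).
Local Notation I0 T := (`]0%R, T[%classic : set R).
Implicit Types (p s T theta sigma : R) (f g u v : R -> R) (d D : nat -> R -> R).

(** At an interior point the restriction of the quotient to [0,T] disappears for small
    increments. *)
Lemma is_derive_within T f (t l : R) : 0 < t -> t < T ->
  (fun s => (f s - f t) / (s - t)) @ within `[0, T] t^' --> l -> is_derive t 1 f l.
Proof.
move=> t0 tT /cvgrPdist_le H.
have cl : (fun h => h^-1 *: ((f \o shift t) (h *: 1) - f t)) @ 0^' --> l.
  apply/cvgrPdist_le => e e0; have [d /= d0 Hd] := H e e0.
  exists (Num.min d (Num.min t (T - t))); first by rewrite /= !lt_min d0 t0 subr_gt0.
  move=> h; rewrite /= sub0r normrN !lt_min => /and3P[hd ht hT] h0.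
  have E : t - (h + t) = - h by ring.
  have := Hd (h + t); rewrite /ball/= E normrN => /(_ hd).
  rewrite addrK => Hh; rewrite /= /shift /GRing.scale/= mulr1 mulrC; apply: Hh.
    by apply/eqP => ht0; move/eqP: h0; apply; move: ht0; lra.
  rewrite in_itv/=; move: ht hT; rewrite !ltr_norml => /andP[h1 h2] /andP[h3 h4].
  by apply/andP; split; lra.
by apply: DeriveDef; [exact: cvgP cl|exact: cvg_lim cl].
Qed.

(** Membership in 0C^k as it is used: the equations D_i = J^1 D_(i+1) hold both the
    differentiability and the vanishing at 0, and every D_i is bounded and measurable on the whole
    line. *)
Definition primitive_chain k T D : Prop :=
  (forall i, (i <= k)%N -> measurable_fun setT (D i) /\
     exists M, forall t, `|D i t| <= M) /\
  (forall i, (i < k)%N -> {in I0 T, D i =1 RLint 1 (D i.+1)}).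

(** The derivatives, extended by 0 outside [0,T], satisfy the equations by the fundamental theorem
    of calculus, whose boundary term at 0 vanishes. *)
Lemma zeroC_chain k T v : 0 < T -> zeroC k T v ->
  exists2 D, primitive_chain k T D & {in I0 T, v =1 D 0%N}.
Proof.
move=> T0 [d [[cd dd] <-] d0].
pose D i := d i \_ (`[0%R, T]%classic : set R).
have DE i : {in I0 T, d i =1 D i}.
  move=> t; rewrite inE/= in_itv/= => /andP[t0 tT].
  by rewrite /D patchE mem_set//= in_itv/= !ltW.
exists D; last exact: DE.
have mD i : (i <= k)%N -> measurable_fun setT (D i).
  move=> ik; apply/(measurable_restrictT _ (measurable_itv _)).
  by apply: subspace_continuous_measurable_fun => //; exact: cd.
split.
  move=> i ik; split; first exact: mD.
  have cn : {within `[0, T], continuous (fun x => `|d i x|)}.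
    move=> x; apply: continuous_comp; first exact: cd.
    exact: norm_continuous.
  have [c _ cmax] := EVT_max (ltW T0) cn.
  exists `|d i c| => t; rewrite /D patchE; case: ifPn => tT; last by rewrite normr0.
  by apply: cmax; rewrite inE in tT.
move=> i ik t; rewrite inE/= in_itv/= => /andP[t0 tT].
have -> : D i t = d i t by rewrite -DE// inE/= in_itv/= t0.
have sub : (`[0%R, t]%classic : set R) `<=` `[0%R, T]%classic.
  by move=> x /=; rewrite !in_itv/= => /andP[-> /= xt]; rewrite (le_trans xt)// ltW.
have c1 : {within `[0, t], continuous (d i.+1)} by exact: continuous_subspaceW sub (cd _ ik).
have c0 : {within `[0, t], continuous (d i)} by exact: continuous_subspaceW sub (cd _ (ltnW ik)).
have isd x : x \in `]0, t[ -> is_derive x 1 (d i) (d i.+1 x).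
  rewrite in_itv/= => /andP[x0 xt]; have xT : x < T by exact: lt_trans tT.
  by apply: (is_derive_within x0 xT); apply: dd => //; rewrite in_itv/= !ltW.
have [_ cr cl] := (continuous_within_itvP _ t0).1 c0.
have H := @continuous_FTC2 _ (d i.+1) (d i) 0 t t0 c1.
rewrite RLint1E /Rintegral.
have -> : (\int[mu]_(x in I0 t) (D i.+1 x)%:E = \int[mu]_(x in `[0%R, t]) (d i.+1 x)%:E)%E.
  rewrite -integral_itv_bndo_bndc; last first.
    apply/measurable_EFinP; apply: measurable_funS (subspace_continuous_measurable_fun _ c1) => //.
    by move=> x /=; rewrite !in_itv/= => /andP[-> /ltW ->].
  rewrite -integral_itv_obnd_cbnd; last first.
    apply/measurable_EFinP; apply: measurable_funS (subspace_continuous_measurable_fun _ c1) => //.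
    by move=> x /=; rewrite !in_itv/= => /andP[/ltW -> /ltW ->].
  apply: eq_integral => x; rewrite inE/= in_itv/= => /andP[x0 xt].
  by rewrite DE// inE/= in_itv/= x0 (lt_trans xt).
rewrite H.
- by rewrite d0// sube0.
- split => //; move=> x xt; by have [] := isd x xt.
- by move=> x xt; rewrite derive1E; have [] := isd x xt.
Qed.

Lemma mLp_bounded1 p T v : 0 <= p -> 0 < T -> measurable_fun setT v ->
  (exists M, forall t, `|v t| <= M) -> mLp p T v.
Proof.
move=> p0 T0 mv [M HM]; apply: (mLp_bounded p0 (ltW T0) mv (M := M)) => x _.
exact: HM.
Qed.

Lemma chain_wderiv k T D : 0 < T -> primitive_chain k T D ->
  forall i j, (j + i <= k)%N -> is_wderiv T i (D j) (D (j + i)%N).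
Proof.
move=> T0 [mD DE]; have L j : (j <= k)%N -> mLp 1 T (D j).
  by move=> jk; have [m1 b1] := mD j jk; exact: mLp_bounded1.
elim=> [|i IH] j jik.
  by rewrite addn0; apply: wderiv0; apply: mLp1_locally_integrable T0 (L _ _); rewrite -(addn0 j).
have jk : (j.+1 <= k)%N by rewrite (leq_trans _ jik)// addnS ltnS leq_addr.
have H : is_wderiv T i (D j.+1) (D (j + i.+1)%N) by rewrite addnS -addSn; apply: IH; rewrite addSn -addnS.
apply: eq_wderiv (wderiv_RLint1 T0 (L _ jk) H).
  by apply: measurable_funTS; exact: (mD j (ltnW jk)).1.
by apply: eq_in_ae => t tD; rewrite DE.
Qed.

Lemma chain_RLint k T D : 0 < T -> primitive_chain k T D ->
  forall i j, (j + i.+1 <= k)%N -> eq_ae0T T (D j) (RLint i.+1%:R (D (j + i.+1)%N)).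
Proof.
move=> T0 [mD DE]; have L j : (j <= k)%N -> mLp 1 T (D j).
  by move=> jk; have [m1 b1] := mD j jk; exact: mLp_bounded1.
elim=> [|i IH] j jik.
  by apply: eq_in_ae => t tD; rewrite addn1 DE// -addn1.
have jk : (j.+1 <= k)%N by rewrite (leq_trans _ jik)// addnS ltnS leq_addr.
have := IH j.+1; rewrite addSn -addnS => /(_ jik) H.
have i0 : 0 < i.+1%:R :> R by rewrite ltr0n.
have S := RLint_semigroup ltr01 i0 T0 (L _ jik); rewrite [1 + _]addrC natr1 in S.
have H1 := ae_RLint 1 (mD _ jk).1 (measurable_RLint i.+1%:R (mD _ jik).1) H.
apply: (ae_imply2 H1 S) => t Dt h1 h2.
by rewrite DE ?inE// h1 h2.
Qed.

(** If m is below the integer part of s, the norm already contains D_(m+1) and Young's inequality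
    suffices. Otherwise m is that integer part, and theta = s - m lies between sigma and 1, which is
    the situation of the Marchaud bound. *)
Lemma chain_bound s p T sigma (m : nat) : 0 < T -> 1 <= p -> 0 < sigma -> sigma < 1 ->
  m%:R + sigma < s -> exists2 C : R, 0 <= C & forall D,
  measurable_fun setT (D m) -> measurable_fun setT (D m.+1) ->
  (exists M, forall t, `|D m.+1 t| <= M) -> {in I0 T, D m =1 RLint 1 (D m.+1)} ->
  (energy p T (RLint (1 - sigma) (D m.+1)) <= C%:E * slobodecki_energy s p T D)%E.
Proof.
move=> T0 p1 s0 s1 ms; have c0 : 0 < 1 - sigma by rewrite subr_gt0.
have sp : 0 <= s by rewrite ltW// (lt_trans _ ms)// ltr_wpDl.
have mj : (m <= Num.truncn s)%N by rewrite truncn_ge_nat// (le_trans _ (ltW ms))// lerDl ltW.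
have [mj'|jm] := ltnP m (Num.truncn s).
  exists (RLnorm (1 - sigma) T `^ p); first exact: powR_ge0.
  move=> D mD mD1 _ _; apply: le_trans (energy_RLint c0 p1 T0 mD1) _.
  by apply: lee_wpmul2l; [rewrite lee_fin powR_ge0|exact: energy_le_slobodecki].
have jE : Num.truncn s = m by apply/eqP; rewrite eqn_leq jm.
have sth : sigma < s - m%:R by rewrite ltrBrDl.
have th1 : s - m%:R < 1 by rewrite ltrBlDl natr1 -jE truncnS_gt.
have [C C0 HC] := RLint_marchaud_bound T0 p1 s0 sth th1.
exists C => // D mD mD1 [M HM] DE.
apply: le_trans (HC _ M mD1 (fun t _ _ => HM t)) _; apply: lee_wpmul2l; first by rewrite lee_fin.
rewrite -(eq_energy _ DE) -(@ae_gagliardo _ _ _ _ (D m)); last 3 first.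
- exact: measurable_funTS.
- by apply: measurable_funTS; exact: measurable_RLint.
- exact: eq_in_ae.
apply: leeD.
  apply: (@le_trans _ _ (\sum_(i < (Num.truncn s).+1) energy p T (D i))%E).
    rewrite (bigD1 (Ordinal (ltnSn (Num.truncn s))))//= jE leeDl//.
    by apply: sume_ge0 => k _; exact: energy_ge0.
  exact: lexx.
by rewrite /gagliardo0 jE gt_eqF// (lt_trans s0).
Qed.

End zero_trace_spaces.

(** * The inclusion of (ii) *)

Section zero_trace_embedding.
Context {R : realType}.
Local Notation mu := (@lebesgue_measure R).
Local Notation I0 T := (`]0%R, T[%classic : set R).
Implicit Types (p s T theta sigma : R) (f g u v : R -> R) (d D : nat -> R -> R).

Lemma smoothness_gt s (m : nat) : m%:R < s -> (m < smoothness s)%N.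
Proof.
move=> ms; have s0 : 0 <= s by rewrite (le_trans _ (ltW ms)).
rewrite /smoothness; case: eqP => [sE|_].
  by rewrite -(ltr_nat R) -sE.
by rewrite ltnS truncn_ge_nat// ltW.
Qed.

Lemma smoothness_ge s : (Num.truncn s <= smoothness s)%N.
Proof. by rewrite /smoothness; case: ifP => //. Qed.

Lemma RLint1_sub T u v t : 0 < T -> mLp 1 T u -> mLp 1 T v -> t <= T ->
  RLint 1 (fun x => u x - v x) t = RLint 1 u t - RLint 1 v t.
Proof.
move=> T0 Lu Lv tT; rewrite !RLint1E.
have sub : I0 t `<=` I0 T.
  by move=> x /=; rewrite !in_itv/= => /andP[-> /lt_le_trans ->].
apply: RintegralB => //.
- exact: integrableS (mLp_integrable (lexx _) T0 Lu).
- exact: integrableS (mLp_integrable (lexx _) T0 Lv).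
Qed.

(** One fixed family [W] represents the derivatives of u, globally measurable, so that approximation
    of u becomes smallness of explicit energies of W - D, free of [wderiv]. *)
Lemma zeroW_approx s p T u : 1 <= p -> 0 < T -> zeroW s p T u ->
  exists W, [/\ forall i, (i <= Num.truncn s)%N -> mLp p T (W i),
    {in I0 T, u =1 W 0%N} &
    forall eta, 0 < eta -> exists2 D, primitive_chain (smoothness s) T D &
      (slobodecki_energy s p T (fun i t => W i t - D i t)%R <= eta%:E)%E].
Proof.
move=> p1 T0 [su Hu]; have p0 : 0 < p by exact: lt_le_trans p1.
have [d [d0 ud foo]] := (slobodeckiP s u p0 T0).1 su.
have md i : (i <= Num.truncn s)%N -> measurable_fun (I0 T) (d i).
  by move=> /ud /is_wderiv_measurable.
pose W i := d i \_ (I0 T).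
have DW i : {in I0 T, d i =1 W i} by move=> t tD; rewrite /W patchE tD.
have mW i : (i <= Num.truncn s)%N -> measurable_fun setT (W i).
  by move=> /md m1; exact/(measurable_restrictT _ (measurable_itv _)).
have LW i : (i <= Num.truncn s)%N -> mLp p T (W i).
  move=> ij; split; first exact: mW.
  rewrite -(eq_energy _ (DW i)); apply: le_lt_trans foo; exact: energy_le_slobodecki.
have uW i : (i <= Num.truncn s)%N -> is_wderiv T i u (W i).
  move=> ij; have [lu lw H] := ud i ij; split => //.
    exact: mLp1_locally_integrable T0 (mLp1 p1 T0 (LW i ij)).
  move=> phi tphi; rewrite H//; congr (_ * _); apply: eq_Rintegral => t tD.
  by rewrite DW.
exists W; split; first exact: LW.
  by rewrite -d0; exact: DW.
move=> eta eta0; have e0 : 0 < eta `^ p^-1 by rewrite powR_gt0.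
have [v zv uv] := Hu _ e0; have [D cD vD] := zeroC_chain T0 zv.
exists D => //.
have cw i : (i <= Num.truncn s)%N -> is_wderiv T i v (D i).
  move=> ij; have := chain_wderiv T0 cD (leq_trans ij (smoothness_ge s) : (0 + i <= _)%N).
  apply: eq_wderiv; last by apply: eq_in_ae => t tD; rewrite vD.
  apply: eq_measurable_fun (measurable_funTS (cD.1 0%N (leq0n _)).1) => t tD.
  by rewrite vD.
have wB i : (i <= Num.truncn s)%N -> is_wderiv T i (u \- v) (fun t => W i t - D i t).
  by move=> ij; exact: is_wderivB T0 (uW i ij) (cw i ij).
move: uv; rewrite slobodecki_normE// (eq_slobodecki_energy _ T0 wB) => H.
have := poweR_le (ltW p0) (poweR_ge0 _ _) (ltW H).
rewrite -poweRrM mulVf ?gt_eqF// poweRe1 ?slobodecki_energy_ge0//.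
by rewrite poweR_EFin -powRrM mulVf ?gt_eqF// powRr1// ltW.
Qed.

(** The fractional derivatives of the approximants form a Cauchy sequence in L^p, and J^(m + sigma)
    of their limit is u. Here [m] is the integer part of the order. *)
Theorem zeroW_RLint s p T sigma (m : nat) u : 0 < T -> 1 <= p -> 0 < sigma -> sigma < 1 ->
  m%:R + sigma < s -> zeroW s p T u ->
  exists2 g, mLp p T g & eq_ae0T T (RLint (m%:R + sigma) g) u.
Proof.
move=> T0 p1 s0 s1 ms zu; have p0 : 0 < p by exact: lt_le_trans p1.
have pw := ltW p0.
have sm : m%:R < s by rewrite (lt_trans _ ms)// ltrDl.
have mk := smoothness_gt sm.
have mu0 : measurable_fun (I0 T) u := ((LpP T u p0).1 zu.1.1.1).1.
have [W [LW uW HW]] := zeroW_approx p1 T0 zu.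
have [C C0 HC] := chain_bound T0 p1 s0 s1 ms.
have /choice[D HD] : forall n : nat, exists D, primitive_chain (smoothness s) T D /\
    (slobodecki_energy s p T (fun i t => W i t - D i t)%R <= (n.+1%:R^-1)%:E)%E.
  by move=> n; have [|D h1 h2] := HW n.+1%:R^-1; [rewrite invr_gt0|exists D].
have cD n := (HD n).1; have eD n := (HD n).2.
have mD n i : (i <= smoothness s)%N -> measurable_fun setT (D n i).
  by move=> ik; exact: ((cD n).1 i ik).1.
have LD q n i : 0 <= q -> (i <= smoothness s)%N -> mLp q T (D n i).
  by move=> q0 ik; have [m1 b1] := (cD n).1 i ik; exact: mLp_bounded1.
have c0 : 0 < 1 - sigma by rewrite subr_gt0.
(* The fractional derivative of order m + sigma of the n-th approximant. *)
pose x n := RLint (1 - sigma) (D n m.+1).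
have Lx n : mLp p T (x n) by exact: mLp_RLint c0 p1 T0 (LD _ _ _ pw mk).
have cauchy n l : (energy p T (fun t => x n t - x l t)%R <=
    (C * (2 `^ p * (l.+1%:R^-1 + n.+1%:R^-1)))%:E)%E.
  pose E i t := D n i t - D l i t.
  have mE i : (i <= smoothness s)%N -> measurable_fun setT (E i).
    by move=> ik; exact: measurable_funB (mD n i ik) (mD l i ik).
  have E1 : energy p T (fun t => x n t - x l t) = energy p T (RLint (1 - sigma) (E m.+1)).
    apply: ae_energy.
    - by apply: measurable_funTS; exact: measurable_funB (Lx n).1 (Lx l).1.
    - by apply: measurable_funTS; apply: measurable_RLint; exact: mE.
    have := RLintB_ae c0 T0 (LD 1 n m.+1 ler01 mk) (LD 1 l m.+1 ler01 mk).
    by apply: filterS => t H Dt; rewrite -H.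
  have E2 : {in I0 T, E m =1 RLint 1 (E m.+1)}.
    move=> t tD; have tT : t <= T by move: tD; rewrite inE/= in_itv/= => /andP[_ /ltW].
    rewrite {1}/E ((cD n).2 _ mk _ tD) ((cD l).2 _ mk _ tD); apply: esym.
    exact: (RLint1_sub T0 (LD 1 n m.+1 ler01 mk) (LD 1 l m.+1 ler01 mk) tT).
  have [M1 HM1] := ((cD n).1 m.+1 mk).2; have [M2 HM2] := ((cD l).1 m.+1 mk).2.
  have bE : exists M, forall t, `|E m.+1 t| <= M.
    exists (M1 + M2) => t; apply: le_trans (ler_normB _ _) _; exact: lerD.
  rewrite E1; apply: le_trans (HC E (mE _ (ltnW mk)) (mE _ mk) bE E2) _.
  rewrite EFinM; apply: lee_wpmul2l; first by rewrite lee_fin.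
  (* The two approximants are compared through the derivatives of u, to which both are close. *)
  have -> : E = (fun i t => (W i t - D l i t) - (W i t - D n i t)).
    by apply/funext => i; apply/funext => t; rewrite /E; ring.
  have mWD k i : (i <= Num.truncn s)%N -> measurable_fun setT (fun t => W i t - D k i t).
    move=> ij; apply: measurable_funB (LW i ij).1 (mD k i _).
    exact: leq_trans ij (smoothness_ge s).
  apply: le_trans (@slobodecki_energyB _ s p T (fun i t => W i t - D l i t) (fun i t => W i t - D n i t) pw (mWD l) (mWD n)) _.
  rewrite EFinM; apply: lee_wpmul2l; first by rewrite lee_fin powR_ge0.
  by rewrite EFinD; apply: leeD.
have [g Lg Hg] : exists2 g, mLp p T g & forall e, 0 < e -> exists N, forall n, (N <= n)%N ->
    (energy p T (fun t => x n t - g t)%R <= e%:E)%E.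
  apply: energy_complete => // e e0.
  have [eta eta0 he] := mul_small (mulr_ge0 C0 (powR_ge0 2 p)) e0.
  have eta2 : 0 < eta / 2 by rewrite divr_gt0.
  exists (Num.truncn (eta / 2)^-1) => n l Nn Nl; apply: le_trans (cauchy n l) _.
  have small k : (Num.truncn (eta / 2)^-1 <= k)%N -> k.+1%:R^-1 <= eta / 2.
    move=> Nk; rewrite -[leRHS]invrK lef_pV2 ?posrE ?invr_gt0//.
    by apply: le_trans (ltW (truncnS_gt _)) _; rewrite ler_nat ltnS.
  rewrite lee_fin mulrA; apply: le_trans he; rewrite ler_wpM2l ?mulr_ge0 ?powR_ge0//.
  by rewrite [leRHS]splitr lerD// small.
exists g => //.
pose al := m%:R + sigma; have al0 : 0 < al by rewrite ltr_wpDl.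
have mg := measurable_RLint al Lg.1.
have uW' : eq_ae0T T (W 0%N) u by apply: eq_in_ae => t tD; rewrite uW.
suff WR : eq_ae0T T (W 0%N) (RLint al g) by apply: (ae_imply2 WR uW') => t Dt <-.
apply: (energy_limit_unique p0 (measurable_funTS (LW 0%N (leq0n _)).1) (measurable_funTS mg)).
move=> e e0.
have A0 : 0 <= 2 `^ p * RLnorm al T `^ p by rewrite mulr_ge0 ?powR_ge0.
have e2 : 0 < e / 2 by rewrite divr_gt0.
have [e1 e10 he1] := mul_small (powR_ge0 2 p) e2.
have [e3 e30 he3] := mul_small A0 e2.
have [N HN] := Hg _ e30.
pose n := maxn N (Num.truncn e1^-1).
(* D_0 = J^(m+1) D_(m+1), and m + 1 = al + (1 - sigma). *)
have D0 : eq_ae0T T (D n 0%N) (RLint al (x n)).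
  have H1 := chain_RLint T0 (cD n) (mk : (0 + m.+1 <= _)%N).
  have H2 := RLint_semigroup al0 c0 T0 (LD 1 n m.+1 ler01 mk).
  have E : al + (1 - sigma) = m.+1%:R by rewrite /al -natr1; ring.
  rewrite E in H2.
  by apply: (ae_imply2 H1 H2) => t Dt; rewrite add0n => h1 h2; rewrite h1 -h2.
have Lxg := mLpB pw (Lx n) Lg.
(* The error u - J^al g is the approximation error of u plus J^al (x_n - g); both are small for
   large n. *)
have -> : energy p T (fun t => W 0%N t - RLint al g t) =
    energy p T (fun t => (W 0%N t - D n 0%N t) + RLint al (fun t => x n t - g t) t).
  apply: ae_energy.
  - by apply: measurable_funTS; exact: measurable_funB (LW 0%N (leq0n _)).1 mg.
  - apply: measurable_funTS; apply: measurable_funD (measurable_RLint al Lxg.1).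
    exact: measurable_funB (LW 0%N (leq0n _)).1 (mD n 0%N (leq0n _)).
  have H := RLintB_ae al0 T0 (mLp1 p1 T0 (Lx n)) (mLp1 p1 T0 Lg).
  by apply: (ae_imply2 D0 H) => t Dt -> ->; ring.
apply: le_trans (energyD pw _ _) _.
- by apply: measurable_funTS; exact: measurable_funB (LW 0%N (leq0n _)).1 (mD n 0%N (leq0n _)).
- exact: (measurable_funTS (measurable_RLint al Lxg.1)).
have h1 : (energy p T (fun t => W 0%N t - D n 0%N t)%R <= e1%:E)%E.
  apply: le_trans (energy_le_slobodecki p T (fun i t => W i t - D n i t) (leq0n (Num.truncn s))) _.
  apply: le_trans (eD n) _; rewrite lee_fin -[leRHS]invrK lef_pV2 ?posrE ?invr_gt0//.
  by apply: le_trans (ltW (truncnS_gt _)) _; rewrite ler_nat ltnS leq_maxr.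
have h2 := energy_RLint_le al0 p1 T0 Lxg.1 (HN n (leq_maxl _ _)).
apply: (@le_trans _ _ ((2 `^ p)%:E * (e1 + RLnorm al T `^ p * e3)%:E)%E).
  apply: lee_wpmul2l; first by rewrite lee_fin powR_ge0.
  by rewrite EFinD; apply: leeD.
by rewrite -EFinM lee_fin mulrDr mulrA [leRHS]splitr lerD.
Qed.

End zero_trace_embedding.

(** * Compactness of J^c on L^p along ultrafilters *)

Section compactness.
Context {R : realType}.
Local Notation mu := (@lebesgue_measure R).
Local Notation I0 T := (`]0%R, T[%classic : set R).
Implicit Types (p s T c : R) (f g u v w : R -> R).

(** Compactness of [-B, B] gives a cluster point. An ultrafilter contains each set or its
    complement, so clustering along it is already convergence. *)
Lemma ultra_bounded_cvg (U : set_system nat) (x : nat -> R) (B : R) :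
  UltraFilter U -> (forall n, `|x n| <= B) ->
  exists l, forall e, 0 < e -> U [set n | `|x n - l| <= e].
Proof.
move=> UU xB; have K := segment_compact (a := - B) (b := B).
have PF : ProperFilter (x @ U) by exact: fmap_proper_filter.
have xK : (x @ U) `[- B, B]%classic.
  have H n : `[- B, B]%classic (x n) by rewrite /= in_itv/= -ler_norml.
  exact: (@filterE _ U _ _ H).
have [l [_ cl]] := K _ PF xK; exists l => e e0.
have [//|nU] := in_ultra_setVsetC [set n | `|x n - l| <= e] UU.
have nl : nbhs l (ball l e) by exact: nbhsx_ballx.
have xn : (x @ U) [set y | ~ `|y - l| <= e] by [].
have [y [/= h1 h2]] := cl _ _ xn nl.
by exfalso; apply: h1; rewrite distrC ltW.
Qed.

Lemma RLint1_lipschitz T v (L : R) t t' : mLp 1 T v -> (forall x, `|v x| <= L) ->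
  0 <= t -> t <= t' -> t' <= T -> `|RLint 1 v t' - RLint 1 v t| <= L * (t' - t).
Proof.
move=> Lv HL t0; rewrite le_eqVlt => /predU1P[<- _|tt' t'T].
  by rewrite !subrr mulr0 normr0.
rewrite (RLint1B Lv)// ?(ltW tt')// -lee_fin.
have mv : measurable_fun (`]t, t'[%classic : set R) v by exact: measurable_funTS Lv.1.
apply: le_trans (le_Rintegral_abs (measurable_itv _) mv) _.
apply: (@le_trans _ _ (\int[mu]_(x in `]t, t'[) (cst L%:E) x)%E).
  apply: ge0_le_integral => //.
  - by apply/measurable_EFinP; exact: measurableT_comp.
  - by move=> x _; rewrite lee_fin.
rewrite integral_cst//= lebesgue_measure_itv/= lte_fin tt' -EFinB -EFinM.
by [].
Qed.

Let dist_triangle3 (a b c d : R) : `|a - d| <= `|a - b| + `|b - c| + `|d - c|.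
Proof.
have -> : a - d = (a - b) + (b - c) - (d - c) by ring.
by apply: le_trans (ler_normB _ _) _; rewrite lerD2r ler_normD.
Qed.

Lemma ultra_equicontinuous (U : set_system nat) T (L eta : R) (y : nat -> R -> R) :
  UltraFilter U -> 0 < T -> (forall n, measurable_fun setT (y n)) ->
  (forall n t, `|y n t| <= L) -> 0 < eta ->
  exists2 A, U A & forall n m t, A n -> A m -> 0 < t -> t < T ->
    `|RLint 1 (y n) t - RLint 1 (y m) t| <= eta.
Proof.
move=> UU T0 my HL eta0; have L0 : 0 <= L by rewrite (le_trans _ (HL 0%N 0)).
have Ly n : mLp 1 T (y n) by apply: mLp_bounded1 => //; exists L.
have eta4 : 0 < eta / 4 by rewrite divr_gt0.
have [e e0 he] := mul_small (mulr_ge0 L0 (ltW T0)) eta4.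
pose N := Num.truncn e^-1.
have Ne : N.+1%:R^-1 <= e.
  by rewrite -[leRHS]invrK lef_pV2 ?posrE ?invr_gt0// ltW// truncnS_gt.
(* The mesh T/(N+1) is at most T e, so the Lipschitz bound costs L T e <= eta/4 on either side;
   eta/2 is left for the difference at the grid points. *)
pose x l := T * l%:R / N.+1%:R.
have x0 l : 0 <= x l by rewrite divr_ge0// mulr_ge0// ltW.
have xT l : (l <= N)%N -> x l <= T.
  move=> lN; rewrite /x ler_pdivrMr// ler_pM2l// ler_nat; exact: leqW.
have F0 n t : 0 <= t -> t <= T -> `|RLint 1 (y n) t| <= L * T.
  move=> t0 tT; have := RLint1_lipschitz (Ly n) (HL n) (lexx 0) t0 tT.
  by rewrite RLint1_0 !subr0 => /le_trans; apply; rewrite ler_wpM2l.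
have lim l : (l <= N)%N -> exists z, forall d, 0 < d -> U [set n | `|RLint 1 (y n) (x l) - z| <= d].
  move=> lN; apply: (@ultra_bounded_cvg U _ (L * T)) => // n.
  by apply: F0; [exact: x0|exact: xT].
have [A UA HA] : exists2 A, U A & forall l n m, (l < N.+1)%N -> A n -> A m ->
    `|RLint 1 (y n) (x l) - RLint 1 (y m) (x l)| <= eta / 2.
  have : forall k, (k <= N.+1)%N -> exists2 A, U A & forall l n m, (l < k)%N -> A n -> A m ->
      `|RLint 1 (y n) (x l) - RLint 1 (y m) (x l)| <= eta / 2.
    elim=> [_|k IH kN]; first by exists setT => //; exact: filterT.
    have [A UA HA] := IH (ltnW kN); have [z Hz] := lim k kN.
    exists (A `&` [set n | `|RLint 1 (y n) (x k) - z| <= eta / 4]).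
      by apply: filterI => //; exact: Hz.
    move=> l n m; rewrite ltnS leq_eqVlt => /predU1P[->|lk] [An zn] [Am zm]; last exact: HA.
    have -> : RLint 1 (y n) (x k) - RLint 1 (y m) (x k) =
      (RLint 1 (y n) (x k) - z) - (RLint 1 (y m) (x k) - z) by ring.
    apply: le_trans (ler_normB _ _) _; apply: le_trans (lerD zn zm) _.
    by rewrite (_ : eta / 4 + eta / 4 = eta / 2)//; lra.
  by move=> /(_ _ (leqnn _)).
exists A => // n m t An Am t0 tT.
pose l := Num.truncn (t * N.+1%:R / T).
have a0 : 0 <= t * N.+1%:R / T by rewrite divr_ge0 ?(ltW T0)// mulr_ge0// ltW.
have lN : (l < N.+1)%N.
  by rewrite truncn_lt_nat// ltr_pdivrMr// mulrC ltr_pM2l.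
have xlt : x l <= t.
  rewrite /x ler_pdivrMr// mulrC -ler_pdivlMr//; by rewrite truncn_le.
have txl : t - x l <= T * e.
  have : t <= x l + T / N.+1%:R.
    have -> : x l + T / N.+1%:R = l.+1%:R * T / N.+1%:R.
      by rewrite /x -[l.+1%:R]natr1; ring.
    have := truncnS_gt (t * N.+1%:R / T); rewrite -/l ltr_pdivrMr// => /ltW h.
    by rewrite ler_pdivlMr.
  move=> h; rewrite lerBlDl (le_trans h)// lerD2l ler_pM2l//.
have lip k : `|RLint 1 (y k) t - RLint 1 (y k) (x l)| <= eta / 4.
  apply: le_trans (RLint1_lipschitz (Ly k) (HL k) (x0 l) xlt (ltW tT)) _.
  by apply: le_trans he; rewrite -mulrA ler_wpM2l.
apply: le_trans (dist_triangle3 _ (RLint 1 (y n) (x l)) (RLint 1 (y m) (x l)) _) _.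
have := HA l n m lN An Am; have := lip n; have := lip m; lra.
Qed.

Lemma ultra_RLint (U : set_system nat) c p T (M eta : R) (v : nat -> R -> R) :
  UltraFilter U -> 0 < c -> 1 <= p -> 0 < T -> 0 <= M ->
  (forall n, mLp p T (v n)) -> (forall n, (energy p T (v n) <= M%:E)%E) -> 0 < eta ->
  exists2 A, U A & forall n m, A n -> A m ->
    (energy p T (fun t => RLint c (v n) t - RLint c (v m) t)%R <= eta%:E)%E.
Proof.
move=> UU; wlog c1 : c eta / c < 1.
  (* An order b < 1 is split off for the truncation; J^(c-b), bounded on L^p, carries the estimate
     over to order c. *)
  move=> wl c0 p1 T0 M0 Lv vM eta0; pose b := Num.min c 1 / 2.
  have m0 : 0 < Num.min c 1 by rewrite lt_min c0 ltr01.
  have mc : Num.min c 1 <= c by rewrite ge_min lexx.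
  have m1 : Num.min c 1 <= 1 by rewrite ge_min lexx orbT.
  have b0 : 0 < b by rewrite divr_gt0.
  have bc : 0 < c - b by rewrite /b; lra.
  have b1 : b < 1 by rewrite /b; lra.
  have [e e0 he] := mul_small (powR_ge0 (RLnorm (c - b) T) p) eta0.
  have [A UA HA] := wl b e b1 b0 p1 T0 M0 Lv vM e0.
  exists A => // n m An Am.
  have Lb k := mLp_RLint b0 p1 T0 (Lv k).
  have Lc k := mLp_RLint c0 p1 T0 (Lv k).
  have LB := mLpB (le_trans ler01 p1) (Lb n) (Lb m).
  have -> : energy p T (fun t => RLint c (v n) t - RLint c (v m) t) =
      energy p T (RLint (c - b) (fun t => RLint b (v n) t - RLint b (v m) t)).
    apply: ae_energy.
    - by apply: measurable_funTS; exact: measurable_funB (Lc n).1 (Lc m).1.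
    - exact: measurable_funTS (measurable_RLint (c - b) LB.1).
    have H1 := RLintB_ae bc T0 (mLp1 p1 T0 (Lb n)) (mLp1 p1 T0 (Lb m)).
    have S k := RLint_semigroup bc b0 T0 (mLp1 p1 T0 (Lv k)).
    have H2 := ae_imply2 (S n) (S m) (fun _ _ => @conj _ _).
    by apply: (ae_imply2 H1 H2) => t Dt h1 [h2 h3]; rewrite h1 h2 h3 subrK.
  by apply: le_trans (energy_RLint_le bc p1 T0 LB.1 (HA n m An Am)) _; rewrite lee_fin.
move=> c0 p1 T0 M0 Lv vM eta0; have p0 : 0 < p by exact: lt_le_trans p1.
(* Two truncation errors of size e, met by two quasi-triangle inequalities with factor 2^p each. *)
have A0 : 0 <= 2 `^ p * 2 `^ p * 2 by rewrite !mulr_ge0 ?powR_ge0.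
have eta2 : 0 < eta / 2 by rewrite divr_gt0.
have [e e0 he] := mul_small A0 eta2.
have [L HL] := RLint_truncation_uniform c0 c1 p1 T0 M0 e0.
have /choice[y Hy] n := HL (v n) (Lv n) (vM n).
have my n : measurable_fun setT (y n) by have [] := Hy n.
have yL n t : `|y n t| <= L by have [_ + _] := Hy n.
have ey n : (energy p T (fun t => RLint c (v n) t - RLint 1 (y n) t)%R <= e%:E)%E by have [] := Hy n.
(* A uniform bound e'^(1/p) on (0,T) amounts to an energy of at most e' T. *)
have [e' e'0 he'] := mul_small (mulr_ge0 (powR_ge0 2 p) (ltW T0)) eta2.
have e'p : 0 < e' `^ p^-1 by rewrite powR_gt0.
have [A UA HA] := ultra_equicontinuous UU T0 my yL e'p.
exists A => // n m An Am.
have m1 k := measurable_RLint 1 (my k).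
have mc k := measurable_RLint c (Lv k).1.
have md k : measurable_fun (I0 T) (fun t => RLint c (v k) t - RLint 1 (y k) t).
  by apply: measurable_funTS; exact: measurable_funB (mc k) (m1 k).
have mdd : measurable_fun (I0 T) (fun t => (RLint c (v n) t - RLint 1 (y n) t) - (RLint c (v m) t - RLint 1 (y m) t)).
  exact: measurable_funB (md n) (md m).
have m11 : measurable_fun (I0 T) (fun t => RLint 1 (y n) t - RLint 1 (y m) t).
  by apply: measurable_funTS; exact: measurable_funB (m1 n) (m1 m).
have -> : (fun t => RLint c (v n) t - RLint c (v m) t) = (fun t =>
    ((RLint c (v n) t - RLint 1 (y n) t) - (RLint c (v m) t - RLint 1 (y m) t)) +
    (RLint 1 (y n) t - RLint 1 (y m) t)).
  by apply/funext => t; ring.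
apply: le_trans (energyD (ltW p0) mdd m11) _.
have h1 : (energy p T (fun t => RLint 1 (y n) t - RLint 1 (y m) t)%R <= (e' * T)%:E)%E.
  apply: (@le_trans _ _ (\int[mu]_(t in I0 T) (cst e'%:E) t)%E).
    apply: ge0_le_integral => //.
    - exact: measurable_energy.
    move=> t; rewrite /= in_itv/= => /andP[t0 tT]; rewrite lee_fin.
    have -> : e' = (e' `^ p^-1) `^ p by rewrite -powRrM mulVf ?gt_eqF// powRr1// ltW.
    by apply: ler_powR_base; [exact: ltW| |exact: HA].
  by rewrite integral_cst//= lebesgue_measure_itv/= lte_fin T0 -EFinB -EFinM subr0.
have h2 : (energy p T (fun t => (RLint c (v n) t - RLint 1 (y n) t) - (RLint c (v m) t - RLint 1 (y m) t))%R
    <= (2 `^ p * (e + e))%:E)%E.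
  apply: le_trans (energyB (ltW p0) (md n) (md m)) _; rewrite EFinM.
  apply: lee_wpmul2l; first by rewrite lee_fin powR_ge0.
  by rewrite EFinD; apply: leeD.
apply: (@le_trans _ _ ((2 `^ p)%:E * (2 `^ p * (e + e) + e' * T)%:E)%E).
  apply: lee_wpmul2l; first by rewrite lee_fin powR_ge0.
  by rewrite EFinD; apply: leeD.
rewrite -EFinM lee_fin; lra.
Qed.

(** For every k the ultrafilter has a member on which the images differ by at most 1/(k+1) in
    energy; an increasing choice of indices from these members is Cauchy, and L^p is complete. *)
Lemma RLint_compact c p T (M : R) (v : nat -> R -> R) : 0 < c -> 1 <= p -> 0 < T ->
  (forall n, mLp p T (v n)) -> (forall n, (energy p T (v n) <= M%:E)%E) ->
  exists h : nat -> nat, {homo h : i j / (i < j)%N} /\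
    exists2 w, mLp p T w & forall e, 0 < e -> exists N, forall n, (N <= n)%N ->
      (energy p T (fun t => RLint c (v (h n)) t - w t)%R <= e%:E)%E.
Proof.
move=> c0 p1 T0 Lv vM.
have M0 : 0 <= M by rewrite -lee_fin (le_trans _ (vM 0%N))// energy_ge0.
have [U [UU Uoo]] := ultraFilterLemma (eventually_filter : ProperFilter \oo).
have /choice[A HA] k : exists A, U A /\ forall n m, A n -> A m ->
    (energy p T (fun t => RLint c (v n) t - RLint c (v m) t)%R <= (k.+1%:R^-1)%:E)%E.
  have [|A UA H] := @ultra_RLint U c p T M k.+1%:R^-1 v UU c0 p1 T0 M0 Lv vM; last by exists A.
  by rewrite invr_gt0.
(* Nested, so that an index chosen at stage n also lies in every earlier [A K]. *)
pose B k := \bigcap_(i in `I_k.+1) A i.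
have UB k : U (B k).
  elim: k => [|k IH].
    have -> : B 0%N = A 0%N.
      apply/seteqP; split => [x /(_ 0%N)|x Ax [|i]//]; by apply.
    exact: (HA 0%N).1.
  apply: filterS (filterI IH (HA k.+1).1) => x [Bx Ax] i /=; rewrite ltnS leq_eqVlt.
  by case/predU1P => [->//|ik]; exact: Bx.
(* The ultrafilter refines the filter at infinity, so its members contain arbitrarily large
   indices. *)
have sel : forall kN : nat * nat, exists n, (kN.2 <= n)%N /\ B kN.1 n.
  move=> [k N]; have UN : U [set n | (N <= n)%N] by apply: Uoo; exists N.
  by have [n [Bn Nn]] := filter_ex (filterI (UB k) UN); exists n.
have /choice[f Hf] := sel.
pose h := fix h k := if k is k'.+1 then f (k, (h k').+1) else f (0%N, 0%N).
have hS k : (h k < h k.+1)%N by have [] := Hf (k.+1, (h k).+1).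
have hB k : B k (h k).
  by case: k => [|k]; [have [] := Hf (0%N, 0%N)|have [] := Hf (k.+1, (h k).+1)].
exists h; split; first exact: (homo_ltn ltn_trans hS).
have LR n := mLp_RLint c0 p1 T0 (Lv (h n)).
apply: energy_complete => // e e0; exists (Num.truncn e^-1) => n m Nn Nm.
apply: le_trans ((HA (Num.truncn e^-1)).2 (h n) (h m) _ _) _; [exact: hB|exact: hB|].
by rewrite lee_fin -[leRHS]invrK lef_pV2 ?posrE ?invr_gt0// ltW// truncnS_gt.
Qed.

End compactness.

(** * The spaces J^a L^p and the compact embedding of (iii) *)

Section riemann_liouville_spaces.
Context {R : realType}.
Local Notation mu := (@lebesgue_measure R).
Local Notation I0 T := (`]0%R, T[%classic : set R).
Implicit Types (p s T a c : R) (f g u v w : R -> R).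

Lemma RLspace_mLp a p T u : 0 < p -> RLspace a p T u ->
  exists2 v, mLp p T v & eq_ae0T T (RLint a v) u.
Proof.
move=> p0 [Lu [v0 Lv0 vu0]]; exists (v0 \_ (I0 T)); first exact: Lp_mLp.
have H := RLint_restrict a ((LpP T v0 p0).1 Lv0).1.
by apply: filterS vu0 => x Hx Dx; rewrite -H ?inE// Hx.
Qed.

Lemma mLp_RLspace a p T u v : 0 < a -> 1 <= p -> 0 < T -> measurable_fun (I0 T) u ->
  mLp p T v -> eq_ae0T T (RLint a v) u -> RLspace a p T u.
Proof.
move=> a0 p1 T0 mu0 Lv vu; have p0 : 0 < p by exact: lt_le_trans p1.
split; last by exists v => //; exact: mLp_Lp.
have Lav := mLp_RLint a0 p1 T0 Lv.
apply/(LpP T u p0).2; split; first exact: mu0.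
by rewrite -(ae_energy _ (measurable_funTS Lav.1) mu0 vu); exact: Lav.2.
Qed.

(** Injectivity of J^a forces the preimage chosen by [RLint_inv] to agree almost everywhere with v,
    so the norm can be read off any preimage. *)
Lemma RLspace_normE a p T u v : 0 < a -> 1 <= p -> 0 < T ->
  mLp p T v -> eq_ae0T T (RLint a v) u ->
  RLspace_norm a p T u = (energy p T v `^ p^-1)%E.
Proof.
move=> a0 p1 T0 Lv vu; have p0 : 0 < p by exact: lt_le_trans p1.
rewrite /RLspace_norm (Lp_normE _ _ (lt0r_neq0 p0)); congr poweR.
have : Lp p T (RLint_inv a p T u) /\ eq_ae0T T (RLint a (RLint_inv a p T u)) u.
  rewrite /RLint_inv; case: xgetP => [z -> //|/(_ v)]; case; split => //.
  exact: mLp_Lp.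
move: (RLint_inv a p T u) => z [Lz zu].
have mz := ((LpP T z p0).1 Lz).1.
pose z' := z \_ (I0 T); have Lz' : mLp p T z' := Lp_mLp p0 Lz.
have zz' : {in I0 T, z =1 z'} by move=> t tD; rewrite /z' patchE tD.
rewrite (eq_energy _ zz'); apply: ae_energy.
- exact: measurable_funTS Lz'.1.
- exact: measurable_funTS Lv.1.
have LB := mLpB (ltW p0) Lz' Lv.
have H : eq_ae0T T (RLint a (fun t => z' t - v t)) (cst 0).
  have H1 := RLintB_ae a0 T0 (mLp1 p1 T0 Lz') (mLp1 p1 T0 Lv).
  have H2 := eq_in_ae (RLint_restrict a mz).
  have H3 := ae_imply2 zu vu (fun _ _ => @conj _ _).
  have H12 := ae_imply2 H1 H2 (fun _ _ => @conj _ _).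
  by apply: (ae_imply2 H12 H3) => t Dt [h1 h2] [h3 h4]; rewrite h1 -h2 h3 h4 subrr.
have := RLint_inj T0 a0 (mLp1 p1 T0 LB) H.
by apply: filterS => t Ht Dt; apply/eqP; rewrite -subr_eq0; apply/eqP; exact: Ht.
Qed.

Lemma cvg_poweR0 (x : nat -> \bar R) p : 0 < p -> (forall n, (0 <= x n)%E) ->
  (forall e, 0 < e -> exists N, forall n, (N <= n)%N -> (x n <= e%:E)%E) ->
  (x n `^ p^-1)%E @[n --> \oo] --> 0%E.
Proof.
move=> p0 x0 H.
have H' e : 0 < e -> exists N, forall n, (N <= n)%N -> (x n `^ p^-1 <= e%:E)%E.
  move=> e0; have ep : 0 < e `^ p by rewrite powR_gt0.
  have [N HN] := H _ ep; exists N => n Nn.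
  have -> : e%:E = ((e `^ p)%:E `^ p^-1)%E.
    by rewrite poweR_EFin -powRrM mulfV ?gt_eqF// powRr1// ltW.
  by apply: poweR_le; [rewrite invr_ge0 ltW|exact: x0|exact: HN].
apply/fine_cvgP; split.
  have [N HN] := H' 1 ltr01; exists N => // n /= /HN h.
  by rewrite ge0_fin_numE ?poweR_ge0// (le_lt_trans h)// ltry.
apply/cvgrPdist_le => e e0; have [N HN] := H' e e0; exists N => // n /= /HN h.
rewrite sub0r normrN ger0_norm ?fine_ge0 ?poweR_ge0//.
by rewrite -lee_fin fineK// ge0_fin_numE ?poweR_ge0// (le_lt_trans h)// ltry.
Qed.

Lemma RLspace_split a c p T u : 0 < a -> 0 < c -> 1 <= p -> 0 < T ->
  RLspace (a + c) p T u -> exists v, [/\ mLp p T v,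
    eq_ae0T T (RLint (a + c) v) u & eq_ae0T T (RLint a (RLint c v)) u].
Proof.
move=> a0 c0 p1 T0 Xu; have p0 : 0 < p by exact: lt_le_trans p1.
have [v Lv vu] := RLspace_mLp p0 Xu; exists v; split => //.
by apply: (ae_imply2 (RLint_semigroup a0 c0 T0 (mLp1 p1 T0 Lv)) vu) => t Dt -> ->.
Qed.

Lemma RLspace_compact_embedding a c p T : 0 < a -> 0 < c -> 1 <= p -> 0 < T ->
  compact_embedding (RLspace (a + c) p T) (RLspace_norm (a + c) p T)
    (RLspace a p T) (RLspace_norm a p T).
Proof.
move=> a0 c0 p1 T0; have p0 : 0 < p by exact: lt_le_trans p1.
have ac0 : 0 < a + c by rewrite addr_gt0.
have mRL u : RLspace (a + c) p T u -> measurable_fun (I0 T) u.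
  by move=> [Lu _]; exact: ((LpP T u p0).1 Lu).1.
split.
- move=> u Xu; have [v [Lv vu vu']] := RLspace_split a0 c0 p1 T0 Xu.
  exact: mLp_RLspace a0 p1 T0 (mRL u Xu) (mLp_RLint c0 p1 T0 Lv) vu'.
- exists (RLnorm c T) => u Xu; have [v [Lv vu vu']] := RLspace_split a0 c0 p1 T0 Xu.
  rewrite (RLspace_normE ac0 p1 T0 Lv vu) (RLspace_normE a0 p1 T0 (mLp_RLint c0 p1 T0 Lv) vu').
  have N0 := RLnorm_ge0 T c0.
  have -> : (RLnorm c T)%:E = ((RLnorm c T `^ p)%:E `^ p^-1)%E.
    by rewrite poweR_EFin -powRrM mulfV ?gt_eqF// powRr1.
  rewrite -poweRM ?lee_fin ?powR_ge0 ?energy_ge0//.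
  apply: poweR_le; [by rewrite invr_ge0 ltW|exact: energy_ge0|].
  exact: energy_RLint c0 p1 T0 Lv.1.
move=> u Xu [M HM].
have /choice[v Hv] n := RLspace_split a0 c0 p1 T0 (Xu n).
have Lv n : mLp p T (v n) by have [] := Hv n.
have vM n : (energy p T (v n) <= (M `^ p)%:E)%E.
  have [_ vu _] := Hv n; have := HM n; rewrite (RLspace_normE ac0 p1 T0 (Lv n) vu) => H.
  have := poweR_le (ltW p0) (poweR_ge0 _ _) H.
  by rewrite -poweRrM mulVf ?gt_eqF// poweRe1 ?energy_ge0// poweR_EFin.
have [h [hh [w Lw Hw]]] := RLint_compact c0 p1 T0 Lv vM.
exists h; split => //; exists (RLint a w).
  have mw := measurable_RLint a Lw.1.
  apply: (mLp_RLspace a0 p1 T0 (measurable_funTS mw) Lw).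
  exact: eq_in_ae.
have E n : RLspace_norm a p T (u (h n) \- RLint a w) =
    (energy p T (fun t => RLint c (v (h n)) t - w t)%R `^ p^-1)%E.
  have Lc := mLp_RLint c0 p1 T0 (Lv (h n)).
  apply: (RLspace_normE a0 p1 T0 (mLpB (ltW p0) Lc Lw)).
  have [_ _ vu] := Hv (h n).
  have H := RLintB_ae a0 T0 (mLp1 p1 T0 Lc) (mLp1 p1 T0 Lw).
  by apply: (ae_imply2 H vu) => t Dt -> ->.
under eq_fun do rewrite E.
by apply: cvg_poweR0 => // n; exact: energy_ge0.
Qed.

End riemann_liouville_spaces.

(** * The three assertions, and the weak derivative in the inversion formula *)

Theorem theorem2p1 (R : realType) (T p : R) (m : nat) (sigma alpha eps : R) :
  0 < T -> 1 <= p ->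
  (1 <= m)%N -> 0 < sigma -> sigma < 1 -> alpha = m%:R - 1 + sigma ->
  0 < eps -> eps < alpha ->
  [/\ (exists2 C : R, 0 < C &
         forall v, Lp p T v ->
           slobodecki (alpha - eps) p T (RLint alpha v) /\
           (slobodecki_norm (alpha - eps) p T (RLint alpha v)
              <= C%:E * Lp_norm p T v)%E) /\
      RLspace alpha p T `<=` zeroW (alpha - eps) p T,
      zeroW (alpha + eps) p T `<=` RLspace alpha p T /\
      (forall u, zeroW (alpha + eps) p T u ->
         [/\ exists w, is_wderiv T m (RLint (m%:R - alpha) u) w,
             Lp p T (wderiv T m (RLint (m%:R - alpha) u)) &
             eq_ae0T T (RLint alpha (wderiv T m (RLint (m%:R - alpha) u))) u]) &
      compact_embedding (RLspace (alpha + eps) p T)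
                        (RLspace_norm (alpha + eps) p T)
                        (RLspace alpha p T)
                        (RLspace_norm alpha p T)].
Proof.
move=> T0 p1 m1 s0 s1 alphaE e0 ea; have p0 : 0 < p by exact: lt_le_trans p1.
have a0 : 0 < alpha by exact: lt_trans ea.
have sa : alpha - eps < alpha by rewrite gtrBl.
have se0 : 0 <= alpha - eps by rewrite subr_ge0 ltW.
(* From here on [m] is one less than in the statement: alpha = m + sigma, and the derivative has
   order m + 1. *)
case: m m1 alphaE => // m _; rewrite -natr1 addrK => alphaE.
have key u : zeroW (alpha + eps) p T u ->
    exists2 g, mLp p T g & eq_ae0T T (RLint alpha g) u.
  by move=> zu; rewrite alphaE; apply: (zeroW_RLint T0 p1 s0 s1 _ zu); rewrite alphaE ltrDl.
have mW u : zeroW (alpha + eps) p T u -> measurable_fun (`]0%R, T[%classic : set R) u.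
  by move=> zu; exact: ((LpP T u p0).1 zu.1.1.1).1.
split; last exact: RLspace_compact_embedding.
- split; last exact: RLspace_sub_zeroW.
  have [C C0 HC] := RLint_slobodecki_bound se0 sa p1 T0.
  exists C => // v Lv.
  have mv := ((LpP T v p0).1 Lv).1.
  have H := RLint_restrict alpha mv.
  have Lv' := Lp_mLp p0 Lv.
  have -> : Lp_norm p T v = Lp_norm p T (v \_ (`]0%R, T[%classic : set R)).
    rewrite !(Lp_normE _ _ (lt0r_neq0 p0)); congr poweR; apply: eq_energy => t tD.
    by rewrite patchE tD.
  apply: HC => //.
    apply: eq_measurable_fun (measurable_funTS (measurable_RLint alpha Lv'.1)) => t tD.
    by rewrite H.
  by apply: eq_in_ae => t tD; rewrite H.
split.
  move=> u zu; have [g Lg gu] := key u zu.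
  exact: mLp_RLspace a0 p1 T0 (mW u zu) Lg gu.
move=> u zu; have [g Lg gu] := key u zu; have mu0 := mW u zu.
rewrite natr1; set b := m.+1%:R - alpha.
have b0 : 0 < b by rewrite /b alphaE -natr1; lra.
pose u' := u \_ (`]0%R, T[%classic : set R).
have mu' : measurable_fun setT u' by exact/(measurable_restrictT _ (measurable_itv _)).
have uu' : eq_ae0T T (RLint b u) (RLint b u') by apply: eq_in_ae; exact: RLint_restrict.
have mbu : measurable_fun (`]0%R, T[%classic : set R) (RLint b u).
  apply: eq_measurable_fun (measurable_funTS (measurable_RLint b mu')) => t tD.
  by rewrite (RLint_restrict b mu0).
have Lag := mLp_RLint a0 p1 T0 Lg.
(* Since u = J^alpha g and b + alpha = m + 1, J^b u is J^(m+1) g, whose weak derivative of order m +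
   1 is g; this gives its existence, its integrability and the inversion formula at once. *)
have gbu : eq_ae0T T (RLint m.+1%:R g) (RLint b u).
  have gu' : eq_ae0T T (RLint alpha g) u'.
    by apply: (ae_imply (mu := @lebesgue_measure R) (D := `]0%R, T[%classic) gu) => t Dt ->; rewrite /u' patchE mem_set.
  have H1 := ae_RLint b Lag.1 mu' gu'.
  have H2 := RLint_semigroup b0 a0 T0 (mLp1 p1 T0 Lg).
  rewrite subrK in H2.
  have H12 := ae_imply2 H1 H2 (fun _ _ => @conj _ _).
  by apply: (ae_imply2 H12 uu') => t Dt [h1 h2] h3; rewrite -h2 h1 h3.
have W : is_wderiv T m.+1 (RLint b u) g.
  exact: eq_wderiv mbu gbu (wderiv_RLint_nat m T0 (mLp1 p1 T0 Lg)).
have wg := wderiv_ae T0 W.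
have mw : measurable_fun (`]0%R, T[%classic : set R) (wderiv T m.+1 (RLint b u)).
  exact: is_wderiv_measurable (is_wderiv_wderiv W).
have mgD : measurable_fun (`]0%R, T[%classic : set R) g by exact: measurable_funTS Lg.1.
split.
- by exists g.
- apply/(LpP T _ p0).2; split; first exact: mw.
  by rewrite (ae_energy _ mw mgD wg); exact: Lg.2.
- apply: (ae_imply (mu := @lebesgue_measure R) (D := `]0%R, T[%classic) gu) => t Dt <-.
  apply: (eq_RLint _ _ mw mgD wg).
  by move: Dt; rewrite /= in_itv/= => /andP[_ /ltW].
Qed.
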